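(* Let $k$ be a field and let $n>1$ be an integer. Let $C=M_n(k)^*$ and let $\tilde H(C)$ be one of $H(C)$, $H_\infty(C)$, or $H_d(C)$ for some integer $d\ge 1$. Assume that we are in a tame case, i.e. we are not in the situation where simultaneously $\tilde H(C)=H_1(C)$, $n=2$ and $\operatorname{char}(k)>0$. Let $S$ be the antipode of $\tilde H(C)$. Then the Hopf algebra endomorphisms of $\tilde H(C)$ are of one of the following types: (a) the trivial endomorphism $x\mapsto\varepsilon(x)1$, i.e. the one induced by the coalgebra map $C\xrightarrow{\varepsilon}k\to\tilde H(C)$; (b) $S^{2t}\circ\alpha$, where $\alpha$ is (induced by) a coalgebra automorphism of $C$; (c) $S^{2t+1}\circ T\circ\alpha$, where $\alpha$ is (induced by) a coalgebra automorphism of $C$, and $T$ is (induced by) the transposition map $x^0_{ij}\mapsto x^0_{ji}$ on $C\subset\tilde H(C)$. Here $t$ is an integer, with $t\ge 0$ if $\tilde H=H$ or $\tilde H=H_d$, and $t\in\mathbb Z$ arbitrary if $\tilde H=H_\infty$.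
   Context: All algebras, coalgebras and Hopf algebras are over the field $k$, (co)unital and (co)associative. For a coalgebra $C$: $H(C)$ is the free Hopf algebra on $C$, i.e. the value at $C$ of the left adjoint of the forgetful functor from Hopf algebras to coalgebras; $H_\infty(C)$ is the free Hopf algebra with bijective antipode on $C$, i.e. the value at $C$ of the left adjoint of the forgetful functor from Hopf algebras with bijective antipode to coalgebras; for $d\ge1$, $H_d(C)$ is the value at $C$ of the left adjoint of the forgetful functor from the category of Hopf algebras whose antipode $S$ satisfies $S^{2d}=\mathrm{id}$ to coalgebras. $M_n(k)^*$ is the $n\times n$ matrix coalgebra, with basis $(x^0_{ij})_{i,j=1}^n$, $\Delta(x^0_{ij})=\sum_{l} x^0_{il}\otimes x^0_{lj}$, $\varepsilon(x^0_{ij})=\delta_{ij}$. The canonical coalgebra map $M_n(k)^*\to\tilde H(M_n(k)^* )$ (unit of the adjunction) is injective, and $M_n(k)^*$ is identified with its image. By functoriality and the universal property, a coalgebra endomorphism (resp. antiendomorphism) of $C$ extends uniquely to a Hopf algebra endomorphism (resp. antiendomorphism, i.e. a map reversing both multiplication and comultiplication and commuting with $S$) of $\tilde H(C)$; an (anti)endomorphism of $C$ is identified with the one it induces on $\tilde H(C)$. The transposition $T$ is an antiautomorphism of $C$. *)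

(* Defs.v *)
From HB Require Import structures.
From mathcomp Require Import all_boot all_order all_algebra generic_quotient.
From mathcomp Require Import sesquilinear.
From mathcomp Require Import boolp classical_sets.

Set Implicit Arguments.
Unset Strict Implicit.
Unset Printing Implicit Defensive.

Import GRing.Theory.

Local Open Scope ring_scope.

Notation is_bilinear f := (bilinear_for *:%R *:%R f).

Section LinearFun.
Variable k : fieldType.

Lemma linear_comp_fun (U V W : lmodType k) (f : U -> V) (g : V -> W) :
  linear f -> linear g -> linear (fun x => g (f x)).
Proof. by move=> lf lg a x y; rewrite lf lg. Qed.

Lemma linear_fun_sum (U V : lmodType k) (f : U -> V) (lf : linear f)
    (I : Type) (r : seq I) (P : pred I) (F : I -> U) :
  f (\sum_(i <- r | P i) F i) = \sum_(i <- r | P i) f (F i).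
Proof.
have fD : {morph f : y z / y + z}.
  by move=> y z; rewrite -{1}[y]scale1r lf scale1r.
have f0 : f 0 = 0 by apply: (addIr (f 0)); rewrite -fD !add0r.
exact: big_morph.
Qed.

End LinearFun.

(* V ⊗ W is the quotient of the formal sums of pairs (v, w), encoded as        *)
(* sequences, where two sums are equal when every bilinear map out of V x W,   *)
(* with values in any vector space, takes the same total value on them.        *)
(* [tlift_linear], [tlift_tens] and [tlift_uniq] give the universal property.  *)
Section Tensor.
Variables (k : fieldType) (V W : lmodType k).

Definition fsum (U : nmodType) (f : V -> W -> U) (s : seq (V * W)) : U :=
  \sum_(p <- s) f p.1 p.2.

Definition tensor_eq (s t : seq (V * W)) : bool :=
  `[< forall (U : lmodType k) (f : V -> W -> U),
        is_bilinear f -> fsum f s = fsum f t >].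

Lemma tensor_eq_refl : reflexive tensor_eq.
Proof. by move=> s; apply/asboolP. Qed.

Lemma tensor_eq_sym : symmetric tensor_eq.
Proof.
by move=> s t; apply/asboolP/asboolP => e U f bf; rewrite (e U f bf).
Qed.

Lemma tensor_eq_trans : transitive tensor_eq.
Proof.
move=> t s u /asboolP e1 /asboolP e2; apply/asboolP => U f bf.
by rewrite (e1 U f bf) (e2 U f bf).
Qed.

Canonical tensor_equiv :=
  EquivRel tensor_eq tensor_eq_refl tensor_eq_sym tensor_eq_trans.

Definition tensor : Type := {eq_quot tensor_equiv}%qT.

HB.instance Definition _ := Choice.on tensor.
HB.instance Definition _ := Quotient.on tensor.
HB.instance Definition _ := EqQuotient.on tensor.

Definition tclass (s : seq (V * W)) : tensor := \pi_tensor%qT s.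

Definition tens (v : V) (w : W) : tensor := tclass [:: (v, w)].

(* The linear map induced by f, provided that f is bilinear.                   *)
Definition tlift (U : nmodType) (f : V -> W -> U) (x : tensor) : U :=
  fsum f (repr x).

Lemma tlift_class (U : lmodType k) (f : V -> W -> U) s :
  is_bilinear f -> tlift f (tclass s) = fsum f s.
Proof.
move=> bf; rewrite /tlift /tclass.
have /eqmodP/asboolP e : (repr (\pi_tensor s) = s %[mod tensor])%qT
  by rewrite reprK.
exact: e.
Qed.

Lemma tensor_lift_eq (x y : tensor) :
  (forall (U : lmodType k) (f : V -> W -> U),
     is_bilinear f -> tlift f x = tlift f y) -> x = y.
Proof.
move=> e; rewrite -[x]reprK -[y]reprK.
by apply/eqmodP/asboolP => U f bf; apply: e.
Qed.

Definition tscale_seq (a : k) (s : seq (V * W)) := [seq (a *: p.1, p.2) | p <- s].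

Definition tzero : tensor := tclass [::].
Definition tadd (x y : tensor) : tensor := tclass (repr x ++ repr y).
Definition tscale (a : k) (x : tensor) : tensor := tclass (tscale_seq a (repr x)).
Definition topp (x : tensor) : tensor := tscale (-1) x.

Section LiftOp.
Variables (U : lmodType k) (f : V -> W -> U).
Hypothesis bf : is_bilinear f.

Lemma tlift_tzero : tlift f tzero = 0.
Proof. by rewrite tlift_class // /fsum big_nil. Qed.

Lemma tlift_tadd x y : tlift f (tadd x y) = tlift f x + tlift f y.
Proof. by rewrite tlift_class // /fsum big_cat. Qed.

Lemma tlift_tscale a x : tlift f (tscale a x) = a *: tlift f x.
Proof.
rewrite tlift_class // /tlift /fsum big_map scaler_sumr.
apply: eq_bigr => p _ /=.
exact: (scalable_linear (bf.1 p.2)).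
Qed.

Lemma tlift_topp x : tlift f (topp x) = - tlift f x.
Proof. by rewrite tlift_tscale scaleN1r. Qed.

End LiftOp.

Lemma taddA : associative tadd.
Proof.
by move=> x y z; apply: tensor_lift_eq => U f bf; rewrite !tlift_tadd ?addrA.
Qed.

Lemma taddC : commutative tadd.
Proof.
by move=> x y; apply: tensor_lift_eq => U f bf; rewrite !tlift_tadd // addrC.
Qed.

Lemma tadd0 : left_id tzero tadd.
Proof.
move=> x; apply: tensor_lift_eq => U f bf.
by rewrite tlift_tadd // tlift_tzero // add0r.
Qed.

Lemma taddN : left_inverse tzero topp tadd.
Proof.
move=> x; apply: tensor_lift_eq => U f bf.
by rewrite tlift_tadd // tlift_topp // tlift_tzero // addNr.
Qed.

HB.instance Definition _ := GRing.isZmodule.Build tensor taddA taddC tadd0 taddN.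

Lemma tscaleA a b x : tscale a (tscale b x) = tscale (a * b) x.
Proof.
by apply: tensor_lift_eq => U f bf; rewrite !tlift_tscale // scalerA.
Qed.

Lemma tscale1 : left_id 1 tscale.
Proof.
by move=> x; apply: tensor_lift_eq => U f bf; rewrite tlift_tscale // scale1r.
Qed.

Lemma tscaleDr : right_distributive tscale +%R.
Proof.
move=> a x y; apply: tensor_lift_eq => U f bf.
by rewrite !(tlift_tscale, tlift_tadd) // scalerDr.
Qed.

Lemma tscaleDl x : {morph tscale^~ x : a b / a + b}.
Proof.
move=> a b; apply: tensor_lift_eq => U f bf.
by rewrite !(tlift_tscale, tlift_tadd) // scalerDl.
Qed.

HB.instance Definition _ :=
  GRing.Zmodule_isLmodule.Build k tensor tscaleA tscale1 tscaleDr tscaleDl.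

Lemma tlift_linear (U : lmodType k) (f : V -> W -> U) :
  is_bilinear f -> linear (tlift f).
Proof. by move=> bf a x y; rewrite tlift_tadd // tlift_tscale. Qed.

Lemma tlift_tens (U : lmodType k) (f : V -> W -> U) v w :
  is_bilinear f -> tlift f (tens v w) = f v w.
Proof. by move=> bf; rewrite tlift_class // /fsum big_seq1. Qed.

Lemma tens_bilinear : is_bilinear tens.
Proof.
by split=> [w|v] a x y; apply: tensor_lift_eq => U f bf;
  rewrite tlift_linear // !tlift_tens //; [apply: bf.1|apply: bf.2].
Qed.

Lemma tensor_sumE (x : tensor) : x = \sum_(p <- repr x) tens p.1 p.2.
Proof.
apply: tensor_lift_eq => U f bf.
rewrite (linear_fun_sum (tlift_linear bf)) {1}/tlift /fsum.
by apply: eq_bigr => p _; rewrite tlift_tens.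
Qed.

Lemma tlift_uniq (U : lmodType k) (f : V -> W -> U) (g : tensor -> U) :
  is_bilinear f -> linear g -> (forall v w, g (tens v w) = f v w) ->
  g =1 tlift f.
Proof.
move=> bf lg eg x.
rewrite [in LHS](tensor_sumE x) (linear_fun_sum lg).
by rewrite /tlift /fsum; apply: eq_bigr => p _; rewrite eg.
Qed.

End Tensor.

Arguments tens {k V W} v w.
Arguments tlift {k V W U} f x.

Notation "v ⊗ w" := (tens v w) (at level 40, left associativity) : ring_scope.

Section TensorMaps.
Variable k : fieldType.

Definition tmap (V W V' W' : lmodType k) (f : V -> V') (g : W -> W') :
  tensor V W -> tensor V' W' := tlift (fun v w => f v ⊗ g w).

Definition tswap (V W : lmodType k) : tensor V W -> tensor W V :=
  tlift (fun v w => w ⊗ v).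

Definition tassoc (U V W : lmodType k) :
  tensor U (tensor V W) -> tensor (tensor U V) W :=
  tlift (fun u => tlift (fun v w => (u ⊗ v) ⊗ w)).

Definition tmul (A B : algType k) (x y : tensor A B) : tensor A B :=
  tlift (fun a b => tlift (fun a' b' => (a * a') ⊗ (b * b')) y) x.

Let tensDl (V W : lmodType k) (a : k) (v v' : V) (w : W) :
  (a *: v + v') ⊗ w = a *: (v ⊗ w) + v' ⊗ w.
Proof. exact: (tens_bilinear V W).1. Qed.

Let tensDr (V W : lmodType k) (a : k) (v : V) (w w' : W) :
  v ⊗ (a *: w + w') = a *: (v ⊗ w) + v ⊗ w'.
Proof. exact: (tens_bilinear V W).2. Qed.

Lemma tens_suml (V W : lmodType k) (I : Type) (r : seq I) (F : I -> V) (w : W) :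
  (\sum_(i <- r) F i) ⊗ w = \sum_(i <- r) F i ⊗ w.
Proof. exact: (linear_fun_sum ((tens_bilinear V W).1 w)). Qed.

Lemma tens_sumr (V W : lmodType k) (I : Type) (r : seq I) (v : V) (F : I -> W) :
  v ⊗ (\sum_(i <- r) F i) = \sum_(i <- r) v ⊗ F i.
Proof. exact: (linear_fun_sum ((tens_bilinear V W).2 v)). Qed.

Let tmap_bilinear (V W V' W' : lmodType k) (f : V -> V') (g : W -> W') :
  linear f -> linear g -> is_bilinear (fun v w => f v ⊗ g w).
Proof.
by move=> lf lg; split=> [u|u] a x y /=; [rewrite lf tensDl|rewrite lg tensDr].
Qed.

Lemma tmap_linear (V W V' W' : lmodType k) (f : V -> V') (g : W -> W') :
  linear f -> linear g -> linear (tmap f g).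
Proof. by move=> lf lg; apply/tlift_linear/tmap_bilinear. Qed.

Lemma tmap_tens (V W V' W' : lmodType k) (f : V -> V') (g : W -> W') v w :
  linear f -> linear g -> tmap f g (v ⊗ w) = f v ⊗ g w.
Proof. by move=> lf lg; apply/tlift_tens/tmap_bilinear. Qed.

Lemma tswap_tens (V W : lmodType k) (v : V) (w : W) :
  tswap (v ⊗ w) = w ⊗ v.
Proof.
apply: tlift_tens.
by split=> [u|u] a x y /=; [rewrite tensDr|rewrite tensDl].
Qed.

Let tassoc_bilinear1 (U V W : lmodType k) (u : U) :
  is_bilinear (fun (v : V) (w : W) => (u ⊗ v) ⊗ w).
Proof. by split=> [z|z] a y y' /=; rewrite ?tensDr // tensDl. Qed.

Let tassoc_bilinear (U V W : lmodType k) :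
  is_bilinear (fun u : U => tlift (fun (v : V) (w : W) => (u ⊗ v) ⊗ w)).
Proof.
split=> [x|x] a y y' /=; last exact/tlift_linear/tassoc_bilinear1.
rewrite /tlift /fsum scaler_sumr -big_split /=.
by apply: eq_bigr => p _; rewrite !tensDl.
Qed.

Lemma tassoc_linear (U V W : lmodType k) : linear (@tassoc U V W).
Proof. exact/tlift_linear/tassoc_bilinear. Qed.

Lemma tassoc_tens (U V W : lmodType k) (u : U) (v : V) (w : W) :
  tassoc (u ⊗ (v ⊗ w)) = (u ⊗ v) ⊗ w.
Proof.
rewrite /tassoc tlift_tens; last exact: tassoc_bilinear.
by rewrite tlift_tens //; apply: tassoc_bilinear1.
Qed.

Lemma tmul_tens (A B : algType k) (a a' : A) (b b' : B) :
  tmul (a ⊗ b) (a' ⊗ b') = (a * a') ⊗ (b * b').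
Proof.
have b1 (x : A) (y : B) :
    is_bilinear (fun (a' : A) (b' : B) => (x * a') ⊗ (y * b')).
  split=> [z|z] c t t' /=.
    by rewrite mulrDr -scalerAr tensDl.
  by rewrite mulrDr -scalerAr tensDr.
rewrite /tmul tlift_tens ?tlift_tens //.
split=> [x|x] c y y' /=; rewrite /tlift /fsum scaler_sumr -big_split /=;
  apply: eq_bigr => p _.
  by rewrite mulrDl -scalerAl tensDl.
by rewrite mulrDl -scalerAl tensDr.
Qed.

End TensorMaps.

HB.mixin Record Lmodule_isCoalgebra (k : fieldType) V of GRing.Lmodule k V := {
  comul : V -> tensor V V;
  counit : V -> k;
  comul_linear : linear comul;
  counit_linear : linear_for *%R counit;
  comulA : forall x, tassoc (tmap idfun comul (comul x)) = tmap comul idfun (comul x);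
  counitl : forall x, tlift (fun y z => counit y *: z) (comul x) = x;
  counitr : forall x, tlift (fun y z => counit z *: y) (comul x) = x
}.

#[short(type="coalgType")]
HB.structure Definition Coalgebra (k : fieldType) :=
  {V of GRing.Lmodule k V & Lmodule_isCoalgebra k V}.

HB.mixin Record Algebra_isBialgebra (k : fieldType) A
    of GRing.Algebra k A & Coalgebra k A := {
  comul1 : comul (1 : A) = 1 ⊗ 1;
  comulM : forall x y : A, comul (x * y) = tmul (comul x) (comul y);
  counit1 : counit (1 : A) = 1;
  counitM : forall x y : A, counit (x * y) = counit x * counit y
}.

#[short(type="bialgType")]
HB.structure Definition Bialgebra (k : fieldType) :=
  {A of GRing.Algebra k A & Coalgebra k A & Algebra_isBialgebra k A}.

HB.mixin Record Bialgebra_isHopf (k : fieldType) H of Bialgebra k H := {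
  antipode : H -> H;
  antipode_linear : linear antipode;
  antipodel : forall x, tlift (fun y z => antipode y * z) (comul x) = (counit x)%:A;
  antipoder : forall x, tlift (fun y z => y * antipode z) (comul x) = (counit x)%:A
}.

#[short(type="hopfType")]
HB.structure Definition Hopf (k : fieldType) :=
  {H of Bialgebra k H & Bialgebra_isHopf k H}.

Section Morphisms.
Variable k : fieldType.

Definition coalg_morphism (C D : coalgType k) (f : C -> D) : Prop :=
  [/\ linear f,
      forall x, comul (f x) = tmap f f (comul x)
    & forall x, counit (f x) = counit x].

Definition coalg_automorphism (C : coalgType k) (f : C -> C) : Prop :=
  coalg_morphism f /\ bijective f.

Definition hopf_morphism (H K : hopfType k) (f : H -> K) : Prop :=
  [/\ coalg_morphism f, monoid_morphism f
    & forall x, f (antipode x) = antipode (f x)].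

Definition hopf_antimorphism (H K : hopfType k) (f : H -> K) : Prop :=
  [/\ linear f,
      f 1 = 1 /\ (forall x y, f (x * y) = f y * f x),
      forall x, comul (f x) = tswap (tmap f f (comul x)),
      forall x, counit (f x) = counit x
    & forall x, f (antipode x) = antipode (f x)].

End Morphisms.

Section AntipodePowers.
Variables (k : fieldType) (H : hopfType k).

(* The inverse of the antipode when the latter is bijective, see               *)
(* [antipode_invK]; an unspecified function otherwise.                         *)
Definition antipode_inv (x : H) : H := xget 0 [set y | antipode y = x]%classic.

Definition antipode_pow (m : int) : H -> H :=
  match m with
  | Posz j => iter j antipode
  | Negz j => iter j.+1 antipode_inv
  end.

Lemma antipode_invK : bijective (@antipode k H) ->
  cancel (@antipode k H) antipode_inv /\ cancel antipode_inv (@antipode k H).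
Proof.
move=> [g gK Kg].
have invK : cancel antipode_inv (@antipode k H).
  move=> x; rewrite /antipode_inv.
  by apply: (@xgetPex _ 0 [set y | antipode y = x]%classic); exists (g x).
by split=> // x; apply: (can_inj gK); rewrite invK.
Qed.

End AntipodePowers.

(* The full subcategories of Hopf algebras: all of them, those with bijective  *)
(* antipode, and those with S^{2d} = id. Their free objects on a coalgebra are *)
(* H, H_oo and H_d respectively.                                               *)
Variant hopf_class := AllHopf | BijHopf | FinOrdHopf of nat.

Definition in_class (k : fieldType) (c : hopf_class) (H : hopfType k) : Prop :=
  match c with
  | AllHopf => True
  | BijHopf => bijective (@antipode k H)
  | FinOrdHopf d => forall x : H, iter (2 * d) antipode x = x
  end.

Section FreeHopf.
Variables (k : fieldType) (c : hopf_class) (C : coalgType k) (H : hopfType k).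

Definition valid_class : Prop :=
  if c is FinOrdHopf d then (0 < d)%N else True.

Definition exponent_range (t : int) : Prop :=
  if c is BijHopf then True else 0 <= t.

(* H, together with i as unit of the adjunction, is the value at C of the left *)
(* adjoint of the forgetful functor from the class c to coalgebras.            *)
Definition is_free_hopf (i : C -> H) : Prop :=
  [/\ in_class c H, coalg_morphism i
    & forall K : hopfType k, in_class c K ->
      forall f : C -> K, coalg_morphism f ->
      exists! g : H -> K, hopf_morphism g /\ g \o i =1 f].

(* f is the (anti)endomorphism of H identified with a : C -> C.                *)
Definition induced_endo (i : C -> H) (a : C -> C) (f : H -> H) : Prop :=
  hopf_morphism f /\ f \o i =1 i \o a.

Definition induced_antiendo (i : C -> H) (a : C -> C) (f : H -> H) : Prop :=
  hopf_antimorphism f /\ f \o i =1 i \o a.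

End FreeHopf.

(* M_n(k)^*, with A standing for \sum_(i, j) A i j *: x_ij.                    *)
Section MatrixCoalgebra.
Variables (k : fieldType) (n : nat).

Definition mxcoalg : Type := 'M[k]_n.

HB.instance Definition _ := GRing.Lmodule.copy mxcoalg 'M[k]_n.

Definition mxgen (i j : 'I_n) : mxcoalg := delta_mx i j.

Definition mx_comul (A : mxcoalg) : tensor mxcoalg mxcoalg :=
  \sum_(i < n) \sum_(j < n) (A : 'M_n) i j *: \sum_(l < n) mxgen i l ⊗ mxgen l j.

Definition mx_counit (A : mxcoalg) : k :=
  \sum_(i < n) \sum_(j < n) (A : 'M_n) i j * (i == j)%:R.

Definition mx_transpose (A : mxcoalg) : mxcoalg := (A : 'M_n)^T.

Lemma mx_comul_linear : linear mx_comul.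
Proof.
move=> a A B; rewrite /mx_comul scaler_sumr -big_split; apply: eq_bigr => i _ /=.
rewrite scaler_sumr -big_split; apply: eq_bigr => j _ /=.
by rewrite !mxE scalerDl scalerA.
Qed.

Lemma mx_counit_linear : linear_for *%R mx_counit.
Proof.
move=> a A B; rewrite /mx_counit mulr_sumr -big_split; apply: eq_bigr => i _ /=.
rewrite mulr_sumr -big_split; apply: eq_bigr => j _ /=.
by rewrite !mxE mulrDl mulrA.
Qed.

Lemma mx_sum_delta (U : lmodType k) (F : 'I_n -> 'I_n -> U) i j :
  \sum_(p < n) \sum_(q < n) (delta_mx i j : 'M[k]_n) p q *: F p q = F i j.
Proof.
rewrite (bigD1 i) //= (bigD1 j) //= !mxE !eqxx scale1r.
rewrite big1 ?addr0 => [|q /negPf qj]; last by rewrite mxE qj andbF scale0r.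
rewrite big1 ?addr0 // => p /negPf pi; rewrite big1 // => q _.
by rewrite mxE pi scale0r.
Qed.

Lemma mx_comul_gen i j :
  mx_comul (mxgen i j) = \sum_(l < n) mxgen i l ⊗ mxgen l j.
Proof.
exact: (mx_sum_delta (fun p q => \sum_(l < n) mxgen p l ⊗ mxgen l q)).
Qed.

Lemma mx_counit_gen i j : mx_counit (mxgen i j) = (i == j)%:R.
Proof. exact: (mx_sum_delta (fun p q => (p == q)%:R : k^o)). Qed.

Lemma mx_transpose_gen i j : mx_transpose (mxgen i j) = mxgen j i.
Proof. exact: trmx_delta. Qed.

Lemma mx_ext (U : lmodType k) (f g : mxcoalg -> U) : linear f -> linear g ->
  (forall i j, f (mxgen i j) = g (mxgen i j)) -> f =1 g.
Proof.
move=> lf lg e A.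
have -> : A = \sum_(i < n) \sum_(j < n) (A : 'M_n) i j *: mxgen i j.
  exact: (@matrix_sum_delta k n n A).
rewrite (linear_fun_sum lf) (linear_fun_sum lg); apply: eq_bigr => i _.
rewrite (linear_fun_sum lf) (linear_fun_sum lg); apply: eq_bigr => j _.
by rewrite (scalable_linear lf) (scalable_linear lg) /= e.
Qed.

Lemma mx_comulA A :
  tassoc (tmap idfun mx_comul (mx_comul A)) =
  tmap mx_comul idfun (mx_comul A).
Proof.
have lC := mx_comul_linear.
have lid : linear (@idfun mxcoalg) by [].
apply: (mx_ext (f := fun A => tassoc (tmap idfun mx_comul (mx_comul A)))
               (g := fun A => tmap mx_comul idfun (mx_comul A))).
- apply: linear_comp_fun (@tassoc_linear _ _ _ _).
  exact: linear_comp_fun lC (tmap_linear lid lC).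
- exact: linear_comp_fun lC (tmap_linear lC lid).
move=> i j; rewrite mx_comul_gen.
rewrite !(linear_fun_sum (tmap_linear _ _)) // linear_fun_sum; last first.
  exact: tassoc_linear.
transitivity (\sum_(l < n) \sum_(m < n)
    (mxgen i l ⊗ mxgen l m) ⊗ mxgen m j); last first.
  rewrite exchange_big; apply: eq_bigr => m _ /=.
  by rewrite tmap_tens // mx_comul_gen tens_suml.
apply: eq_bigr => l _; rewrite tmap_tens // mx_comul_gen tens_sumr.
rewrite linear_fun_sum; last exact: tassoc_linear.
by apply: eq_bigr => m _; rewrite tassoc_tens.
Qed.

Lemma mx_counitl A : tlift (fun y z => mx_counit y *: z) (mx_comul A) = A.
Proof.
have bf : is_bilinear (fun y z : mxcoalg => mx_counit y *: z).
  split=> [z|z] a x y /=; first by rewrite mx_counit_linear scalerDl scalerA.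
  by rewrite scalerDr !scalerA mulrC.
apply: (mx_ext (f := fun A => tlift (fun y z => mx_counit y *: z) (mx_comul A))
               (g := idfun)) => //.
  exact: linear_comp_fun mx_comul_linear (tlift_linear bf).
move=> i j; rewrite mx_comul_gen (linear_fun_sum (tlift_linear bf)) (bigD1 i) //=.
rewrite tlift_tens // mx_counit_gen eqxx scale1r big1 ?addr0 // => l /negPf li.
by rewrite tlift_tens // mx_counit_gen eq_sym li scale0r.
Qed.

Lemma mx_counitr A : tlift (fun y z => mx_counit z *: y) (mx_comul A) = A.
Proof.
have bf : is_bilinear (fun y z : mxcoalg => mx_counit z *: y).
  split=> [z|z] a x y /=; last by rewrite mx_counit_linear scalerDl scalerA.
  by rewrite scalerDr !scalerA mulrC.
apply: (mx_ext (f := fun A => tlift (fun y z => mx_counit z *: y) (mx_comul A))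
               (g := idfun)) => //.
  exact: linear_comp_fun mx_comul_linear (tlift_linear bf).
move=> i j; rewrite mx_comul_gen (linear_fun_sum (tlift_linear bf)) (bigD1 j) //=.
rewrite tlift_tens // mx_counit_gen eqxx scale1r big1 ?addr0 // => l /negPf li.
by rewrite tlift_tens // mx_counit_gen li scale0r.
Qed.

HB.instance Definition _ := Lmodule_isCoalgebra.Build k mxcoalg
  mx_comul_linear mx_counit_linear mx_comulA mx_counitl mx_counitr.

End MatrixCoalgebra.

(* Main.v *)
Require Import Defs.
From HB Require Import structures.
From mathcomp Require Import all_boot all_order all_algebra.
From mathcomp Require Import generic_quotient sesquilinear boolp zify.

Set Implicit Arguments.
Unset Strict Implicit.
Unset Printing Implicit Defensive.

Import GRing.Theory.

Local Open Scope ring_scope.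

(** Let K be the algebra generated by the entries of n x n matrices X_m, where m
runs over a set M with an injective successor s, subject to
X_m X_(s m)^T = 1 = X_(s m)^T X_m. It is a Hopf algebra in which every X_m is
comultiplicative and S(X_m) = X_(s m)^T. When M is the natural numbers, the
integers, or the residues modulo 2d, with m standing for the m-th power of the
antipode, the universal property makes the free Hopf algebra on the matrix
coalgebra a retract of K ([comparison]). An endomorphism phi is determined by its
restriction to the generators, that is, by a comultiplicative n x n matrix Y over
K, and the theorem is a classification of these matrices
([comatrix_classification]).

K is understood through a basis of irreducible words, given by a diamond lemma
([nf_ext_invariant]): a function on irreducible words extends to a functional on K.
A functional on words of length r that kills the leading parts of the relations
extends without change on words of length at most r ([nf_ext_homogeneous]). On the
words with given types t = (m_1, ..., m_r) such a functional is a matrix B with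
rows and columns indexed by lists of r indices; the relations say that the columns
of B vanish under contraction at the pairs (s m, m) of t, and its rows at the pairs
(m, s m). Since Y is comultiplicative, the values B(Y) multiply like the B.

Let r be the degree of Y, and suppose r >= 2. There are more than n pairs of a
column u and a row q satisfying these conditions, with q_x u_y = 0 for x <> y and
q_x u_x invertible. Then the values of the matrices u_x q_x at Y are orthogonal
idempotents of M_n(k) up to invertible scalars, so one of them is zero
([orthogonal_idempotents_vanish]); as all rank-one B factor through it, and every B
is a sum of rank-one ones, all functionals of degree r vanish at Y, which is absurd
([valmx_word_indic0], [top_vanish]). The required pairs are indicators of the
alternating lists x y x y ..., for which n(n-1) > n when n > 2. When n = 2 one more
pair is needed; it is supported on alternating lists with one error, and its
self-pairing is the length of a run of types at which both kinds of contraction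
occur. That length is 1 unless s (s m) = m, so it is invertible except possibly
for d = 1 in positive characteristic: this is the use of tameness
([block_len_neq0]).

So Y has degree at most 1, and its coordinates on the letters of a fixed type m are
matrix units E_ij in M_n(k). If they vanish for all m, then Y is scalar, hence the
identity matrix, and phi is trivial. If they are nonzero for one m, they leave room
for no other m and for no constant term, and Y = sum E_ij (X_m)_ij. Matrix units of
M_n(k) are conjugate to the standard ones, so phi is an automorphism of the matrix
coalgebra followed by the power m of the antipode, with a transposition if m is odd
([unit_map_auto], [endomorphisms]). *)

(** * Linear and bilinear maps on tensor products *)

Section Linear.
Variable k : fieldType.
Implicit Types U V W : lmodType k.

Lemma lin_scale U V (f : U -> V) : linear f -> forall a x, f (a *: x) = a *: f x.
Proof. by move=> lf; apply: scalable_linear. Qed.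

Lemma lin0 U V (f : U -> V) : linear f -> f 0 = 0.
Proof. by move=> lf; rewrite -[0](scale0r 0) lin_scale // !scale0r. Qed.

Lemma lin_sum U V (f : U -> V) (I : Type) (r : seq I) (P : pred I) (F : I -> U) :
  linear f -> f (\sum_(i <- r | P i) F i) = \sum_(i <- r | P i) f (F i).
Proof. by move=> lf; apply: linear_fun_sum. Qed.

Lemma bilinear_intro U V W (f : U -> V -> W) :
  (forall v, linear (f^~ v)) -> (forall u, linear (f u)) -> is_bilinear f.
Proof. by move=> l1 l2; split=> x; [apply: l1 | apply: l2]. Qed.

Lemma bilin_l U V W (f : U -> V -> W) v : is_bilinear f -> linear (f^~ v).
Proof. by move=> bf; apply: bf.1. Qed.

Lemma bilin_r U V W (f : U -> V -> W) u : is_bilinear f -> linear (f u).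
Proof. by move=> bf; apply: bf.2. Qed.

Lemma scale_forml_bilinear V W (f : V -> k) : linear_for *%R f ->
  is_bilinear (fun (y : V) (z : W) => f y *: z).
Proof.
move=> lf; apply: bilinear_intro => [z|y] a u v.
  by rewrite lf scalerDl scalerA.
by rewrite scalerDr !scalerA mulrC.
Qed.

Lemma scale_formr_bilinear V W (f : W -> k) : linear_for *%R f ->
  is_bilinear (fun (y : V) (z : W) => f z *: y).
Proof.
move=> lf; apply: bilinear_intro => [z|y] a u v.
  by rewrite scalerDr !scalerA mulrC.
by rewrite lf scalerDl scalerA.
Qed.

Lemma tens_lin_l V W (w : W) : linear (fun v : V => v ⊗ w).
Proof. exact: (bilin_l _ (tens_bilinear V W)). Qed.

Lemma tens_lin_r V W (v : V) : linear (fun w : W => v ⊗ w).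
Proof. exact: (bilin_r _ (tens_bilinear V W)). Qed.

Lemma bilin_comp U V W U' V' (f : U -> V -> W) (g : U' -> U) (h : V' -> V) :
  is_bilinear f -> linear g -> linear h -> is_bilinear (fun x y => f (g x) (h y)).
Proof.
move=> bf lg lh; apply: bilinear_intro => [v|u] a x y /=.
  by rewrite lg (bilin_l _ bf).
by rewrite lh (bilin_r _ bf).
Qed.

Lemma bilin_post U V W W' (f : U -> V -> W) (g : W -> W') :
  is_bilinear f -> linear g -> is_bilinear (fun x y => g (f x y)).
Proof.
move=> bf lg; apply: bilinear_intro => [v|u] a x y /=.
  by rewrite (bilin_l _ bf) lg.
by rewrite (bilin_r _ bf) lg.
Qed.

Lemma tensor_ext V W U (f g : tensor V W -> U) : linear f -> linear g ->
  (forall v w, f (v ⊗ w) = g (v ⊗ w)) -> f =1 g.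
Proof.
move=> lf lg e x; rewrite (tensor_sumE x) !lin_sum //.
by apply: eq_bigr => p _; apply: e.
Qed.

Lemma tmap_comp V W V' W' V'' W'' (f : V -> V') (g : W -> W')
    (f' : V' -> V'') (g' : W' -> W'') :
  linear f -> linear g -> linear f' -> linear g' ->
  forall x, tmap f' g' (tmap f g x) = tmap (fun v => f' (f v)) (fun w => g' (g w)) x.
Proof.
move=> lf lg lf' lg'; have l1 := linear_comp_fun lf lf'.
have l2 := linear_comp_fun lg lg'.
apply: tensor_ext; last by move=> v w; rewrite !tmap_tens.
  by apply: linear_comp_fun; apply: tmap_linear.
exact: tmap_linear.
Qed.

Lemma eq_tlift V W U (f g : V -> W -> U) : f =2 g -> tlift f =1 tlift g.
Proof. by move=> e x; rewrite /tlift /fsum; apply: eq_bigr => p _; rewrite e. Qed.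

Lemma eq_tmap V W V' W' (f f' : V -> V') (g g' : W -> W') :
  f =1 f' -> g =1 g' -> tmap f g =1 tmap f' g'.
Proof. by move=> e e'; apply: eq_tlift => v w; rewrite e e'. Qed.

Lemma tmap_id V W (f : V -> V) (g : W -> W) : f =1 id -> g =1 id -> tmap f g =1 id.
Proof.
move=> ef eg x.
rewrite (eq_tmap ef eg).
by apply: (tensor_ext (g := id)) => [||v w]; rewrite ?tmap_tens //; apply: tmap_linear.
Qed.

Lemma tswap_linear V W : linear (@tswap k V W).
Proof.
apply: tlift_linear; apply: bilinear_intro => [v|v].
  exact: tens_lin_r.
exact: tens_lin_l.
Qed.

Lemma tswapK V W : cancel (@tswap k V W) (@tswap k W V).
Proof.
move=> x; apply: (tensor_ext (f := fun x => tswap (tswap x)) (g := id)) => [||v w] //.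
  by apply: linear_comp_fun; apply: tswap_linear.
by rewrite !tswap_tens.
Qed.

Lemma tswap_tmap V W V' W' (f : V -> V') (g : W -> W') : linear f -> linear g ->
  forall x, tswap (tmap f g x) = tmap g f (tswap x).
Proof.
move=> lf lg; have lS := @tswap_linear.
apply: tensor_ext => [||v w]; last by rewrite tmap_tens // !tswap_tens tmap_tens.
  by apply: linear_comp_fun (lS _ _); apply: tmap_linear.
by apply: linear_comp_fun (lS _ _) _; apply: tmap_linear.
Qed.

Lemma mulr_bilinear (A : algType k) : is_bilinear (fun a b : A => a * b).
Proof.
apply: bilinear_intro => [v|u] a x y; first by rewrite mulrDl scalerAl.
by rewrite mulrDr scalerAr.
Qed.

Section Tmul.
Variables A B : algType k.

Let b1 (x : A) (y : B) :
  is_bilinear (fun (a' : A) (b' : B) => (x * a') ⊗ (y * b')).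
Proof.
by apply: bilin_comp (tens_bilinear A B) _ _; apply: (bilin_r _ (mulr_bilinear _)).
Qed.

Let b2 (y : tensor A B) :
  is_bilinear (fun (a : A) (b : B) => tlift (fun a' b' => (a * a') ⊗ (b * b')) y).
Proof.
have l1 (v : B) : linear (fun a : A =>
    tlift (fun (a' : A) (b' : B) => (a * a') ⊗ (v * b')) y).
  move=> a x x'; rewrite /tlift /fsum scaler_sumr -big_split /=.
  by apply: eq_bigr => p _; rewrite (bilin_l _ (mulr_bilinear _)) tens_lin_l.
have l2 (u : A) : linear (fun b : B =>
    tlift (fun (a' : A) (b' : B) => (u * a') ⊗ (b * b')) y).
  move=> a x x'; rewrite /tlift /fsum scaler_sumr -big_split /=.
  by apply: eq_bigr => p _; rewrite (bilin_l _ (mulr_bilinear _)) tens_lin_r.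
exact: bilinear_intro.
Qed.

Lemma tmul_bilinear : is_bilinear (@tmul k A B).
Proof.
apply: bilinear_intro => [y|x].
  exact: tlift_linear (b2 y).
move=> a y y'; rewrite /tmul [X in X = _]/tlift /fsum.
rewrite [in X in _ = X]/tlift /fsum scaler_sumr -big_split /=.
by apply: eq_bigr => p _; rewrite (tlift_linear (b1 _ _)).
Qed.

Lemma tmulA : associative (@tmul k A B).
Proof.
have lr x := bilin_r x tmul_bilinear; have ll y := bilin_l y tmul_bilinear.
move=> x y z; move: x; apply: tensor_ext => [||a b] //.
  exact: linear_comp_fun (ll _) (ll _).
move: y; apply: tensor_ext => [||a' b'] //.
- exact: linear_comp_fun (ll _) (lr _).
- exact: linear_comp_fun (lr _) (ll _).
move: z; apply: tensor_ext => [||a'' b''] //.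
- exact: linear_comp_fun (lr _) (lr _).
by rewrite !tmul_tens !mulrA.
Qed.

Lemma tmul1x : left_id (1 ⊗ 1) (@tmul k A B).
Proof.
apply: tensor_ext => [||a b] //; first exact: (bilin_r _ tmul_bilinear).
by rewrite tmul_tens !mul1r.
Qed.

Lemma tmulx1 : right_id (1 ⊗ 1) (@tmul k A B).
Proof.
apply: tensor_ext => [||a b] //; first exact: (bilin_l _ tmul_bilinear).
by rewrite tmul_tens !mulr1.
Qed.

End Tmul.
End Linear.

(** * Convolution and the antipode *)

Section Convolution.
Variables (k : fieldType) (D : coalgType k) (A : lmodType k).
Variables (mu : A -> A -> A) (e : A).
Hypotheses (mu_bil : is_bilinear mu) (muA : associative mu).
Hypotheses (mu1x : left_id e mu) (mux1 : right_id e mu).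

(** The product mu is a parameter because convolutions with values in the tensor
square are needed as well, where the product is [tmul]. *)
Definition conv (f g : D -> A) (x : D) : A := tlift (fun y z => mu (f y) (g z)) (comul x).
Definition conv_unit (x : D) : A := counit x *: e.

Let cl := @comul_linear k D.

Lemma conv_unit_linear : linear conv_unit.
Proof. by move=> a x y; rewrite /conv_unit counit_linear scalerDl scalerA. Qed.

Lemma conv_bilinear (f g : D -> A) : linear f -> linear g ->
  is_bilinear (fun y z => mu (f y) (g z)).
Proof. by move=> lf lg; apply: bilin_comp. Qed.

Lemma conv_linear f g : linear f -> linear g -> linear (conv f g).
Proof.
move=> lf lg; apply: linear_comp_fun cl _.
by apply/tlift_linear/conv_bilinear.
Qed.

Lemma eq_conv f f' g g' : f =1 f' -> g =1 g' -> conv f g =1 conv f' g'.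
Proof. by move=> ef eg x; apply: eq_tlift => y z; rewrite ef eg. Qed.

(** Both sides are the same trilinear map, applied to one of the two iterated
coproducts of x. *)
Lemma convA f g h : linear f -> linear g -> linear h ->
  conv f (conv g h) =1 conv (conv f g) h.
Proof.
move=> lf lg lh x.
have lfg := tlift_linear (conv_bilinear lf lg).
have lgh := tlift_linear (conv_bilinear lg lh).
have lid : linear (@idfun D) by [].
pose L := tlift (fun t z => mu (tlift (fun a b => mu (f a) (g b)) t) (h z)).
have bL : is_bilinear (fun t z => mu (tlift (fun a b => mu (f a) (g b)) t) (h z)).
  exact: bilin_comp.
have lL : linear L := tlift_linear bL.
pose R := tlift (fun a t => mu (f a) (tlift (fun b c => mu (g b) (h c)) t)).
have bR : is_bilinear (fun a t => mu (f a) (tlift (fun b c => mu (g b) (h c)) t)).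
  exact: bilin_comp.
have lR : linear R := tlift_linear bR.
have -> : conv f (conv g h) x = R (tmap idfun (@comul k D) (comul x)).
  change (tlift (fun y z => mu (f y) (conv g h z)) (comul x) =
    R (tmap idfun (@comul k D) (comul x))).
  move: (comul x); apply: tensor_ext => [||v w].
  - by apply: tlift_linear; apply: bilin_comp => //; apply: conv_linear.
  - by apply: linear_comp_fun lR; apply: tmap_linear.
  rewrite tmap_tens // /R !tlift_tens //.
  by apply: bilin_comp => //; apply: conv_linear.
have -> : conv (conv f g) h x = L (tmap (@comul k D) idfun (comul x)).
  change (tlift (fun y z => mu (conv f g y) (h z)) (comul x) =
    L (tmap (@comul k D) idfun (comul x))).
  move: (comul x); apply: tensor_ext => [||v w].
  - by apply: tlift_linear; apply: bilin_comp => //; apply: conv_linear.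
  - by apply: linear_comp_fun lL; apply: tmap_linear.
  rewrite tmap_tens // /L !tlift_tens //.
  by apply: bilin_comp => //; apply: conv_linear.
rewrite -comulA; move: (tmap _ _ _).
have lT := @tassoc_linear k D D D.
apply: tensor_ext => //; first by apply: linear_comp_fun lL.
move=> v t; rewrite /R tlift_tens // -/R; move: t.
apply: tensor_ext => [||w u].
- exact: linear_comp_fun lgh (bilin_r _ mu_bil).
- apply: linear_comp_fun lL; apply: linear_comp_fun lT; exact: tens_lin_r.
rewrite tassoc_tens /L !tlift_tens //; first exact: conv_bilinear.
exact: conv_bilinear.
Qed.

Lemma conv1x f : linear f -> conv conv_unit f =1 f.
Proof.
move=> lf x; rewrite -[in RHS](counitl x) /conv; move: (comul x).
have b : is_bilinear (fun y z : D => counit y *: z).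
  by apply: scale_forml_bilinear; exact: counit_linear.
have lu := conv_unit_linear.
have b' := conv_bilinear lu lf.
apply: tensor_ext => [||v w].
- exact: tlift_linear.
- exact: linear_comp_fun (tlift_linear b) lf.
rewrite !tlift_tens // (lin_scale lf) /conv_unit.
by rewrite (lin_scale (bilin_l (f w) mu_bil)) mu1x.
Qed.

Lemma convx1 f : linear f -> conv f conv_unit =1 f.
Proof.
move=> lf x; rewrite -[in RHS](counitr x) /conv; move: (comul x).
have b : is_bilinear (fun y z : D => counit z *: y).
  by apply: scale_formr_bilinear; exact: counit_linear.
have lu := conv_unit_linear.
have b' := conv_bilinear lf lu.
apply: tensor_ext => [||v w].
- exact: tlift_linear.
- exact: linear_comp_fun (tlift_linear b) lf.
rewrite !tlift_tens // (lin_scale lf) /conv_unit.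
by rewrite (lin_scale (bilin_r (f v) mu_bil)) mux1.
Qed.

Lemma conv_inv_uniq f g h : linear f -> linear g -> linear h ->
  conv f g =1 conv_unit -> conv g h =1 conv_unit -> f =1 h.
Proof.
move=> lf lg lh fg gh x.
rewrite -(convx1 lf) -(eq_conv (frefl f) gh) convA // (eq_conv fg (frefl h)).
exact: conv1x.
Qed.

End Convolution.

Section Antipode.
Variables (k : fieldType) (H : hopfType k).
Notation S := (@antipode k H).

Let lS : linear S := @antipode_linear k H.
Let lD : linear (@comul k H) := @comul_linear k H.
Let mulb := mulr_bilinear H.

Lemma conv_antipodel : conv ( *%R ) S id =1 conv_unit (1 : H) (D := H).
Proof. exact: antipodel. Qed.

Lemma conv_antipoder : conv ( *%R ) id S =1 conv_unit (1 : H) (D := H).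
Proof. exact: antipoder. Qed.

Lemma antipode1 : S 1 = 1.
Proof.
have := antipodel (1 : H); rewrite comul1 tlift_tens ?mulr1 ?counit1 ?scale1r //.
by apply: (bilin_comp mulb lS (h := id)).
Qed.

Lemma counit_antipode x : counit (S x) = counit x.
Proof.
have ce := @counit_linear k H.
have /(congr1 (@counit k H)) := antipodel x.
have -> : counit ((counit x)%:A : H) = counit x.
  have := scalable_linear ce (counit x) (1 : H).
  by rewrite counit1 /= mulr1.
move=> <-; rewrite -{1}(counitr x); move: (comul x).
have b : is_bilinear (fun y z : H => counit z *: y).
  by apply: scale_formr_bilinear; exact: counit_linear.
have lid : linear (@idfun H) by [].
have b2 : is_bilinear (fun y z : H => S y * z) by apply: (bilin_comp mulb lS lid).
have lce : linear (@counit k H : H -> k^o) by exact: ce.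
apply: (tensor_ext (f := fun t => counit (S (tlift (fun y z : H => counit z *: y) t)) : k^o)
  (g := fun t => counit (tlift (fun y z : H => S y * z) t) : k^o)) => [||v w].
- apply: linear_comp_fun lce; apply: linear_comp_fun lS; exact: tlift_linear.
- by apply: linear_comp_fun lce; exact: tlift_linear.
rewrite !tlift_tens // counitM (lin_scale lS) (lin_scale lce) mulrC.
by [].
Qed.

Let mut := @tmul_bilinear k H H.
Let j1 (x : H) : tensor H H := x ⊗ 1.
Let j2 (x : H) : tensor H H := 1 ⊗ x.

Let lj1 : linear j1. Proof. exact: tens_lin_l. Qed.
Let lj2 : linear j2. Proof. exact: tens_lin_r. Qed.

Let conv_push (A : lmodType k) (mu : A -> A -> A) (f : H -> A) (u v : H -> H) :
  is_bilinear mu -> linear f -> linear u -> linear v ->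
  (forall x y, f (x * y) = mu (f x) (f y)) ->
  forall x, conv mu (fun y => f (u y)) (fun y => f (v y)) x = f (conv *%R u v x).
Proof.
move=> bmu lf lu lv fM x; rewrite /conv; move: (comul x).
have lfu := linear_comp_fun lu lf; have lfv := linear_comp_fun lv lf.
apply: tensor_ext => [||a b].
- by apply: tlift_linear; apply: bilin_comp.
- by apply: linear_comp_fun lf; apply: tlift_linear; apply: bilin_comp.
by rewrite !tlift_tens ?fM //; apply: bilin_comp.
Qed.

(** With j1 x = x ⊗ 1 and j2 x = 1 ⊗ x, the coproduct is the convolution j1 * j2.
Its inverse is (j2 S) * (j1 S), the flip of S ⊗ S, but Delta S is an inverse too. *)
Theorem antipode_comul x : comul (S x) = tswap (tmap S S (comul x)).
Proof.
have lid : linear (@idfun H) by [].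
have A := @tmulA k H H; have u1 := @tmul1x k H H; have u2 := @tmulx1 k H H.
have lj1S : linear (fun y => j1 (S y)) by apply: linear_comp_fun lj1.
have lj2S : linear (fun y => j2 (S y)) by apply: linear_comp_fun lj2.
have lDS : linear (fun y => comul (S y)) by apply: linear_comp_fun lD.
have cD : @comul k H =1 conv (@tmul k H H) j1 j2.
  move=> y; rewrite /conv -[LHS](@tmap_id k H H id id) //; move: (comul y).
  apply: tensor_ext => [||a b].
  - exact: tmap_linear.
  - by apply: tlift_linear; apply: bilin_comp.
  rewrite tmap_tens // tlift_tens ?tmul_tens ?mul1r ?mulr1 //.
  exact: bilin_comp.
pose C := conv (@tmul k H H) (fun y => j2 (S y)) (fun y => j1 (S y)).
have lC : linear C by apply: conv_linear.
have eC y : C y = tswap (tmap S S (comul y)).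
  rewrite /C /conv; move: (comul y); apply: tensor_ext => [||a b].
  - by apply: tlift_linear; apply: bilin_comp.
  - by apply: linear_comp_fun (@tswap_linear k H H); apply: tmap_linear.
  rewrite tmap_tens // tlift_tens ?tmul_tens ?mul1r ?mulr1 ?tswap_tens //.
  exact: bilin_comp.
rewrite -eC; move: x.
apply: (conv_inv_uniq mut A u1 u2 lDS lD lC) => [x|x].
  rewrite (conv_push (f := @comul k H) (u := S) (v := id)) //; last exact: comulM.
  by rewrite conv_antipodel /conv_unit (lin_scale lD) comul1.
rewrite (eq_conv _ cD (frefl C)) -(convA mut A lj1 lj2 lC).
have step : conv (@tmul k H H) j2 C =1 fun y => j1 (S y).
  move=> y; rewrite /C (convA mut A lj2 lj2S lj1S).
  rewrite (eq_conv _ (f' := conv_unit (1 ⊗ 1)) _ (frefl _)).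
    exact: conv1x.
  move=> z; rewrite (conv_push (f := j2) (u := id) (v := S)) //.
    by rewrite conv_antipoder /conv_unit lin_scale.
  by move=> a b; rewrite /j2 tmul_tens mulr1.
rewrite (eq_conv _ (frefl j1) step).
rewrite (conv_push (f := j1) (u := id) (v := S)) //.
  by rewrite conv_antipoder /conv_unit lin_scale.
by move=> a b; rewrite /j1 tmul_tens mulr1.
Qed.

End Antipode.

Section BialgMap.
Variables (k : fieldType) (A B : hopfType k) (h : A -> B).
Hypotheses (hc : coalg_morphism h) (hm : monoid_morphism h).

(** Both sides are convolution inverses of h. *)
Lemma bialg_antipode x : h (antipode x) = antipode (h x).
Proof.
case: hc => lh hD he; case: hm => h1 hM.
have lSA := @antipode_linear k A; have lSB := @antipode_linear k B.
have mb := mulr_bilinear B.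
have l1 : linear (fun y => h (antipode y)) by apply: linear_comp_fun lh.
have l2 : linear (fun y => antipode (h y)) by apply: linear_comp_fun lSB.
move: x; apply: (conv_inv_uniq (g := h) mb (@mulrA B) (@mul1r B) (@mulr1 B)) => // [x|x].
  transitivity (h (tlift (fun y z => antipode y * z) (comul x))); last first.
    by rewrite antipodel (lin_scale lh) h1.
  rewrite /conv; move: (comul x); apply: tensor_ext => [||a b].
  - by apply: tlift_linear; apply: bilin_comp.
  - apply: linear_comp_fun lh; apply: tlift_linear.
    by apply: (bilin_comp (mulr_bilinear A) lSA (h := id)).
  rewrite !tlift_tens ?hM //; last by apply: bilin_comp.
  by apply: (bilin_comp (mulr_bilinear A) lSA (h := id)).
have := antipoder (h x); rewrite hD he /conv_unit => <-.
rewrite /conv; move: (comul x); apply: tensor_ext => [||a b].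
- by apply: tlift_linear; apply: bilin_comp.
- apply: (linear_comp_fun (tmap_linear lh lh)).
  by apply: tlift_linear; apply: (bilin_comp mb (g := id) _ lSB).
rewrite tmap_tens // !tlift_tens //; last by apply: bilin_comp.
by apply: (bilin_comp mb (g := id) _ lSB).
Qed.

End BialgMap.

(** * The algebra on letters *)

Notation letter M n := (M * 'I_n * 'I_n)%type.

Section Words.
Variables (k : fieldType) (n : nat) (M : choiceType) (s : M -> M).
Local Notation word := (seq (letter M n)).

Definition row_inv (U : lmodType k) (G : word -> U) :=
  forall p q m i j,
    \sum_(l < n) G (p ++ (m, i, l) :: (s m, j, l) :: q) = (i == j)%:R *: G (p ++ q).

Definition col_inv (U : lmodType k) (G : word -> U) :=
  forall p q m i j,
    \sum_(l < n) G (p ++ (s m, l, i) :: (m, l, j) :: q) = (i == j)%:R *: G (p ++ q).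

(** The relations X_m X_(s m)^T = 1 and X_(s m)^T X_m = 1, as constraints on a
function of the words in the letters (m, i, j). *)
Definition rel_invariant (U : lmodType k) (G : word -> U) := row_inv G /\ col_inv G.

Lemma rinv_comp (U V : lmodType k) (G : word -> U) (f : U -> V) :
  linear f -> rel_invariant G -> rel_invariant (fun w => f (G w)).
Proof.
move=> lf [rG cG]; split=> p q m i j.
  by rewrite -(lin_sum _ _ _ lf) (rG p q m i j) lin_scale.
by rewrite -(lin_sum _ _ _ lf) (cG p q m i j) lin_scale.
Qed.

Lemma rinv_shift (U : lmodType k) (G : word -> U) u v :
  rel_invariant G -> rel_invariant (fun w => G (u ++ w ++ v)).
Proof.
have E p x y q : u ++ (p ++ x :: y :: q) ++ v = (u ++ p) ++ x :: y :: (q ++ v).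
  by rewrite -!catA.
have E' p q : u ++ (p ++ q) ++ v = (u ++ p) ++ (q ++ v) by rewrite -!catA.
move=> [rG cG]; split=> p q m i j; under eq_bigr do rewrite E.
  by rewrite E' -(rG (u ++ p) (q ++ v) m i j).
by rewrite E' -(cG (u ++ p) (q ++ v) m i j).
Qed.

Lemma eq_rinv (U : lmodType k) (G G' : word -> U) :
  G =1 G' -> rel_invariant G -> rel_invariant G'.
Proof.
move=> e [rG cG]; split=> p q m i j.
  by rewrite -e -(rG p q m i j); apply: eq_bigr => l _; rewrite e.
by rewrite -e -(cG p q m i j); apply: eq_bigr => l _; rewrite e.
Qed.

Lemma rinv_sum (U : lmodType k) (I : Type) (r : seq I) (P : pred I)
    (G : I -> word -> U) :
  (forall i, rel_invariant (G i)) -> rel_invariant (fun w => \sum_(i <- r | P i) G i w).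
Proof.
move=> iG; split=> p q m i j; rewrite exchange_big scaler_sumr;
  apply: eq_bigr => x _; [exact: (iG x).1|exact: (iG x).2].
Qed.

Lemma rinv_scale (U : lmodType k) (G : word -> U) (a : k) :
  rel_invariant G -> rel_invariant (fun w => a *: G w).
Proof.
by apply: rinv_comp => b x y; rewrite scalerDr !scalerA mulrC.
Qed.

Definition wsum (U : lmodType k) (G : word -> U) (f : seq (k * word)) : U :=
  \sum_(c <- f) c.1 *: G c.2.

(** Formal sums are identified when no invariant function separates them. This is
the quotient by the ideal of relations, and invariant functions with values in any
space factor through it by construction. *)
Definition weq (f g : seq (k * word)) : bool :=
  `[< forall (U : lmodType k) (G : word -> U), rel_invariant G -> wsum G f = wsum G g >].

Lemma weq_refl : reflexive weq.
Proof. by move=> f; apply/asboolP. Qed.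

Lemma weq_sym : symmetric weq.
Proof. by move=> f g; apply/asboolP/asboolP => e U G iG; rewrite (e U G iG). Qed.

Lemma weq_trans : transitive weq.
Proof.
move=> g f h /asboolP e1 /asboolP e2; apply/asboolP => U G iG.
by rewrite (e1 U G iG) (e2 U G iG).
Qed.

Canonical weq_equiv := EquivRel weq weq_refl weq_sym weq_trans.

Definition letter_hopf : Type := {eq_quot weq_equiv}%qT.

HB.instance Definition _ := Choice.on letter_hopf.
HB.instance Definition _ := Quotient.on letter_hopf.
HB.instance Definition _ := EqQuotient.on letter_hopf.

Definition kclass (f : seq (k * word)) : letter_hopf := \pi_letter_hopf%qT f.

Definition klift (U : lmodType k) (G : word -> U) (x : letter_hopf) : U := wsum G (repr x).

Lemma klift_class (U : lmodType k) (G : word -> U) f :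
  rel_invariant G -> klift G (kclass f) = wsum G f.
Proof.
move=> iG; rewrite /klift /kclass.
have /eqmodP/asboolP e : (repr (\pi_letter_hopf f) = f %[mod letter_hopf])%qT by rewrite reprK.
exact: e.
Qed.

Lemma kext (x y : letter_hopf) :
  (forall (U : lmodType k) (G : word -> U), rel_invariant G -> klift G x = klift G y) ->
  x = y.
Proof.
move=> e; rewrite -[x]reprK -[y]reprK; apply/eqmodP/asboolP => U G iG; exact: e.
Qed.

Lemma eq_klift (U : lmodType k) (G G' : word -> U) : G =1 G' -> klift G =1 klift G'.
Proof. by move=> e x; apply: eq_bigr => c _; rewrite e. Qed.

Definition kadd (x y : letter_hopf) := kclass (repr x ++ repr y).
Definition kscale (a : k) (x : letter_hopf) := kclass [seq (a * c.1, c.2) | c <- repr x].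
Definition kopp (x : letter_hopf) := kscale (-1) x.
Definition kzero := kclass [::].
Definition kw (w : word) : letter_hopf := kclass [:: (1, w)].
Definition kmul (x y : letter_hopf) : letter_hopf :=
  kclass [seq (c.1 * d.1, c.2 ++ d.2) | c <- repr x, d <- repr y].

Section LiftOp.
Variables (U : lmodType k) (G : word -> U).
Hypothesis iG : rel_invariant G.

Lemma klift_add x y : klift G (kadd x y) = klift G x + klift G y.
Proof. by rewrite klift_class // /wsum big_cat. Qed.

Lemma klift_scale a x : klift G (kscale a x) = a *: klift G x.
Proof.
rewrite klift_class // /wsum big_map scaler_sumr.
by apply: eq_bigr => c _; rewrite scalerA.
Qed.

Lemma klift_zero : klift G kzero = 0.
Proof. by rewrite klift_class // /wsum big_nil. Qed.

Lemma klift_opp x : klift G (kopp x) = - klift G x.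
Proof. by rewrite klift_scale scaleN1r. Qed.

Lemma klift_w w : klift G (kw w) = G w.
Proof. by rewrite klift_class // /wsum big_seq1 scale1r. Qed.

Lemma klift_mul x y :
  klift G (kmul x y) = klift (fun u => klift (fun v => G (u ++ v)) y) x.
Proof.
rewrite klift_class // /wsum big_allpairs_dep /=; apply: eq_bigr => c _.
rewrite scaler_sumr; apply: eq_bigr => d _ /=.
by rewrite scalerA.
Qed.

Lemma rinv_catl u : rel_invariant (fun v => G (u ++ v)).
Proof.
by apply: eq_rinv (rinv_shift u [::] iG) => w; rewrite cats0.
Qed.

Lemma rinv_catr v : rel_invariant (fun u => G (u ++ v)).
Proof. exact: (rinv_shift [::] v iG). Qed.

Lemma rinv_klift y : rel_invariant (fun u => klift (fun v => G (u ++ v)) y).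
Proof.
rewrite /klift /wsum; apply: (@rinv_sum U _ _ xpredT (fun c u => c.1 *: G (u ++ c.2))) => c.
by apply: rinv_scale; apply: rinv_catr.
Qed.

End LiftOp.

Lemma kaddA : associative kadd.
Proof. by move=> x y z; apply: kext => U G iG; rewrite !klift_add ?addrA. Qed.

Lemma kaddC : commutative kadd.
Proof. by move=> x y; apply: kext => U G iG; rewrite !klift_add // addrC. Qed.

Lemma kadd0 : left_id kzero kadd.
Proof. by move=> x; apply: kext => U G iG; rewrite klift_add // klift_zero // add0r. Qed.

Lemma kaddN : left_inverse kzero kopp kadd.
Proof.
by move=> x; apply: kext => U G iG; rewrite klift_add // klift_opp // klift_zero // addNr.
Qed.

HB.instance Definition _ := GRing.isZmodule.Build letter_hopf kaddA kaddC kadd0 kaddN.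

Lemma kscaleA a b x : kscale a (kscale b x) = kscale (a * b) x.
Proof. by apply: kext => U G iG; rewrite !klift_scale // scalerA. Qed.

Lemma kscale1 : left_id 1 kscale.
Proof. by move=> x; apply: kext => U G iG; rewrite klift_scale // scale1r. Qed.

Lemma kscaleDr : right_distributive kscale +%R.
Proof.
by move=> a x y; apply: kext => U G iG; rewrite !(klift_scale, klift_add) // scalerDr.
Qed.

Lemma kscaleDl x : {morph kscale^~ x : a b / a + b}.
Proof.
by move=> a b; apply: kext => U G iG; rewrite !(klift_scale, klift_add) // scalerDl.
Qed.

HB.instance Definition _ :=
  GRing.Zmodule_isLmodule.Build k letter_hopf kscaleA kscale1 kscaleDr kscaleDl.

Lemma klift_linear (U : lmodType k) (G : word -> U) : rel_invariant G -> linear (klift G).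
Proof. by move=> iG a x y; rewrite klift_add // klift_scale. Qed.

Lemma kspan (x : letter_hopf) : x = \sum_(c <- repr x) c.1 *: kw c.2.
Proof.
apply: kext => U G iG; rewrite (lin_sum _ _ _ (klift_linear iG)).
by apply: eq_bigr => c _; rewrite (lin_scale (klift_linear iG)) klift_w.
Qed.

Lemma klin_ext (U : lmodType k) (f g : letter_hopf -> U) : linear f -> linear g ->
  (forall w, f (kw w) = g (kw w)) -> f =1 g.
Proof.
move=> lf lg e x; rewrite (kspan x) !lin_sum //; apply: eq_bigr => c _.
by rewrite !lin_scale // e.
Qed.

Lemma kw_invariant : rel_invariant kw.
Proof.
split=> p q m i j; apply: kext => U G iG; rewrite (lin_sum _ _ _ (klift_linear iG));
  rewrite (lin_scale (klift_linear iG)) klift_w //.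
  by rewrite -(iG.1 p q m i j); apply: eq_bigr => l _; rewrite klift_w.
by rewrite -(iG.2 p q m i j); apply: eq_bigr => l _; rewrite klift_w.
Qed.

Lemma kmulA : associative kmul.
Proof.
move=> x y z; apply: kext => U G iG; rewrite !klift_mul //; last exact: rinv_klift.
apply: eq_klift => u; rewrite !klift_mul //; last exact: rinv_catl.
by apply: eq_klift => v; apply: eq_klift => w; rewrite catA.
Qed.

Lemma kmul1x : left_id (kw [::]) kmul.
Proof.
move=> x; apply: kext => U G iG; rewrite klift_mul // klift_w //.
exact: rinv_klift.
Qed.

Lemma kmulx1 : right_id (kw [::]) kmul.
Proof.
move=> x; apply: kext => U G iG; rewrite klift_mul //; apply: eq_klift => u.
by rewrite klift_w ?cats0 //; apply: rinv_catl.
Qed.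

Lemma kmulDl : left_distributive kmul +%R.
Proof.
move=> x y z; apply: kext => U G iG; rewrite klift_mul // klift_add ?klift_mul //;
exact: rinv_klift || by rewrite klift_add ?klift_mul.
Qed.

Lemma kmulDr : right_distributive kmul +%R.
Proof.
move=> x y z; apply: kext => U G iG; rewrite klift_mul // klift_add // !klift_mul //.
rewrite -big_split; apply: eq_bigr => c _ /=; rewrite -scalerDr.
by rewrite klift_add //; apply: rinv_catl.
Qed.

Lemma kmulw u v : kmul (kw u) (kw v) = kw (u ++ v).
Proof.
apply: kext => U G iG; rewrite klift_mul // klift_w; last exact: rinv_klift.
by rewrite !klift_w //; apply: rinv_catl.
Qed.

Definition kcounit_word (w : word) : k := \prod_(x <- w) (x.1.2 == x.2)%:R.

Lemma kcounit_cat u v : kcounit_word (u ++ v) = kcounit_word u * kcounit_word v.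
Proof. exact: big_cat. Qed.

Lemma kcounit_cons x w : kcounit_word (x :: w) = (x.1.2 == x.2)%:R * kcounit_word w.
Proof. exact: big_cons. Qed.

Lemma kcounit_invariant : rel_invariant (kcounit_word : word -> k^o).
Proof.
split=> p q m i j.
  under eq_bigr do rewrite kcounit_cat !kcounit_cons /=.
  rewrite kcounit_cat (bigD1 i) //= eqxx mul1r big1 ?addr0.
    by rewrite mulrCA [in LHS]eq_sym.
  by move=> l /negPf li; rewrite [i == l]eq_sym li mul0r mulr0.
under eq_bigr do rewrite kcounit_cat !kcounit_cons /=.
rewrite kcounit_cat (bigD1 i) //= eqxx mul1r big1 ?addr0.
  by rewrite mulrCA.
by move=> l /negPf li; rewrite li mul0r mulr0.
Qed.

(** The counit separates the empty word from zero. *)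
Lemma kone_neq0 : kw [::] != 0.
Proof.
apply/eqP => /(congr1 (klift (kcounit_word : word -> k^o))).
rewrite klift_w; last exact: kcounit_invariant.
rewrite (lin0 (klift_linear kcounit_invariant)) /kcounit_word big_nil => /eqP.
by rewrite oner_eq0.
Qed.

HB.instance Definition _ := GRing.Zmodule_isNzRing.Build letter_hopf
  kmulA kmul1x kmulx1 kmulDl kmulDr kone_neq0.

Lemma kmulZl a (x y : letter_hopf) : a *: (x * y) = (a *: x) * y.
Proof.
apply: kext => U G iG; rewrite klift_scale // !klift_mul //.
by rewrite klift_scale //; apply: rinv_klift.
Qed.

HB.instance Definition _ := GRing.Lmodule_isLalgebra.Build k letter_hopf kmulZl.

Lemma kmulZr a (x y : letter_hopf) : a *: (x * y) = x * (a *: y).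
Proof.
apply: kext => U G iG; rewrite klift_scale // !klift_mul //.
transitivity (klift (fun u => a *: klift (fun v => G (u ++ v)) y) x).
  rewrite /klift /wsum scaler_sumr; apply: eq_bigr => c _.
  by rewrite !scalerA mulrC.
apply: eq_klift => u.
by rewrite (lin_scale (klift_linear (rinv_catl iG u))).
Qed.

HB.instance Definition _ := GRing.Lalgebra_isAlgebra.Build k letter_hopf kmulZr.

Lemma kwM u v : kw (u ++ v) = kw u * kw v.
Proof. by rewrite -kmulw. Qed.

Lemma kw0 : kw [::] = 1. Proof. by []. Qed.

End Words.

(** * The Hopf algebra on letters *)

Arguments kw {k n M s} w.
Arguments klift {k n M s U} G x.
Arguments kcounit_word k {n M} w.

Section Msum.
Variables (k : fieldType) (n : nat) (M : choiceType) (s : M -> M).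
Local Notation word := (seq (letter M n)).
Local Notation inv := (rel_invariant s).

(** The index pattern of the coproduct of a product of comatrix entries: F receives
the words whose column, respectively row, indices are the intermediate ones. *)
Fixpoint midsum (U : nmodType) (w : word) (F : word -> word -> U) : U :=
  if w is x :: w' then
    \sum_(l < n) midsum w' (fun a b => F ((x.1.1, x.1.2, l) :: a) ((x.1.1, l, x.2) :: b))
  else F [::] [::].

Lemma eq_midsum (U : nmodType) w (F F' : word -> word -> U) :
  (forall a b, F a b = F' a b) -> midsum w F = midsum w F'.
Proof.
elim: w F F' => [|x w IH] F F' e //=; apply: eq_bigr => l _; apply: IH => a b.
exact: e.
Qed.

Lemma midsum_sum (U : nmodType) w (I : Type) (r : seq I) (P : pred I)
    (F : I -> word -> word -> U) :
  midsum w (fun a b => \sum_(i <- r | P i) F i a b) = \sum_(i <- r | P i) midsum w (F i).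
Proof.
elim: w F => [|x w IH] F //=; rewrite exchange_big; apply: eq_bigr => l _ /=.
exact: IH.
Qed.

Lemma midsum_lin (U V : lmodType k) (f : U -> V) w (F : word -> word -> U) :
  linear f -> f (midsum w F) = midsum w (fun a b => f (F a b)).
Proof.
move=> lf; elim: w F => [|x w IH] F //=; rewrite lin_sum //.
by apply: eq_bigr => l _; apply: IH.
Qed.

Lemma midsum_cat (U : nmodType) u v (F : word -> word -> U) :
  midsum (u ++ v) F = midsum u (fun a b => midsum v (fun a' b' => F (a ++ a') (b ++ b'))).
Proof.
elim: u F => [|x u IH] F /=; first by apply: eq_midsum.
by apply: eq_bigr => l _; rewrite IH.
Qed.

Lemma midsum_coassoc (U : nmodType) w (T : word -> word -> word -> U) :
  midsum w (fun a b => midsum b (fun b' c => T a b' c)) =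
  midsum w (fun b c => midsum b (fun a b' => T a b' c)).
Proof.
elim: w T => [|x w IH] T //=.
transitivity (\sum_(l < n) \sum_(m < n) midsum w (fun a b => midsum b (fun b' c =>
   T ((x.1.1, x.1.2, l) :: a) ((x.1.1, l, m) :: b') ((x.1.1, m, x.2) :: c)))).
  by apply: eq_bigr => l _; rewrite -midsum_sum; apply: eq_midsum.
rewrite exchange_big; apply: eq_bigr => m _ /=.
by rewrite midsum_sum; apply: eq_bigr => l _; apply: IH.
Qed.

Lemma midsum_counitl (U : lmodType k) w (F : word -> U) :
  midsum w (fun a b => kcounit_word k a *: F b) = F w.
Proof.
elim: w F => [|[[m i] j] w IH] F /=; first by rewrite /kcounit_word big_nil scale1r.
rewrite (bigD1 i) //= [X in _ + X]big1 ?addr0 => [|l /negPf li].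
  by under eq_midsum do rewrite kcounit_cons eqxx mul1r; rewrite IH.
under eq_midsum do rewrite kcounit_cons /= eq_sym li mul0r scale0r.
by have := IH (fun _ => 0); under eq_midsum do rewrite scaler0.
Qed.

Lemma midsum_counitr (U : lmodType k) w (F : word -> U) :
  midsum w (fun a b => kcounit_word k b *: F a) = F w.
Proof.
elim: w F => [|[[m i] j] w IH] F /=; first by rewrite /kcounit_word big_nil scale1r.
rewrite (bigD1 j) //= [X in _ + X]big1 ?addr0 => [|l /negPf li].
  by under eq_midsum do rewrite kcounit_cons eqxx mul1r; rewrite IH.
under eq_midsum do rewrite kcounit_cons /= li mul0r scale0r.
by have := IH (fun _ => 0); under eq_midsum do rewrite scaler0.
Qed.

Lemma delta_sum (U : lmodType k) (i : 'I_n) (F : 'I_n -> U) :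
  \sum_(j < n) (i == j)%:R *: F j = F i.
Proof.
rewrite (bigD1 i) //= eqxx scale1r big1 ?addr0 // => j /negPf ji.
by rewrite eq_sym ji scale0r.
Qed.

Lemma scale_linear (U : lmodType k) (a : k) : linear (fun x : U => a *: x).
Proof. by move=> b x y; rewrite scalerDr !scalerA mulrC. Qed.

(** Summing over the last index contracts the second factors, which leaves a
relation between the first factors. *)
Lemma midsum_row_inv (U : lmodType k) (F : word -> word -> U) :
  (forall a, row_inv s (F a)) -> (forall b, row_inv s (F^~ b)) ->
  row_inv s (fun w => midsum w F).
Proof.
move=> Fr Fl p q m i j.
under eq_bigr do rewrite midsum_cat.
rewrite midsum_cat -midsum_sum (midsum_lin _ _ (scale_linear _)); apply: eq_midsum => a b /=.
rewrite (midsum_lin _ _ (scale_linear _)).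
transitivity (midsum q (fun a' b' => \sum_(c < n) \sum_(d < n) \sum_(l < n)
   F (a ++ (m, i, c) :: (s m, j, d) :: a') (b ++ (m, c, l) :: (s m, d, l) :: b'))).
  rewrite midsum_sum exchange_big; apply: eq_bigr => c _ /=.
  rewrite midsum_sum exchange_big; apply: eq_bigr => d _ /=.
  by rewrite midsum_sum.
apply: eq_midsum => a' b'.
under eq_bigr => c _ do under eq_bigr => d _ do rewrite (Fr _ b b' m c d).
under eq_bigr => c _ do
  rewrite (delta_sum c (fun d => F (a ++ (m, i, c) :: (s m, j, d) :: a') (b ++ b'))).
exact: (Fl _ a a' m i j).
Qed.

Lemma midsum_col_inv (U : lmodType k) (F : word -> word -> U) :
  (forall a, col_inv s (F a)) -> (forall b, col_inv s (F^~ b)) ->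
  col_inv s (fun w => midsum w F).
Proof.
move=> Fr Fl p q m i j.
under eq_bigr do rewrite midsum_cat.
rewrite midsum_cat -midsum_sum (midsum_lin _ _ (scale_linear _)); apply: eq_midsum => a b /=.
rewrite (midsum_lin _ _ (scale_linear _)).
transitivity (midsum q (fun a' b' => \sum_(c < n) \sum_(d < n) \sum_(l < n)
   F (a ++ (s m, l, c) :: (m, l, d) :: a') (b ++ (s m, c, i) :: (m, d, j) :: b'))).
  rewrite midsum_sum exchange_big; apply: eq_bigr => c _ /=.
  rewrite midsum_sum exchange_big; apply: eq_bigr => d _ /=.
  by rewrite midsum_sum.
apply: eq_midsum => a' b'.
under eq_bigr => c _ do under eq_bigr => d _ do rewrite (Fl _ a a' m c d).
under eq_bigr => c _ do
  rewrite (delta_sum c (fun d => F (a ++ a') (b ++ (s m, c, i) :: (m, d, j) :: b'))).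
exact: (Fr _ b b' m i j).
Qed.

Lemma midsum_invariant (U : lmodType k) (F : word -> word -> U) :
  (forall a, inv (F a)) -> (forall b, inv (F^~ b)) -> inv (fun w => midsum w F).
Proof.
move=> Fr Fl; split.
  by apply: midsum_row_inv => a; [exact: (Fr a).1 | exact: (Fl a).1].
by apply: midsum_col_inv => a; [exact: (Fr a).2 | exact: (Fl a).2].
Qed.

End Msum.

Section KHopf.
Variables (k : fieldType) (n : nat) (M : choiceType) (s : M -> M).
Local Notation word := (seq (letter M n)).
Local Notation K := (letter_hopf k n s).
Local Notation inv := (rel_invariant s).
Local Notation kw := (@kw k n M s).

Let kwi : inv kw := @kw_invariant k n M s.

Definition kcomul : K -> tensor K K := klift (fun w => midsum w (fun a b => kw a ⊗ kw b)).
Definition kcounit : K -> k := klift (kcounit_word k : word -> k^o).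

Lemma kcomul_inv : inv (fun w => midsum w (fun a b => kw a ⊗ kw b)).
Proof.
apply: midsum_invariant => a.
  exact: rinv_comp (@tens_lin_r k K K (kw a)) kwi.
exact: rinv_comp (@tens_lin_l k K K (kw a)) kwi.
Qed.

Lemma kcomul_linear : linear kcomul.
Proof. exact: klift_linear kcomul_inv. Qed.

Lemma kcomulw w : kcomul (kw w) = midsum w (fun a b => kw a ⊗ kw b).
Proof. exact: klift_w kcomul_inv w. Qed.

Lemma kcounit_linear : linear_for *%R kcounit.
Proof. exact: klift_linear (@kcounit_invariant k n M s). Qed.

Lemma kcounitw w : kcounit (kw w) = kcounit_word k w.
Proof. exact: klift_w (@kcounit_invariant k n M s) w. Qed.

Lemma kcomulA x :
  tassoc (tmap idfun kcomul (kcomul x)) = tmap kcomul idfun (kcomul x).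
Proof.
have lC := kcomul_linear; have lid : linear (@idfun K) by [].
have lT := @tassoc_linear k K K K.
have lm1 := tmap_linear lid lC; have lm2 := tmap_linear lC lid.
move: x; apply: klin_ext => [||w].
- exact: linear_comp_fun (linear_comp_fun lC lm1) lT.
- exact: linear_comp_fun lC lm2.
rewrite kcomulw (midsum_lin _ _ lm1) (midsum_lin _ _ lm2) (midsum_lin _ _ lT).
transitivity (midsum w (fun a b => midsum b (fun b' c => (kw a ⊗ kw b') ⊗ kw c))).
  apply: eq_midsum => a b; rewrite tmap_tens // kcomulw.
  rewrite (midsum_lin _ _ (@tens_lin_r k _ _ _)) (midsum_lin _ _ lT).
  by apply: eq_midsum => b' c; rewrite tassoc_tens.
rewrite midsum_coassoc; apply: eq_midsum => a b; rewrite tmap_tens // kcomulw.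
by rewrite (midsum_lin _ _ (@tens_lin_l k _ _ _)).
Qed.

Lemma kcounitl x : tlift (fun y z => kcounit y *: z) (kcomul x) = x.
Proof.
have b : is_bilinear (fun y z : K => kcounit y *: z).
  by apply: scale_forml_bilinear; exact: kcounit_linear.
move: x; apply: (klin_ext (g := id)) => [||w] //.
  exact: linear_comp_fun kcomul_linear (tlift_linear b).
rewrite kcomulw (midsum_lin _ _ (tlift_linear b)) -[RHS](midsum_counitl (k := k)).
by apply: eq_midsum => a c; rewrite tlift_tens // kcounitw.
Qed.

Lemma kcounitr x : tlift (fun y z => kcounit z *: y) (kcomul x) = x.
Proof.
have b : is_bilinear (fun y z : K => kcounit z *: y).
  by apply: scale_formr_bilinear; exact: kcounit_linear.
move: x; apply: (klin_ext (g := id)) => [||w] //.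
  exact: linear_comp_fun kcomul_linear (tlift_linear b).
rewrite kcomulw (midsum_lin _ _ (tlift_linear b)) -[RHS](midsum_counitr (k := k)).
by apply: eq_midsum => a c; rewrite tlift_tens // kcounitw.
Qed.

HB.instance Definition _ := Lmodule_isCoalgebra.Build k (letter_hopf k n s)
  kcomul_linear kcounit_linear kcomulA kcounitl kcounitr.

Lemma kcomul1 : comul (1 : K) = 1 ⊗ 1.
Proof. by rewrite -kw0 [LHS]kcomulw. Qed.

Lemma kbilin_ext (U : lmodType k) (f g : K -> K -> U) :
  is_bilinear f -> is_bilinear g ->
  (forall u v, f (kw u) (kw v) = g (kw u) (kw v)) -> forall x y, f x y = g x y.
Proof.
move=> bf bg e x y; move: x; apply: klin_ext; [exact: bilin_l|exact: bilin_l|move=> u].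
move: y; apply: klin_ext; [exact: bilin_r|exact: bilin_r|move=> v]; exact: e.
Qed.

Lemma kcomulM (x y : K) : comul (x * y) = tmul (comul x) (comul y).
Proof.
have bt := @tmul_bilinear k K K.
have lC : linear (@comul k K) := kcomul_linear.
move: x y; apply: kbilin_ext => [||u v].
- exact: bilin_post (mulr_bilinear K) lC.
- exact: (bilin_comp bt lC lC).
rewrite -kwM [LHS]kcomulw midsum_cat.
rewrite [X in _ = tmul X _]kcomulw [X in _ = tmul _ X]kcomulw.
rewrite (midsum_lin _ _ (bilin_l _ bt)); apply: eq_midsum => a b.
rewrite (midsum_lin _ _ (bilin_r _ bt)); apply: eq_midsum => a' b'.
by rewrite tmul_tens -!kwM.
Qed.

Lemma kcounit1 : counit (1 : K) = 1.
Proof. by rewrite -kw0 [LHS]kcounitw /kcounit_word big_nil. Qed.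

Lemma kcounitM (x y : K) : counit (x * y) = counit x * counit y.
Proof.
have bt := @mulr_bilinear k k^o.
have lC : linear (@counit k K : K -> k^o) := kcounit_linear.
move: x y; apply: (kbilin_ext (f := fun x y => counit (x * y) : k^o)
  (g := fun x y => counit x * counit y : k^o)) => [||u v].
- exact: bilin_post (mulr_bilinear K) lC.
- exact: (bilin_comp bt lC lC).
by rewrite -kwM [LHS]kcounitw kcounit_cat -!kcounitw.
Qed.

HB.instance Definition _ := Algebra_isBialgebra.Build k (letter_hopf k n s)
  kcomul1 kcomulM kcounit1 kcounitM.

Section Anti.
Variable f : M -> M.
Hypothesis fs : forall m, f (s m) = s (f m).
Definition tletter (x : letter M n) : letter M n := (f x.1.1, x.2, x.1.2).
Definition tword (w : word) : word := rev (map tletter w).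
(** Reversing a word and transposing its letters exchanges the row relations and the
column relations. The antipode is the case f = s, the transposition f = id. *)
Definition kanti : K -> K := klift (fun w => kw (tword w)).

Lemma tword_cat u v : tword (u ++ v) = tword v ++ tword u.
Proof. by rewrite /tword map_cat rev_cat. Qed.

Lemma kanti_inv : inv (fun w => kw (tword w)).
Proof.
have E p x y q : tword (p ++ x :: y :: q) =
    tword q ++ tletter y :: tletter x :: tword p.
  by rewrite tword_cat /tword /= !rev_cons -!cats1 -!catA.
split=> p q m i j; under eq_bigr do rewrite E /tletter /= fs; rewrite tword_cat.
  by rewrite (kwi.2 _ _ (f m) j i) eq_sym.
by rewrite (kwi.1 _ _ (f m) j i) eq_sym.
Qed.

Lemma kanti_linear : linear kanti.
Proof. exact: klift_linear kanti_inv. Qed.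

Lemma kantiw w : kanti (kw w) = kw (tword w).
Proof. exact: klift_w kanti_inv w. Qed.

Lemma kantiM x y : kanti (x * y) = kanti y * kanti x.
Proof.
have mb := mulr_bilinear K; have lf := kanti_linear.
move: x y; apply: kbilin_ext => [||u v].
- exact: bilin_post mb lf.
- apply: bilinear_intro => [y|x].
    exact: linear_comp_fun lf (bilin_r _ mb).
  exact: linear_comp_fun lf (bilin_l _ mb).
by rewrite -kwM !kantiw -kwM tword_cat.
Qed.

Lemma kanti1 : kanti 1 = 1.
Proof. by rewrite -kw0 kantiw. Qed.

Lemma midsum_tword (U : nmodType) w (F : word -> word -> U) :
  midsum (tword w) F = midsum w (fun a b => F (tword b) (tword a)).
Proof.
elim: w F => [|x w IH] F //=.
rewrite /tword map_cons rev_cons -cats1 midsum_cat -/(tword w) IH /=.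
rewrite midsum_sum; apply: eq_bigr => l _; apply: eq_midsum => a b.
by rewrite /tword /= !rev_cons -!cats1.
Qed.

Lemma kanti_comul x : comul (kanti x) = tswap (tmap kanti kanti (comul x)).
Proof.
have lf := kanti_linear; have lm := tmap_linear lf lf.
have lS := @tswap_linear k K K.
move: x; apply: klin_ext => [||w].
- exact: linear_comp_fun lf kcomul_linear.
- exact: linear_comp_fun (linear_comp_fun kcomul_linear lm) lS.
rewrite kantiw [LHS]kcomulw [X in tmap _ _ X]kcomulw (midsum_lin _ _ lm) (midsum_lin _ _ lS).
rewrite midsum_tword; apply: eq_midsum => a b.
by rewrite tmap_tens // tswap_tens !kantiw.
Qed.

Lemma kanti_counit x : counit (kanti x) = counit x.
Proof.
move: x; apply: (klin_ext (f := fun x => counit (kanti x) : k^o)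
   (g := counit : K -> k^o)) => [||w].
- by apply: linear_comp_fun kanti_linear _; exact: kcounit_linear.
- exact: kcounit_linear.
rewrite kantiw [LHS]kcounitw [RHS]kcounitw /kcounit_word /tword.
rewrite (perm_big (map tletter w)) ?perm_rev //= big_map.
by apply: eq_bigr => x _; rewrite eq_sym.
Qed.

End Anti.

Definition kantipode : K -> K := kanti s.
Let fs m : s (s m) = s (s m). Proof. by []. Qed.

Lemma kantipodew w : kantipode (kw w) = kw (tword s w).
Proof. exact: kantiw. Qed.

(** The first letters of the two factors are adjacent in S(a) b and cancel by a
column relation; p and q let the induction run inside a larger word. *)
Lemma midsum_antipodel w (p q : word) :
  midsum w (fun a b => kw (p ++ tword s a ++ b ++ q)) =
  kcounit_word k w *: kw (p ++ q).
Proof.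
elim: w p q => [|[[m i] j] w IH] p q /=; first by rewrite /kcounit_word big_nil scale1r.
rewrite -midsum_sum kcounit_cons mulrC -scalerA.
transitivity (midsum w (fun a b => (i == j)%:R *: kw (p ++ tword s a ++ b ++ q))).
  apply: eq_midsum => a b; rewrite catA -(kwi.2 _ _ m i j).
  apply: eq_bigr => l _; congr kw.
  by rewrite /tword map_cons rev_cons -cats1 -!catA.
rewrite -(midsum_lin _ _ (scale_linear _)) IH !scalerA mulrC.
by [].
Qed.

(** In a S(b) the first letters are the outermost ones and cancel last. *)
Lemma midsum_antipoder w (p q : word) :
  midsum w (fun a b => kw (p ++ a ++ tword s b ++ q)) =
  kcounit_word k w *: kw (p ++ q).
Proof.
elim: w p q => [|[[m i] j] w IH] p q /=; first by rewrite /kcounit_word big_nil scale1r.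
rewrite kcounit_cons.
transitivity (\sum_(l < n) kcounit_word k w *: kw (p ++ (m, i, l) :: (s m, j, l) :: q)).
  apply: eq_bigr => l _.
  have := IH (p ++ [:: (m, i, l)]) ((s m, j, l) :: q); rewrite -catA => <-.
  apply: eq_midsum => a b; congr kw.
  by rewrite /tword map_cons rev_cons -cats1 -!catA.
by rewrite -scaler_sumr (kwi.1 _ _ m i j) scalerA mulrC.
Qed.

Lemma kantipode_linear : linear kantipode. Proof. exact: kanti_linear. Qed.

Lemma kantipodel x : tlift (fun y z => kantipode y * z) (comul x) = (counit x)%:A.
Proof.
have b : is_bilinear (fun y z : K => kantipode y * z).
  by apply: (bilin_comp (mulr_bilinear K) kantipode_linear (h := id)).
move: x; apply: klin_ext => [||w].
- exact: linear_comp_fun kcomul_linear (tlift_linear b).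
- by move=> a x y; rewrite counit_linear scalerDl scalerA.
rewrite [X in tlift _ X]kcomulw (midsum_lin _ _ (tlift_linear b)).
have := midsum_antipodel w [::] [::]; rewrite /= kw0 -kcounitw => <-.
apply: eq_midsum => a c; rewrite tlift_tens // kantipodew -kwM.
by rewrite cats0.
Qed.

Lemma kantipoder x : tlift (fun y z => y * kantipode z) (comul x) = (counit x)%:A.
Proof.
have b : is_bilinear (fun y z : K => y * kantipode z).
  by apply: (bilin_comp (mulr_bilinear K) (g := id) _ kantipode_linear).
move: x; apply: klin_ext => [||w].
- exact: linear_comp_fun kcomul_linear (tlift_linear b).
- by move=> a x y; rewrite counit_linear scalerDl scalerA.
rewrite [X in tlift _ X]kcomulw (midsum_lin _ _ (tlift_linear b)).
have := midsum_antipoder w [::] [::]; rewrite /= kw0 -kcounitw => <-.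
apply: eq_midsum => a c; rewrite tlift_tens // kantipodew -kwM.
by rewrite cats0.
Qed.

HB.instance Definition _ := Bialgebra_isHopf.Build k (letter_hopf k n s)
  kantipode_linear kantipodel kantipoder.

Lemma kw_antipode w : antipode (kw w) = kw (tword s w).
Proof. exact: kantipodew. Qed.

Lemma kw_comul w : comul (kw w) = midsum w (fun a b => kw a ⊗ kw b).
Proof. exact: kcomulw. Qed.

Lemma kw_counit w : counit (kw w) = kcounit_word k w.
Proof. exact: kcounitw. Qed.

End KHopf.

(** * Irreducible words and the diamond lemma *)

Section Diamond.
Variables (k : fieldType) (n : nat) (M : choiceType) (s : M -> M).
Variable (pivot : M -> 'I_n).
Hypotheses (s_inj : injective s) (pivotS : forall m, pivot (s m) != pivot m).
Local Notation word := (seq (letter M n)).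
Local Notation letter := (letter M n).
Local Notation comb := (seq (k * word)).

(** The row relation solved for the term whose column index is the pivot of a. *)
Definition rhs_row (a : M) (i i' : 'I_n) : comb :=
  ((i == i')%:R, [::]) ::
  [seq (-1, [:: (a, i, l); (s a, i', l)]) | l <- enum 'I_n & l != pivot a].

(** The column relation solved for the term whose row index is the pivot of s b. *)
Definition rhs_col (b : M) (j j' : 'I_n) : comb :=
  ((j == j')%:R, [::]) ::
  [seq (-1, [:: (s b, l, j); (b, l, j')]) | l <- enum 'I_n & l != pivot (s b)].

(** The pivot is that of the left type. As consecutive types have different pivots,
two row rules never overlap, and neither do two column rules. *)
Inductive rule : letter -> letter -> comb -> Prop :=
  | RowRule a i i' : rule (a, i, pivot a) (s a, i', pivot a) (rhs_row a i i')
  | ColRule b j j' : rule (s b, pivot (s b), j) (b, pivot (s b), j') (rhs_col b j j').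

Definition pick_rule (x y : letter) : option comb :=
  let: (a, i, j) := x in let: (b, i', j') := y in
  if (b == s a) && ((j == pivot a) && (j' == pivot a)) then Some (rhs_row a i i')
  else if (a == s b) && ((i == pivot a) && (i' == pivot a)) then Some (rhs_col b j j')
  else None.

Lemma pick_ruleP x y r : pick_rule x y = Some r -> rule x y r.
Proof.
case: x y => [[a i] j] [[b i'] j'] /=.
case: ifP => [/and3P[/eqP-> /eqP-> /eqP->] [<-]|_]; first exact: RowRule.
by case: ifP => // /and3P[/eqP-> /eqP-> /eqP->] [<-]; apply: ColRule.
Qed.

Lemma pick_rule_complete x y r : rule x y r -> pick_rule x y <> None.
Proof.
case=> [a i i'|b j j'] /=; first by rewrite !eqxx.
by case: ifP => //; rewrite !eqxx.
Qed.

Fixpoint find_red (w : word) : option (word * comb * word) :=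
  if w is x :: w' then
    if w' is y :: q then
      if pick_rule x y is Some r then Some ([::], r, q)
      else if find_red w' is Some (p, r, q) then Some (x :: p, r, q) else None
    else None
  else None.

Definition irr w := find_red w == None.

Lemma find_redP w p r q : find_red w = Some (p, r, q) ->
  exists x y, w = p ++ x :: y :: q /\ rule x y r.
Proof.
elim: w p r q => [|x w IH] p r q //=; case: w IH => [|y w] IH //.
case Exy: (pick_rule x y) => [r'|].
  by move=> [<- <- <-]; exists x, y; split=> //; apply: pick_ruleP.
case E: (find_red (y :: w)) => [[[p' r'] q']|] // [<- <- <-].
by have [x' [y' [-> R]]] := IH _ _ _ E; exists x', y'.
Qed.

Lemma find_red_complete p x y q r : rule x y r -> find_red (p ++ x :: y :: q) <> None.
Proof.
move=> R; elim: p => [|z p IH] /=.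
  by case: (pick_rule x y) (pick_rule_complete R).
case E: (p ++ x :: y :: q) IH => [|z' w] IH; first by case: p E.
case: (pick_rule z z') => //.
by case: (find_red (z' :: w)) IH => // [[[? ?] ?]].
Qed.

Definition letter_weight (x : letter) : nat := (x.1.2 == pivot x.1.1) + (x.2 == pivot x.1.1).

(** A numeral in base 4 with digits 1, 2, 3, one more than the number of pivot
indices of each letter. A rule either deletes two digits or lowers a digit and
changes the following one by at most 2, so it lowers the weight. *)
Fixpoint weight (w : word) : nat :=
  if w is x :: w' then ((letter_weight x).+1 * 4 ^ size w' + weight w')%N else 0%N.

Lemma weight_cat u v : weight (u ++ v) = (weight u * 4 ^ size v + weight v)%N.
Proof.
elim: u => [|x u IH] //=; rewrite IH size_cat expnD; nia.
Qed.

Lemma letter_weight_le2 x : (letter_weight x <= 2)%N.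
Proof. by rewrite /letter_weight; do 2 case: (_ == _). Qed.

Lemma weight_lt_letters p x y q x' y' : (letter_weight x' < letter_weight x)%N ->
  (weight (p ++ x' :: y' :: q) < weight (p ++ x :: y :: q))%N.
Proof.
move=> lt; rewrite !weight_cat /= ltn_add2l !expnS.
have := letter_weight_le2 y'; have := expn_gt0 4 (size q); nia.
Qed.

Lemma weight_lt_delete p x y q : (weight (p ++ q) < weight (p ++ x :: y :: q))%N.
Proof.
rewrite !weight_cat /= !expnS; have := expn_gt0 4 (size q); nia.
Qed.

Lemma rule_weight x y r c p q : rule x y r -> c \in r ->
  (weight (p ++ c.2 ++ q) < weight (p ++ x :: y :: q))%N.
Proof.
case=> [a i i'|b j j']; rewrite inE => /orP[/eqP->|/mapP[l]]; try exact: weight_lt_delete;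
  rewrite mem_filter => /andP[ne _] -> /=; apply: weight_lt_letters;
  rewrite /letter_weight /= eqxx (negPf ne); lia.
Qed.

Lemma rule_size x y r c : rule x y r -> c \in r -> size c.2 = 0%N \/ size c.2 = 2%N.
Proof.
by case=> [a i i'|b j j']; rewrite inE => /orP[/eqP->|/mapP[l _ ->]]; auto.
Qed.

Section Fun.
Variable U : lmodType k.
Implicit Types G : word -> U.

Definition apply_rhs G p (r : comb) q : U := \sum_(c <- r) c.1 *: G (p ++ c.2 ++ q).

Lemma apply_rhs_row G p q a i i' : apply_rhs G p (rhs_row a i i') q =
  (i == i')%:R *: G (p ++ q) -
  \sum_(l < n | l != pivot a) G (p ++ (a, i, l) :: (s a, i', l) :: q).
Proof.
rewrite /apply_rhs /rhs_row big_cons big_map big_filter big_enum_cond /= -sumrN.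
by congr (_ + _); apply: eq_bigr => l _; rewrite scaleN1r.
Qed.

Lemma apply_rhs_col G p q b j j' : apply_rhs G p (rhs_col b j j') q =
  (j == j')%:R *: G (p ++ q) -
  \sum_(l < n | l != pivot (s b)) G (p ++ (s b, l, j) :: (b, l, j') :: q).
Proof.
rewrite /apply_rhs /rhs_col big_cons big_map big_filter big_enum_cond /= -sumrN.
by congr (_ + _); apply: eq_bigr => l _; rewrite scaleN1r.
Qed.

Lemma row_ruleE G p q a i i' :
  G (p ++ (a, i, pivot a) :: (s a, i', pivot a) :: q) = apply_rhs G p (rhs_row a i i') q <->
  \sum_(l < n) G (p ++ (a, i, l) :: (s a, i', l) :: q) = (i == i')%:R *: G (p ++ q).
Proof.
rewrite apply_rhs_row [X in _ <-> X = _](bigD1 (pivot a)) //=.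
split=> [->|<-]; first by rewrite subrK.
by rewrite addrK.
Qed.

Lemma col_ruleE G p q b j j' :
  G (p ++ (s b, pivot (s b), j) :: (b, pivot (s b), j') :: q) = apply_rhs G p (rhs_col b j j') q <->
  \sum_(l < n) G (p ++ (s b, l, j) :: (b, l, j') :: q) = (j == j')%:R *: G (p ++ q).
Proof.
rewrite apply_rhs_col [X in _ <-> X = _](bigD1 (pivot (s b))) //=.
split=> [->|<-]; first by rewrite subrK.
by rewrite addrK.
Qed.

Definition rules_below N G := forall p x y q r, rule x y r ->
  (weight (p ++ x :: y :: q) < N)%N -> G (p ++ x :: y :: q) = apply_rhs G p r q.

Lemma rules_below_row N G p q a i i' : rules_below N G ->
  (weight (p ++ (a, i, pivot a) :: (s a, i', pivot a) :: q) < N)%N ->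
  \sum_(l < n) G (p ++ (a, i, l) :: (s a, i', l) :: q) = (i == i')%:R *: G (p ++ q).
Proof. by move=> g lt; apply/row_ruleE/g => //; apply: RowRule. Qed.

Lemma rules_below_col N G p q b j j' : rules_below N G ->
  (weight (p ++ (s b, pivot (s b), j) :: (b, pivot (s b), j') :: q) < N)%N ->
  \sum_(l < n) G (p ++ (s b, l, j) :: (b, l, j') :: q) = (j == j')%:R *: G (p ++ q).
Proof. by move=> g lt; apply/col_ruleE/g => //; apply: ColRule. Qed.

(** All ambiguities reduce to this: the corner entry of a square array is computed
from its column or from its row, the other lines having known sums with equal totals. *)
Lemma double_sum_square (T : 'I_n -> 'I_n -> U) (A B : 'I_n -> U) (k1 k2 : 'I_n) :
  (forall m, m != k2 -> \sum_(l < n) T l m = A m) ->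
  (forall l, l != k1 -> \sum_(m < n) T l m = B l) ->
  \sum_(m < n) A m = \sum_(l < n) B l ->
  A k2 - \sum_(l < n | l != k1) T l k2 = B k1 - \sum_(m < n | m != k2) T k1 m.
Proof.
move=> hA hB; rewrite (bigD1 k2) //= [RHS](bigD1 k1) //=.
rewrite -(eq_bigr _ hA) -(eq_bigr _ hB).
under eq_bigr => m _ do rewrite (bigD1 k1) //=.
under [X in _ = _ + X -> _]eq_bigr => l _ do rewrite (bigD1 k2) //=.
rewrite !big_split /= [X in _ = _ + (_ + X) -> _]exchange_big /= !addrA => /addIr e.
by apply/eqP; rewrite subr_eq addrAC eq_sym subr_eq eq_sym; apply/eqP; rewrite e.
Qed.

(** Two different rules apply to one pair of letters only if s (s a) = a. The square
is then formed by the words (a, m, l) (s a, m, l). *)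
Lemma confluent_same G p x y q r r' : rules_below (weight (p ++ x :: y :: q)) G ->
  rule x y r -> rule x y r' -> apply_rhs G p r q = apply_rhs G p r' q.
Proof.
have mixed a i i' b j j' : (a, i, pivot a) = (s b, pivot (s b), j) ->
   (s a, i', pivot a) = (b, pivot (s b), j') ->
   rules_below (weight (p ++ (a, i, pivot a) :: (s a, i', pivot a) :: q)) G ->
   apply_rhs G p (rhs_row a i i') q = apply_rhs G p (rhs_col b j j') q.
  move=> [ea ei ej]; subst a i j => - [eb ei' ej']; subst i' j'.
  rewrite eb => g; rewrite apply_rhs_row apply_rhs_col eb.
  pose T l m := G (p ++ (s b, m, l) :: (b, m, l) :: q).
  rewrite !eqxx scale1r.
  apply: (@double_sum_square T (fun _ => G (p ++ q)) (fun _ => G (p ++ q))) => // [m ne|l ne].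
    have := rules_below_row (p := p) (q := q) (a := s b) (i := m) (i' := m) g.
    rewrite eb eqxx scale1r; apply; apply: weight_lt_letters.
    by rewrite /letter_weight /= !eqxx (negPf ne).
  have := rules_below_col (p := p) (q := q) (b := b) (j := l) (j' := l) g.
  rewrite eqxx scale1r; apply; apply: weight_lt_letters.
  by rewrite /letter_weight /= !eqxx (negPf ne).
move=> g R; case: R g => [a i i'|b j j'] g R.
  move: R; move ex: (a, i, pivot a) => x0; move ey: (s a, i', pivot a) => y0 R.
  case: R ex ey => [a2 i2 i2'|b j j'] ex ey.
    by case: ex ey => -> -> _ [->].
  exact: mixed.
move: R; move ex: (s b, pivot (s b), j) => x0; move ey: (b, pivot (s b), j') => y0 R.
case: R ex ey => [a2 i2 i2'|b2 j2 j2'] ex ey.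
  by symmetry; apply: mixed => //; rewrite -ex -ey.
by case: ex ey => _ _ -> [-> _ ->].
Qed.

(** The types are a, s a, a or s b, b, s b, and the two summation indices of the
relations involved span the square. *)
Lemma confluent_overlap G p x y z q r r' : rules_below (weight (p ++ x :: y :: z :: q)) G ->
  rule x y r -> rule y z r' -> apply_rhs G p r (z :: q) = apply_rhs G (p ++ [:: x]) r' q.
Proof.
move=> g R; case: R g => [a i i'|b j j'] g R.
  move: R g; move ey: (s a, i', pivot a) => y0 R.
  case: R ey => [a2 i2 i2'|b j j'] ey g.
    by case: ey => e _ e2; have := pivotS a; rewrite e -e2 eqxx.
  case: ey => /s_inj e ei ej; subst b i' j.
  rewrite apply_rhs_row apply_rhs_col.
  pose T l m := G (p ++ (a, i, l) :: (s a, m, l) :: (a, m, j') :: q).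
  under [X in _ = _ - X]eq_bigr => m _ do rewrite -catA /=.
  rewrite -catA /=.
  apply: (@double_sum_square T (fun m => (i == m)%:R *: G (p ++ (a, m, j') :: q))
     (fun l => (l == j')%:R *: G (p ++ (a, i, l) :: q))) => // [m ne|l ne|].
  - apply: (rules_below_row g).
    have := @weight_lt_letters (p ++ [:: (a, i, pivot a)]) (s a, pivot (s a), pivot a)
      (a, pivot (s a), j') q (s a, m, pivot a) (a, m, j'); rewrite -!catA; apply.
    by rewrite /letter_weight /= !eqxx (negPf ne).
  - have := rules_below_col (p := p ++ [:: (a, i, l)]) (q := q) (b := a) (j := l) (j' := j') g.
    under eq_bigr do rewrite -catA /=; rewrite -!catA; apply.
    by apply: weight_lt_letters; rewrite /letter_weight /= eqxx (negPf ne); lia.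
  rewrite delta_sum.
  under eq_bigr => l _ do rewrite eq_sym.
  by rewrite (delta_sum j' (fun l => G (p ++ (a, i, l) :: q))).
move: R g; move ey: (b, pivot (s b), j') => y0 R.
case: R ey => [a i i'|b2 j2 j2'] ey g; last first.
  by case: ey => e e2 _; have := pivotS b; rewrite e2 -e eqxx.
case: ey => e ei ej; subst a i j'.
rewrite apply_rhs_row apply_rhs_col.
pose T l m := G (p ++ (s b, m, j) :: (b, m, l) :: (s b, i', l) :: q).
under [X in _ = _ - X]eq_bigr => m _ do rewrite -catA /=.
rewrite -catA /=; symmetry.
apply: (@double_sum_square T (fun m => (m == i')%:R *: G (p ++ (s b, m, j) :: q))
   (fun l => (j == l)%:R *: G (p ++ (s b, i', l) :: q))) => // [m ne|l ne|].
- have := rules_below_row (p := p ++ [:: (s b, m, j)]) (q := q) (a := b) (i := m) (i' := i') g.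
  under eq_bigr do rewrite -catA /=; rewrite -!catA; apply.
  by apply: weight_lt_letters; rewrite /letter_weight /= eqxx (negPf ne); lia.
- apply: (rules_below_col g).
  have := @weight_lt_letters (p ++ [:: (s b, pivot (s b), j)]) (b, pivot (s b), pivot b)
    (s b, i', pivot b) q (b, pivot (s b), l) (s b, i', l); rewrite -!catA; apply.
  by rewrite /letter_weight /= !eqxx (negPf ne); lia.
rewrite delta_sum.
under eq_bigr => l _ do rewrite eq_sym.
by rewrite (delta_sum i' (fun l => G (p ++ (s b, l, j) :: q))).
Qed.

(** Both orders of rewriting give the same double sum. *)
Lemma confluent_disjoint G p x y t x' y' q r r' :
  rules_below (weight (p ++ x :: y :: t ++ x' :: y' :: q)) G ->
  rule x y r -> rule x' y' r' ->
  apply_rhs G p r (t ++ x' :: y' :: q) = apply_rhs G (p ++ x :: y :: t) r' q.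
Proof.
move=> g R R'.
transitivity (\sum_(c <- r) \sum_(d <- r')
    (c.1 * d.1) *: G (p ++ c.2 ++ t ++ d.2 ++ q)).
  rewrite /apply_rhs big_seq [RHS]big_seq; apply: eq_bigr => c cr.
  have := g (p ++ c.2 ++ t) x' y' q r' R'; rewrite -!catA => ->.
    by rewrite /apply_rhs scaler_sumr; apply: eq_bigr => d _; rewrite scalerA -!catA.
  exact: (rule_weight _ _ R cr).
rewrite exchange_big /apply_rhs big_seq [RHS]big_seq; apply: eq_bigr => d dr /=.
rewrite -catA /=.
have := g p x y (t ++ d.2 ++ q) r R => ->.
  by rewrite /apply_rhs scaler_sumr; apply: eq_bigr => c _; rewrite scalerA mulrC.
have := rule_weight (p ++ x :: y :: t) q R' dr; rewrite -!catA /=; apply.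
Qed.

Lemma confluent G p x y q r p' x' y' q' r' :
  p ++ x :: y :: q = p' ++ x' :: y' :: q' ->
  rules_below (weight (p ++ x :: y :: q)) G ->
  rule x y r -> rule x' y' r' -> apply_rhs G p r q = apply_rhs G p' r' q'.
Proof.
wlog le : p x y q r p' x' y' q' r' / (size p <= size p')%N.
  move=> W e g R R'; case/orP: (leq_total (size p) (size p')) => le.
    exact: (W _ _ _ _ _ _ _ _ _ _ le e g R R').
  by symmetry; apply: (W _ _ _ _ _ _ _ _ _ _ le (esym e) _ R' R); rewrite -e.
move=> e g R R'.
have : p = take (size p) p'.
  have := congr1 (take (size p)) e; rewrite take_size_cat // takel_cat //.
move=> ep; have := cat_take_drop (size p) p'; rewrite -ep => ep'.
move: e; rewrite -ep' -catA => /eqP; rewrite eqseq_cat // eqxx /= => /eqP.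
case: (drop (size p) p') => [|z [|z' t]] /=.
- by case=> ex ey eq; subst x' y' q'; rewrite cats0; apply: confluent_same R R'.
- case=> ex ey eq; subst z x' q; exact: confluent_overlap R R'.
case=> ex ey eq; subst z z' q; exact: confluent_disjoint R R'.
Qed.

Variable G0 : word -> U.

(** Rewriting always takes the leftmost reducible pair; N bounds the weight of w. *)
Fixpoint nf_ext_fuel N (w : word) : U :=
  if N is N'.+1 then
    if find_red w is Some (p, r, q) then apply_rhs (nf_ext_fuel N') p r q else G0 w
  else 0.

Definition nf_ext w := nf_ext_fuel (weight w).+1 w.

Lemma nf_ext_fuel_irrelevant N N' w : (weight w < N)%N ->
  (weight w < N')%N -> nf_ext_fuel N w = nf_ext_fuel N' w.
Proof.
elim: N N' w => [|N IH] [|N'] w //= lt lt'.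
case E: (find_red w) => [[[p r] q]|] //.
have [x [y [ew R]]] := find_redP E.
rewrite /apply_rhs big_seq [RHS]big_seq; apply: eq_bigr => c cr; congr (_ *: _).
have := rule_weight p q R cr; rewrite -ew => ltc.
by apply: IH; [exact: leq_trans ltc lt | exact: leq_trans ltc lt'].

Qed.

Lemma nf_ext_reduce w p r q : find_red w = Some (p, r, q) -> nf_ext w = apply_rhs nf_ext p r q.
Proof.
move=> E; rewrite {1}/nf_ext /= E; have [x [y [ew R]]] := find_redP E.
rewrite /apply_rhs big_seq [RHS]big_seq; apply: eq_bigr => c cr; congr (_ *: _).
by apply: nf_ext_fuel_irrelevant => //; rewrite ew; apply: (rule_weight p q R cr).
Qed.

Lemma nf_ext_irr w : irr w -> nf_ext w = G0 w.
Proof. by move=> /eqP E; rewrite /nf_ext /= E. Qed.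

(** The diamond lemma: the induction on the weight makes the extension compatible
with the rules on all smaller words, which is what confluence requires. *)
Lemma nf_ext_rules N : rules_below N nf_ext.
Proof.
elim: N => [|N IH] p x y q r R // lt.
case E: (find_red (p ++ x :: y :: q)) => [[[p' r'] q']|]; last first.
  by have := @find_red_complete p _ _ q _ R.
have [x' [y' [e R']]] := find_redP E.
rewrite (nf_ext_reduce E); symmetry; apply: (confluent e _ R R').
move=> p1 x1 y1 q1 r1 R1 lt1; apply: IH => //; lia.
Qed.

(** Hence functions on irreducible words extend to the quotient, and in particular
irreducible words are linearly independent there. *)
Lemma nf_ext_invariant : rel_invariant s nf_ext.
Proof.
split=> p q m i j.
  by apply: (rules_below_row
    (@nf_ext_rules (weight (p ++ (m, i, pivot m) :: (s m, j, pivot m) :: q)).+1)).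
by apply: (rules_below_col
  (@nf_ext_rules (weight (p ++ (s m, pivot (s m), i) :: (m, pivot (s m), j) :: q)).+1)).
Qed.

(** Compatibility with the leading parts of the relations. *)
Definition homogeneous (a : word -> U) :=
  (forall p q m i j, \sum_(l < n) a (p ++ (m, i, l) :: (s m, j, l) :: q) = 0) /\
  (forall p q m i j, \sum_(l < n) a (p ++ (s m, l, i) :: (m, l, j) :: q) = 0).

(** On words of length at most N the shorter words that a rule produces have value
zero, so that G0 satisfies the full relations there and rewriting preserves it. *)
Lemma nf_ext_homogeneous N w : homogeneous G0 -> (forall v, size v != N -> G0 v = 0) ->
  (size w <= N)%N -> nf_ext w = G0 w.
Proof.
move=> [h1 h2] sup; elim: {w}(weight w).+1 {-2}w (ltnSn (weight w)) => // m IH w lt le.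
case E: (find_red w) => [[[p r] q]|]; last by apply: nf_ext_irr; apply/eqP.
rewrite (nf_ext_reduce E); have [x [y [ew R]]] := find_redP E.
have ltN : (size (p ++ q) < N)%N by move: le; rewrite ew !size_cat /=; lia.
have e0 : G0 (p ++ q) = 0 by apply: sup; rewrite neq_ltn ltN.
transitivity (apply_rhs G0 p r q).
  rewrite /apply_rhs big_seq [RHS]big_seq; apply: eq_bigr => c cr; congr (_ *: _).
  apply: IH; first by have := rule_weight p q R cr; rewrite -ew => ltc; exact: leq_trans ltc lt.
  by move: le; rewrite ew !size_cat /=; case: (rule_size R cr) => ->; lia.
rewrite ew; case: R {ew} => [a i i'|b j j'].
  by symmetry; apply/row_ruleE; rewrite h1 e0 scaler0.
by symmetry; apply/col_ruleE; rewrite h2 e0 scaler0.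
Qed.

End Fun.

Local Notation K := (letter_hopf k n s).
Local Notation kw := (@kw k n M s).

Lemma kw_rule p x y q r : rule x y r -> kw (p ++ x :: y :: q) = apply_rhs kw p r q.
Proof.
have [kr kc] := @kw_invariant k n M s.
by case=> [a i i'|b j j']; [apply/row_ruleE; apply: kr | apply/col_ruleE; apply: kc].
Qed.

(** The filtration by length; the words are required to be irreducible so that they
can be separated by their coordinates. *)
Definition deg_lt (N : nat) (x : K) := exists f : comb,
  all (fun c => irr c.2 && (size c.2 < N)%N) f /\ x = \sum_(c <- f) c.1 *: kw c.2.

Lemma deg_lt_sum N (I : eqType) (r : seq I) (a : I -> k) (F : I -> K) :
  (forall i, i \in r -> deg_lt N (F i)) -> deg_lt N (\sum_(i <- r) a i *: F i).
Proof.
elim: r => [|i r IH] h; first by exists [::]; rewrite !big_nil.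
rewrite big_cons; have [f [af ef]] := h i (mem_head _ _).
have [|g [ag eg]] := IH; first by move=> j jr; apply: h; rewrite inE jr orbT.
exists ([seq (a i * c.1, c.2) | c <- f] ++ g).
rewrite all_cat all_map ag andbT; split; first exact: af.
rewrite big_cat big_map /= ef eg scaler_sumr; congr (_ + _).
by apply: eq_bigr => c _; rewrite scalerA.
Qed.

Lemma deg_lt_kw N w : (size w < N)%N -> deg_lt N (kw w).
Proof.
elim: {w}(weight w).+1 {-2}w (ltnSn (weight w)) => // m IH w lt le.
case E: (find_red w) => [[[p r] q]|]; last first.
  exists [:: (1, w)]; rewrite big_seq1 scale1r; split=> //=.
  by rewrite /irr E eqxx le.
have [x [y [ew R]]] := find_redP E; rewrite ew (kw_rule p q R) /apply_rhs.
apply: deg_lt_sum => c cr; apply: IH.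
  by have := rule_weight p q R cr; rewrite -ew => ltc; exact: leq_trans ltc lt.
by move: le; rewrite ew !size_cat /=; case: (rule_size R cr) => ->; lia.
Qed.

Lemma deg_lt_mono N N' x : (N <= N')%N -> deg_lt N x -> deg_lt N' x.
Proof.
move=> le [f [af ->]]; exists f; split=> //; apply: sub_all af => c /andP[-> lt] /=.
exact: leq_trans le.
Qed.

Lemma deg_lt_ex x : exists N, deg_lt N x.
Proof.
exists (\max_(c <- repr x) (size c.2).+1).
rewrite [X in deg_lt _ X]kspan; apply: deg_lt_sum => c cr.
apply: deg_lt_kw.
exact: (@leq_bigmax_seq _ (repr x) xpredT (fun c : k * word => (size c.2).+1) c cr isT).
Qed.

Definition word_indic (v w : word) : k^o := (w == v)%:R.

Definition irr_coord (v : word) : K -> k^o := klift (nf_ext (word_indic v)).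

Lemma irr_coord_linear v : linear (irr_coord v).
Proof. exact: klift_linear (nf_ext_invariant _). Qed.

Lemma irr_coord_monomial v w : irr w -> irr_coord v (kw w) = (w == v)%:R.
Proof. by move=> iw; rewrite /irr_coord klift_w ?nf_ext_irr //; apply: nf_ext_invariant. Qed.

(** The functionals [irr_coord] form the dual basis of the irreducible words. *)
Lemma deg_lt_step N x : deg_lt N.+1 x ->
  (forall v, irr v -> size v = N -> irr_coord v x = 0) -> deg_lt N x.
Proof.
move=> [f [/allP af ex]] c0.
have sum_coord v : irr_coord v x = \sum_(c <- f | c.2 == v) c.1.
  rewrite ex (lin_sum _ _ _ (irr_coord_linear v)) [RHS]big_mkcond big_seq [RHS]big_seq.
  apply: eq_bigr => c cf; have /andP[ic _] := af _ cf.
  rewrite (lin_scale (irr_coord_linear v)) irr_coord_monomial //.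
  by case: eqP => _; [exact: mulr1 | exact: mulr0].
pose vs := undup [seq c.2 | c <- f].
have -> : x = \sum_(v <- vs) (irr_coord v x : k) *: kw v.
  rewrite {1}ex; transitivity (\sum_(c <- f) \sum_(v <- vs | c.2 == v) c.1 *: kw v).
    rewrite big_seq [RHS]big_seq; apply: eq_bigr => c cf.
    under eq_bigl => v do rewrite eq_sym.
    by rewrite -big_filter (@filter_pred1_uniq _ vs) ?undup_uniq ?mem_undup ?map_f ?big_seq1.
  rewrite (exchange_big_dep xpredT) //=; apply: eq_bigr => v _.
  by rewrite sum_coord scaler_suml.
rewrite (bigID (fun v => (size v < N)%N)) /= [X in _ + X](_ : _ = 0) ?addr0.
  rewrite -big_filter.
  apply: (@deg_lt_sum _ _ _ (fun v => irr_coord v x : k) kw) => v.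
  by rewrite mem_filter => /andP[lt _]; apply: deg_lt_kw.
rewrite big_seq_cond big1 // => v /andP[]; rewrite mem_undup => /mapP[c cf ->] ge.
have /andP[ic lt] := af _ cf.
rewrite c0 ?scale0r //; apply/eqP; rewrite eqn_leq -ltnS lt /= leqNgt.
exact: ge.
Qed.

End Diamond.

(** * Values of functionals at a comultiplicative matrix *)

(** Otherwise pick a nonzero row in each E x. Multiplying a linear relation between
these rows by E y isolates the coefficient of index y, so they are independent. *)
Lemma orthogonal_idempotents_vanish (k : fieldType) n (S : finType)
    (c : S -> k) (E : S -> 'M[k]_n) :
  (forall x, c x != 0) ->
  (forall x y, E x *m E y = if x == y then c x *: E x else 0) ->
  (n < #|S|)%N -> exists x, E x = 0.
Proof.
move=> c0 EE lt; case: (pickP (fun x => E x == 0)) => [x /eqP|ne]; first by exists x.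
have nz x : exists i, row i (E x) != 0.
  case: (pickP (fun i => row i (E x) != 0)) => [i|h]; first by exists i.
  have /eqP[] := ne x; apply/row_matrixP => i; rewrite row0.
  by apply/eqP/negPn; rewrite h.
pose f x := xchoose (nz x); pose y x := row (f x) (E x).
have y0 x : y x != 0 := xchooseP (nz x).
have yE x z : y x *m E z = if x == z then c x *: y x else 0.
  by rewrite /y -row_mul EE; case: eqP => [->|_]; rewrite ?row0 // linearZ.
pose Y := \matrix_(i < #|S|) y (enum_val i).
have : row_free Y.
  apply/inj_row_free => l lY.
  apply/rowP => i; rewrite [RHS]mxE.
  have : (l *m Y) *m E (enum_val i) = 0 by rewrite lY mul0mx.
  rewrite [l *m Y]mulmx_sum_row mulmx_suml (bigD1 i) //= big1 ?addr0.
    rewrite rowK -scalemxAl yE eqxx scalerA => /eqP; rewrite scaler_eq0 (negPf (y0 _)) orbF.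
    by rewrite mulf_eq0 (negPf (c0 _)) orbF => /eqP.
  move=> j /negPf ji; rewrite rowK -scalemxAl yE (inj_eq enum_val_inj) ji scaler0.
  by [].
rewrite /row_free => /eqP e; have := rank_leq_col Y; rewrite e; lia.
Qed.

Section Lists.
Variables (k : fieldType) (n : nat) (M : choiceType).
Local Notation word := (seq (letter M n)).

Definition types (w : word) : seq M := [seq x.1.1 | x <- w].
Definition rows (w : word) : seq 'I_n := [seq x.1.2 | x <- w].
Definition cols (w : word) : seq 'I_n := [seq x.2 | x <- w].
Definition mk_word (t : seq M) (I J : seq 'I_n) : word := zip (zip t I) J.

Lemma mk_wordK w : mk_word (types w) (rows w) (cols w) = w.
Proof. by elim: w => [|[[m i] j] w IH] //=; rewrite -[in RHS]IH. Qed.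

Lemma mk_word_cat t1 I1 J1 t2 I2 J2 : size I1 = size t1 -> size J1 = size t1 ->
  mk_word (t1 ++ t2) (I1 ++ I2) (J1 ++ J2) = mk_word t1 I1 J1 ++ mk_word t2 I2 J2.
Proof.
by move=> e1 e2; rewrite /mk_word zip_cat // zip_cat // size_zip e1 minnn e2.
Qed.

Lemma size_mk_word t I J : size I = size t -> size J = size t -> size (mk_word t I J) = size t.
Proof. by move=> e1 e2; rewrite /mk_word !size_zip e1 minnn e2 minnn. Qed.

Fixpoint listsum (U : nmodType) (r : nat) (F : seq 'I_n -> U) : U :=
  if r is r'.+1 then \sum_(l < n) listsum r' (fun L => F (l :: L)) else F [::].

Lemma eq_listsum (U : nmodType) r (F F' : seq 'I_n -> U) :
  (forall L, size L = r -> F L = F' L) -> listsum r F = listsum r F'.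
Proof.
elim: r F F' => [|r IH] F F' e /=; first exact: e.
by apply: eq_bigr => l _; apply: IH => L eL; apply: e; rewrite /= eL.
Qed.

Lemma listsum0 (U : nmodType) r : listsum r (fun _ => 0 : U) = 0.
Proof. by elim: r => //= r IH; apply: big1 => l _. Qed.

Lemma listsum_delta (A : seq 'I_n) (F : seq 'I_n -> k) :
  listsum (size A) (fun L => (L == A)%:R * F L) = F A.
Proof.
elim: A F => [|a A IH] F /=; first by rewrite mul1r.
rewrite (bigD1 a) //= [X in _ + X]big1 ?addr0 => [|l /negPf ne].
  rewrite -(IH (fun L => F (a :: L))); apply: eq_listsum => L _.
  by rewrite eqseq_cons eqxx.
rewrite -[RHS](listsum0 k (size A)); apply: eq_listsum => L _.
by rewrite eqseq_cons ne mul0r.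
Qed.

Lemma listsum_scale r (a : k) (F : seq 'I_n -> k) :
  listsum r (fun L => a * F L) = a * listsum r F.
Proof.
elim: r F => [|r IH] F //=; rewrite mulr_sumr; apply: eq_bigr => l _; exact: IH.
Qed.

Lemma listsum_scaler r (a : k) (F : seq 'I_n -> k) :
  listsum r (fun L => F L * a) = listsum r F * a.
Proof. by rewrite mulrC -listsum_scale; apply: eq_listsum => L _; rewrite mulrC. Qed.

Lemma midsum_listsum (U : nmodType) w
    (F : seq M -> seq 'I_n -> seq 'I_n -> seq M -> seq 'I_n -> seq 'I_n -> U) :
  midsum w (fun a b => F (types a) (rows a) (cols a) (types b) (rows b) (cols b)) =
  listsum (size w) (fun L => F (types w) (rows w) L (types w) L (cols w)).
Proof.
elim: w F => [|[[m i] j] w IH] F //=; apply: eq_bigr => l _.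
exact: (IH (fun a b c a' b' c' => F (m :: a) (i :: b) (l :: c) (m :: a') (l :: b') (j :: c'))).
Qed.

Lemma eq_midsum_size (U : nmodType) w (F F' : word -> word -> U) :
  (forall a b, size a = size w -> size b = size w -> F a b = F' a b) ->
  midsum w F = midsum w F'.
Proof.
elim: w F F' => [|x w IH] F F' e /=; first exact: e.
by apply: eq_bigr => l _; apply: IH => a b ea eb; apply: e; rewrite /= ?ea ?eb.
Qed.

End Lists.

Section Comatrix.
Variables (k : fieldType) (n : nat) (M : choiceType) (s : M -> M).
Variable (pivot : M -> 'I_n).
Hypotheses (s_inj : injective s) (pivotS : forall m, pivot (s m) != pivot m).
Local Notation word := (seq (letter M n)).
Local Notation K := (letter_hopf k n s).
Local Notation kw := (@kw k n M s).
Local Notation nf_ext a := (nf_ext (k := k) (U := k^o) s pivot (a : word -> k^o)).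
Local Notation deg_lt := (deg_lt (k := k) (s := s) pivot).
Local Notation homogeneous a := (homogeneous (k := k) (U := k^o) s (a : word -> k^o)).

Variable Y : 'I_n -> 'I_n -> K.
Hypothesis Ycomul : forall a b, comul (Y a b) = \sum_(c < n) Y a c ⊗ Y c b.
Variable N : nat.
Hypothesis Ydeg : forall a b, deg_lt N.+1 (Y a b).

Let nf_ext_linear (al : word -> k) : linear (klift (nf_ext al) : K -> k^o).
Proof. exact: klift_linear (nf_ext_invariant s_inj pivotS _). Qed.

Lemma klift_nf_ext_w (al : word -> k) w : klift (nf_ext al) (kw w) = nf_ext al w.
Proof. by apply: klift_w; apply: nf_ext_invariant. Qed.

(** The value at Y of the functional on K that extends al. As Y is comultiplicative,
Y gives an algebra map from functionals under convolution to matrices. *)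
Definition valmx (al : word -> k) : 'M[k]_n := \matrix_(a, b) klift (nf_ext al) (Y a b).

Lemma valmx_expand a b : exists2 f : seq (k * word),
  {in f, forall c, irr k s pivot c.2 && (size c.2 <= N)%N} &
  Y a b = \sum_(c <- f) c.1 *: kw c.2 /\
  forall al, valmx al a b = \sum_(c <- f) c.1 * al c.2.
Proof.
have [f [/allP af ef]] := Ydeg a b; exists f => //; split=> // al.
rewrite mxE ef (lin_sum _ _ _ (nf_ext_linear al)) big_seq [RHS]big_seq.
apply: eq_bigr => c cf; have /andP[ic _] := af _ cf.
by rewrite (lin_scale (nf_ext_linear al)) klift_nf_ext_w nf_ext_irr.
Qed.

Lemma eq_valmx al be : (forall w, (size w <= N)%N -> irr k s pivot w -> al w = be w) ->
  valmx al = valmx be.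
Proof.
move=> e; apply/matrixP => a b; have [f af [_ E]] := valmx_expand a b.
rewrite !E big_seq [RHS]big_seq; apply: eq_bigr => c cf.
by have /andP[ic lc] := af _ cf; rewrite e.
Qed.

Lemma valmx_add al be : valmx (fun w => al w + be w) = valmx al + valmx be.
Proof.
apply/matrixP => a b; have [f af [_ E]] := valmx_expand a b.
by rewrite [RHS]mxE !E -big_split; apply: eq_bigr => c _; rewrite mulrDr.
Qed.

Lemma valmx_scale x al : valmx (fun w => x * al w) = x *: valmx al.
Proof.
apply/matrixP => a b; have [f af [_ E]] := valmx_expand a b.
by rewrite [RHS]mxE !E mulr_sumr; apply: eq_bigr => c _; rewrite mulrCA.
Qed.

Lemma valmx0 : valmx (fun _ => 0) = 0.
Proof.
apply/matrixP => a b; have [f af [_ E]] := valmx_expand a b.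
by rewrite [RHS]mxE E big1 // => c _; rewrite mulr0.
Qed.

Definition stable_functional (al : word -> k) :=
  forall w, (size w <= N)%N -> nf_ext al w = al w.

(** The coproduct splits a word of length at most N into words of the same length,
on which al and be agree with their extensions. *)
Lemma valmx_mul al be ga : stable_functional al -> stable_functional be ->
  (forall w, (size w <= N)%N -> midsum w (fun a b => al a * be b) = ga w) ->
  valmx al *m valmx be = valmx ga.
Proof.
move=> oa ob E; apply/matrixP => a b; have [f af [ef ->]] := valmx_expand a b.
have bil := bilin_comp (@mulr_bilinear k k^o) (nf_ext_linear al) (nf_ext_linear be).
transitivity (tlift (fun y z => klift (nf_ext al) y * klift (nf_ext be) z : k^o) (comul (Y a b))).
  rewrite Ycomul (lin_sum _ _ _ (tlift_linear bil)) mxE; apply: eq_bigr => c _.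
  by rewrite tlift_tens // !mxE.
rewrite ef (lin_sum _ _ _ (@comul_linear k K)) (lin_sum _ _ _ (tlift_linear bil)).
rewrite big_seq [RHS]big_seq; apply: eq_bigr => c cf.
have /andP[_ lc] := af _ cf.
rewrite (lin_scale (@comul_linear k K)) (lin_scale (tlift_linear bil)) -E //.
rewrite kw_comul (midsum_lin _ _ (tlift_linear bil)); congr (_ * _).
apply: eq_midsum_size => u v eu ev; rewrite tlift_tens // !klift_nf_ext_w.
by rewrite oa ?eu // ob ?ev.
Qed.

Lemma irr_coord_valmx v a b : irr_coord pivot v (Y a b) = valmx (word_indic k v) a b.
Proof. by rewrite mxE. Qed.

(** Adjacent types (s b, b): the column relations contract the row indices there. *)
Definition ev_pair : rel M := fun a b => a == s b.
(** Adjacent types (a, s a): the row relations contract the column indices there. *)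
Definition coev_pair : rel M := fun a b => b == s a.

Definition ctr_free (E : rel M) (t : seq M) (u : seq 'I_n -> k) :=
  forall t1 a b t2 I1 I2,
  E a b -> t = t1 ++ a :: b :: t2 -> size I1 = size t1 -> size I2 = size t2 ->
  \sum_(l < n) u (I1 ++ l :: l :: I2) = 0.

Definition on_type (t : seq M) (B : seq 'I_n -> seq 'I_n -> k) (w : word) : k :=
  if types w == t then B (rows w) (cols w) else 0.

Lemma on_type_homogeneous t B :
  (forall J, size J = size t -> ctr_free ev_pair t (B^~ J)) ->
  (forall I, size I = size t -> ctr_free coev_pair t (B I)) -> homogeneous (on_type t B).
Proof.
move=> hu hq; split=> p q m i j; rewrite /on_type.
  rewrite /types /rows /cols; under eq_bigr => l _ do rewrite !map_cat /=.
  case: eqP => e; last by rewrite big1.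
  apply: (hq _ _ _ _ _ _ _ _ _ (esym e)); rewrite /coev_pair ?eqxx ?size_map //.
  by rewrite -e !size_cat /= !size_map.
rewrite /types /rows /cols; under eq_bigr => l _ do rewrite !map_cat /=.
case: eqP => e; last by rewrite big1.
apply: (hu _ _ _ _ _ _ _ _ _ (esym e)); rewrite /ev_pair ?eqxx ?size_map //.
by rewrite -e !size_cat /= !size_map.
Qed.

Lemma size_types (w : word) : size (types w) = size w. Proof. exact: size_map. Qed.

Variable t : seq M.
Hypothesis tN : size t = N.

Definition admissible (B : seq 'I_n -> seq 'I_n -> k) :=
  (forall J, size J = N -> ctr_free ev_pair t (B^~ J)) /\
  (forall I, size I = N -> ctr_free coev_pair t (B I)).

Lemma on_type_stable B : admissible B -> stable_functional (on_type t B).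
Proof.
move=> [hu hq] w lw; apply: (@nf_ext_homogeneous k n M s pivot k^o (on_type t B) N w _ _ lw).
  by apply: on_type_homogeneous; rewrite tN.
move=> v sv; rewrite /on_type; case: eqP => // e; case/eqP: sv.
by rewrite -tN -e size_types.
Qed.

Lemma valmx_type_mul B B' : admissible B -> admissible B' ->
  valmx (on_type t B) *m valmx (on_type t B') =
  valmx (on_type t (fun I J => listsum N (fun L => B I L * B' L J))).
Proof.
move=> aB aB'; apply: valmx_mul; try exact: on_type_stable.
move=> w lw; rewrite /on_type.
rewrite (midsum_listsum w (fun ta ra ca tb rb cb => (if ta == t then B ra ca else 0) *
   (if tb == t then B' rb cb else 0))).
case: eqP => e; first by rewrite -size_types e tN.
by rewrite -[RHS](listsum0 n k (size w)); apply: eq_listsum => L _; rewrite mul0r.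
Qed.

Definition rank1 (u q : seq 'I_n -> k) : seq 'I_n -> seq 'I_n -> k := fun I J => u I * q J.

Lemma ctr_free_scale E u c : ctr_free E t u -> ctr_free E t (fun I => u I * c).
Proof.
move=> h t1 a b t2 I1 I2 e1 e2 e3 e4.
by rewrite -mulr_suml (h _ _ _ _ _ _ e1 e2 e3 e4) mul0r.
Qed.

Lemma rank1_admissible u q :
  ctr_free ev_pair t u -> ctr_free coev_pair t q -> admissible (rank1 u q).
Proof.
move=> hu hq; split=> J _; first exact: ctr_free_scale.
by move=> t1 a b t2 I1 I2 e1 e2 e3 e4; rewrite -mulr_sumr (hq _ _ _ _ _ _ e1 e2 e3 e4) mulr0.
Qed.

Lemma valmx_rank1_mul u q u' q' : ctr_free ev_pair t u -> ctr_free coev_pair t q ->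
  ctr_free ev_pair t u' -> ctr_free coev_pair t q' ->
  valmx (on_type t (rank1 u q)) *m valmx (on_type t (rank1 u' q')) =
  listsum N (fun L => q L * u' L) *: valmx (on_type t (rank1 u q')).
Proof.
move=> hu hq hu' hq'; rewrite valmx_type_mul; try exact: rank1_admissible.
rewrite -valmx_scale; apply: eq_valmx => w _ _; rewrite /on_type.
case: eqP => e; last by rewrite mulr0.
rewrite /rank1 -listsum_scaler; apply: eq_listsum => L _.
by rewrite -!mulrA [LHS]mulrCA; congr (_ * _); rewrite mulrCA.
Qed.

(** Elimination: from B subtract the rank-one matrix spanned by the row and the
column of a nonzero entry. It is admissible, and the difference has one more zero row. *)
Lemma valmx_admissible0 :
  (forall u q, ctr_free ev_pair t u -> ctr_free coev_pair t q ->
     valmx (on_type t (rank1 u q)) = 0) ->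
  forall B, admissible B -> valmx (on_type t B) = 0.
Proof.
move=> h1 B.
pose nzrow (B : seq 'I_n -> seq 'I_n -> k) (I : N.-tuple 'I_n) :=
  [exists J : N.-tuple 'I_n, B I J != 0].
have [m] := ubnP #|nzrow B|; elim: m B => // m IH B lt aB.
case: (pickP (nzrow B)) => [I0 nzI0|z]; last first.
  rewrite -valmx0; apply: eq_valmx => w _ _; rewrite /on_type; case: eqP => // e.
  have sw : size w = N by rewrite -tN -e size_types.
  have sr : size (rows w) == N by rewrite size_map sw.
  have sc : size (cols w) == N by rewrite size_map sw.
  have := z (Tuple sr) => /existsP h; apply/eqP/negPn/negP => ne; apply: h.
  by exists (Tuple sc).
have /existsP[J0 b0] := nzI0; have [hu hq] := aB.
pose u I := B I J0; pose q J := B I0 J / B I0 J0.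
have lu : ctr_free ev_pair t u by apply: hu; rewrite size_tuple.
have lq : ctr_free coev_pair t q by apply: ctr_free_scale; apply: hq; rewrite size_tuple.
(* The row of I0 of B' is zero, and zero rows of B stay zero. *)
pose B' I J := B I J - u I * q J.
have -> : valmx (on_type t B) = valmx (on_type t B') + valmx (on_type t (rank1 u q)).
  rewrite -valmx_add; apply: eq_valmx => w _ _; rewrite /on_type; case: eqP => _.
    by rewrite /B' subrK.
  by rewrite addr0.
rewrite h1 // addr0; apply: IH; last first.
  have [hu' hq'] := rank1_admissible lu lq.
  split=> J sJ t1 a b t2 I1 I2 e1 e2 e3 e4; rewrite sumrB.
    by rewrite (hu _ sJ _ _ _ _ _ _ e1 e2 e3 e4) (hu' _ sJ _ _ _ _ _ _ e1 e2 e3 e4) subr0.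
  by rewrite (hq _ sJ _ _ _ _ _ _ e1 e2 e3 e4) (hq' _ sJ _ _ _ _ _ _ e1 e2 e3 e4) subr0.
rewrite ltnS in lt; apply: leq_trans lt; apply: proper_card; apply/properP; split.
  apply/subsetP => I; rewrite !unfold_in => /existsP[J]; apply: contraR => /existsPn z.
  have z' (J' : N.-tuple 'I_n) : B I J' = 0 by apply/eqP; have := z J'; rewrite negbK.
  by rewrite /B' /u (z' J) (z' J0) mul0r subr0.
exists I0; first by [].
apply/existsPn => J; rewrite negbK /B' /u /q mulrCA divff // mulr1 subrr.
by [].
Qed.

Lemma nf_ext_zero (P : pred word) (al : word -> k) :
  (forall p x y q (r : seq (k * word)) c, rule s pivot x y r -> c \in r -> P (p ++ x :: y :: q) ->
     P (p ++ c.2 ++ q)) ->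
  (forall w, P w -> al w = 0) -> forall w, P w -> nf_ext al w = 0.
Proof.
move=> hP a0 w; elim: {w}(weight pivot w).+1 {-2}w (ltnSn (weight pivot w)) => // m IH w lt Pw.
case E: (find_red k s pivot w) => [[[p r] q]|]; last by rewrite nf_ext_irr ?a0 //; apply/eqP.
rewrite (nf_ext_reduce _ E); have [x [y [ew R]]] := find_redP E.
rewrite /apply_rhs big_seq big1 // => c cr.
rewrite (IH (p ++ c.2 ++ q)) ?scaler0 //; last by apply: hP R cr _; rewrite -ew.
by have := rule_weight p q R cr; rewrite -ew => ltc; exact: leq_trans ltc lt.
Qed.

(** Words that are not longer than v, and not of its type, stay so under rewriting. *)
Lemma nf_ext_word_indic0 v w : types v = t -> (size w <= N)%N -> types w != t ->
  nf_ext (word_indic k v) w = 0.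
Proof.
move=> tv; pose P (w : word) := (size w <= N)%N && (types w != t).
move=> sw tw; apply: (@nf_ext_zero P (word_indic k v)); last by rewrite /P sw.
  move=> p x y q r c R cr /andP[le ne].
  have le' : (size (p ++ c.2 ++ q) <= N)%N.
    by move: le; rewrite !size_cat /=; case: (rule_size R cr) => ->; lia.
  rewrite /P le' /=; case: (rule_size R cr) => e.
    apply/eqP => /(congr1 size); rewrite size_types tN => e'.
    by move: le e'; rewrite !size_cat /= e; lia.
  suff -> : types (p ++ c.2 ++ q) = types (p ++ x :: y :: q) by [].
  rewrite /types !map_cat; congr (_ ++ _).
  by case: R cr e => [a i i'|b j j']; rewrite inE => /orP[/eqP->|/mapP[l _ ->]].
move=> w' /andP[_ ne]; rewrite /word_indic; case: eqP => // e.
by rewrite e tv eqxx in ne.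
Qed.

(** The coordinate functional of v vanishes on words shorter than v, so on words of
type t the relations become the contraction conditions. *)
Lemma word_indic_admissible v : types v = t ->
  admissible (fun I J => nf_ext (word_indic k v) (mk_word t I J)).
Proof.
move=> tv; have [Gr Gc] := nf_ext_invariant s_inj pivotS (word_indic k v : word -> k^o).
have small w : (size w < N)%N -> nf_ext (word_indic k v) w = 0.
  move=> lt; apply: nf_ext_word_indic0 => //; first exact: ltnW.
  by apply/eqP => e; rewrite -size_types e tN ltnn in lt.
have split3 (J : seq 'I_n) (t1 t2 : seq M) : size J = (size t1 + (size t2).+2)%N ->
    exists J1 j j' J2, [/\ J = J1 ++ j :: j' :: J2, size J1 = size t1 & size J2 = size t2].
  move=> sJ; have := cat_take_drop (size t1) J.
  have : size (take (size t1) J) = size t1 by rewrite size_takel // sJ leq_addr.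
  have : size (drop (size t1) J) = (size t2).+2 by rewrite size_drop sJ addKn.
  case: (drop _ J) => [|j [|j' J2]] //= [e2] e1 eJ.
  by exists (take (size t1) J), j, j', J2.
split=> J sJ t1 a b t2 I1 I2 /eqP eab et e1 e2.
  have [|J1 [j [j' [J2 [-> f1 f2]]]]] := split3 J t1 t2.
    by rewrite sJ -tN et size_cat.
  subst a; have E l : mk_word t (I1 ++ l :: l :: I2) (J1 ++ j :: j' :: J2) =
      mk_word t1 I1 J1 ++ (s b, l, j) :: (b, l, j') :: mk_word t2 I2 J2 by rewrite et mk_word_cat.
  under eq_bigr => l _ do rewrite E.
  rewrite (Gc (mk_word t1 I1 J1) (mk_word t2 I2 J2) b j j') small ?scaler0 //.
  by rewrite size_cat !size_mk_word // -tN et size_cat /=; lia.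
have [|J1 [j [j' [J2 [-> f1 f2]]]]] := split3 J t1 t2.
  by rewrite sJ -tN et size_cat.
subst b; have E l : mk_word t (J1 ++ j :: j' :: J2) (I1 ++ l :: l :: I2) =
    mk_word t1 J1 I1 ++ (a, j, l) :: (s a, j', l) :: mk_word t2 J2 I2 by rewrite et mk_word_cat.
under eq_bigr => l _ do rewrite E.
rewrite (Gr (mk_word t1 J1 I1) (mk_word t2 J2 I2) a j j') small ?scaler0 //.
by rewrite size_cat !size_mk_word // -tN et size_cat /=; lia.
Qed.

Lemma valmx_word_indic v : types v = t ->
  valmx (word_indic k v) =
  valmx (on_type t (fun I J => nf_ext (word_indic k v) (mk_word t I J))).
Proof.
move=> tv; apply: eq_valmx => w sw iw; rewrite /on_type.
case: eqP => [<-|/eqP ne]; first by rewrite mk_wordK nf_ext_irr.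
by rewrite -(nf_ext_irr _ iw) (nf_ext_word_indic0 tv).
Qed.

(** The pairs u x, q x give more than n orthogonal idempotents up to scalars, so one
of them has value 0; every rank-one matrix u' q' factors through it. *)
Lemma valmx_word_indic0 (S : finType) (c : S -> k) (u q : S -> seq 'I_n -> k) :
  (n < #|S|)%N -> (forall x, c x != 0) ->
  (forall x, ctr_free ev_pair t (u x)) -> (forall x, ctr_free coev_pair t (q x)) ->
  (forall x y, listsum N (fun L => q x L * u y L) = if x == y then c x else 0) ->
  forall v, types v = t -> valmx (word_indic k v) = 0.
Proof.
move=> lt c0 hu hq pair v tv; rewrite valmx_word_indic //.
apply: valmx_admissible0; last exact: word_indic_admissible.
pose E x := valmx (on_type t (rank1 (u x) (q x))).
have [|x Ex0] := orthogonal_idempotents_vanish (E := E) c0 _ lt.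
  move=> x y; rewrite /E valmx_rank1_mul // pair.
  by case: eqP => [->|_] //; rewrite scale0r.
move=> u' q' hu' hq'.
have e : valmx (on_type t (rank1 u' (q x))) *m E x *m valmx (on_type t (rank1 (u x) q')) =
    (c x * c x) *: valmx (on_type t (rank1 u' q')).
  by rewrite /E valmx_rank1_mul // pair eqxx -scalemxAl valmx_rank1_mul // pair eqxx scalerA.
move: e; rewrite Ex0 mulmx0 mul0mx => /esym/eqP.
by rewrite scaler_eq0 mulf_eq0 (negPf (c0 x)) /= => /eqP.
Qed.

End Comatrix.

(** * Biorthogonal families of contraction-free tensors *)

Section Families.
Variables (k : fieldType) (n : nat) (M : choiceType) (s : M -> M).
Implicit Types (x y : 'I_n) (t : seq M).

Fixpoint alt r x y : seq 'I_n := if r is r'.+1 then x :: alt r' y x else [::].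

Lemma size_alt r x y : size (alt r x y) = r.
Proof. by elim: r x y => //= r IH x y; rewrite IH. Qed.

Lemma alt_nostutter r x y I1 l m I2 : x != y ->
  alt r x y = I1 ++ l :: m :: I2 -> l != m.
Proof.
elim: r x y I1 => [|r IH] x y [|i I1] //= xy; last first.
  by case=> _; apply: IH; rewrite eq_sym.
by case: r {IH} => [|r] //= [<- <-].
Qed.

Lemma alt_stutter r x y I1 l I2 : x != y -> (I1 ++ l :: l :: I2 == alt r x y) = false.
Proof.
move=> xy; apply/eqP => e; have := alt_nostutter xy (esym e).
by rewrite eqxx.
Qed.

Definition indic (A : seq 'I_n) : seq 'I_n -> k := fun I => (I == A)%:R.

Lemma listsum_indic r A (F : seq 'I_n -> k) : size A = r ->
  listsum r (fun L => indic A L * F L) = F A.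
Proof. by move=> <-; apply: listsum_delta. Qed.

(** An alternating list has no two equal neighbours, and contraction only looks at
lists that have them. *)
Lemma indic_alt_ctr_free (E : rel M) t r x y : x != y -> ctr_free E t (indic (alt r x y)).
Proof.
move=> xy t1 a b t2 I1 I2 _ _ _ _; rewrite big1 // => l _.
by rewrite /indic alt_stutter.
Qed.

Lemma alt_inj r x y x' y' : (1 < r)%N ->
  (alt r x y == alt r x' y') = (x == x') && (y == y').
Proof.
case: r => [|[|r]] // _; apply/eqP/andP => [/= [-> -> _]|[/eqP-> /eqP->]] //.
Qed.

(** The indicators of the n(n-1) alternating lists, and n(n-1) > n. *)
Lemma family_ge3 r : (2 < n)%N -> (1 < r)%N ->
  exists (S : finType) (c : S -> k) (u : S -> seq 'I_n -> k),
  [/\ (n < #|S|)%N, forall z, c z != 0,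
      forall (E : rel M) t z, ctr_free E t (u z)
    & forall z w, listsum r (fun L => u z L * u w L) = if z == w then c z else 0].
Proof.
move=> n3 r2; pose S := {p : 'I_n * 'I_n | p.1 != p.2}.
exists S, (fun _ => 1), (fun z => indic (alt r (val z).1 (val z).2)); split=> [|_|E t z|z w].
- rewrite card_sig; pose i0 : 'I_n := Ordinal (ltn_trans (isT : (0 < 2)%N) n3).
  have -> : #|[pred p : 'I_n * 'I_n | p.1 != p.2]| = (n * n - n)%N.
    have := cardC [pred p : 'I_n * 'I_n | p.1 == p.2].
    rewrite card_prod card_ord.
    have -> : #|[pred p : 'I_n * 'I_n | p.1 == p.2]| = n.
      rewrite -[RHS]card_ord -(card_image (f := fun i : 'I_n => (i, i))); last by move=> i j [].
      apply: eq_card => -[i j]; rewrite !inE /=; apply/eqP/imageP => [->|[l _ [-> ->]]] //.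
      by exists j.
    by move=> <-; rewrite addKn; apply: eq_card.
  by nia.
- exact: oner_neq0.
- exact: indic_alt_ctr_free (valP z).
rewrite listsum_indic ?size_alt // /indic alt_inj //.
rewrite -[z == w]/(val z == val w); case: (val z) (val w) => [a b] [a' b'] /=.
rewrite -[(a, b) == (a', b')]/((a == a') && (b == b')).
by case: (_ && _).
Qed.

Definition head_rel (E : rel M) m t := if t is m' :: _ then E m m' else false.

(** Supported on the alternating list x y x y ... with a single error, made inside the
initial run of pairs in E. The sign alternates with the position of the error, so
that contraction at a pair cancels an error at its left against one at its right. *)
Fixpoint block_vec (E : rel M) t x y (I : seq 'I_n) : k :=
  match t, I with
  | m :: t', i :: I' =>
    if i == x then
      if head_rel E m t' then - block_vec E t' y x I' else 0
    else (I' == alt (size t') y x)%:R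
  | _, _ => 0
  end.

Lemma block_vec_ctr_free (E : rel M) t x y : x != y ->
  (forall F : 'I_n -> k, \sum_(l < n) F l = F x + F y) -> ctr_free E t (block_vec E t x y).
Proof.
move=> xy s2 t1; elim: t1 t x y xy s2 => [|m t1 IH] t x y xy s2 a b t2 I1 I2 eab -> e1 e2.
  case: I1 e1 => // _; rewrite s2 /= eqxx eab [y == x]eq_sym (negPf xy).
  by rewrite !eqseq_cons eqxx /= addNr.
case: I1 e1 => [|i I1] //= [e1]; case: eqP => _; last first.
  by rewrite big1 // => l _; rewrite alt_stutter // eq_sym.
case: (head_rel E m _); last by rewrite big1.
rewrite sumrN (IH _ y x _ _ a b t2) ?oppr0 // 1?eq_sym //.
by move=> F; rewrite s2 addrC.
Qed.

Lemma block_vec_alt (E : rel M) t x y : block_vec E t x y (alt (size t) x y) = 0.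
Proof.
elim: t x y => [|m t IH] x y //=; rewrite eqxx IH oppr0.
by case: ifP.
Qed.

Lemma block_vec_alt_swap (E : rel M) t x y : x != y -> (1 < size t)%N ->
  block_vec E t x y (alt (size t) y x) = 0.
Proof.
case: t => [|m [|m' t]] //= xy _; rewrite [y == x]eq_sym (negPf xy).
by rewrite eqseq_cons (negPf xy).
Qed.

(** The number of positions common to the initial runs of E and of E'. *)
Fixpoint block_len (E E' : rel M) t : nat :=
  if t is m :: t' then
    if head_rel E m t' && head_rel E' m t' then (block_len E E' t').+1 else 1%N
  else 0%N.

(** A common support word has its error in both runs, and contributes a squared sign. *)
Lemma block_vec_pairing (E E' : rel M) t x y : x != y ->
  (forall F : 'I_n -> k, \sum_(l < n) F l = F x + F y) ->
  listsum (size t) (fun L => block_vec E t x y L * block_vec E' t x y L) = (block_len E E' t)%:R.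
Proof.
elim: t x y => [|m t IH] x y xy s2 /=; first by rewrite mul0r.
rewrite s2 /= eqxx [y == x]eq_sym (negPf xy).
have -> : listsum (size t) (fun L : seq 'I_n =>
    (L == alt (size t) y x)%:R * (L == alt (size t) y x)%:R) = 1 :> k.
  by rewrite (listsum_indic (A := alt (size t) y x)) ?size_alt // eqxx.
rewrite addrC; case: (head_rel E m t) (head_rel E' m t) => [] [] /=;
  try by rewrite [X in _ + X](_ : _ = 0) ?addr0 // -[RHS](listsum0 n k (size t));
         apply: eq_listsum => L _; rewrite ?mul0r ?mulr0.
rewrite -natr1 addrC; congr (_ + _).
rewrite -(IH y x) 1?eq_sym //; last by move=> F; rewrite s2 addrC.
by apply: eq_listsum => L _; rewrite mulrNN.
Qed.

(** The two alternating lists and one pair of block vectors. *)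
Lemma family_2 (E E' : rel M) t x y : x != y -> (1 < size t)%N ->
  (forall F : 'I_n -> k, \sum_(l < n) F l = F x + F y) ->
  (block_len E E' t)%:R != 0 :> k ->
  exists (c : option bool -> k) (u q : option bool -> seq 'I_n -> k),
  [/\ forall z, c z != 0, forall z, ctr_free E t (u z), forall z, ctr_free E' t (q z)
    & forall z w, listsum (size t) (fun L => q z L * u w L) = if z == w then c z else 0].
Proof.
move=> xy t2 s2 c0; have yx : y != x by rewrite eq_sym.
(* The index None is for the block vectors, Some b for the two alternating lists. *)
pose A (b : bool) := if b then alt (size t) x y else alt (size t) y x.
have sA b : size (A b) = size t by case: b; rewrite /A size_alt.
have A0 F b : block_vec F t x y (A b) = 0.
  by case: b; rewrite /A ?block_vec_alt // block_vec_alt_swap.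
have lA F b : ctr_free F t (indic (A b)) by case: b; apply: indic_alt_ctr_free.
pose f (F : rel M) (z : option bool) := if z is Some b then indic (A b) else block_vec F t x y.
exists (fun z => if z is None then (block_len E E' t)%:R else 1), (f E), (f E').
split=> [[b|]|[b|]|[b|]|[b|] [b'|]] //=; rewrite ?oner_neq0 //; try exact: block_vec_ctr_free.
- rewrite listsum_indic // /indic.
  have -> : (A b == A b') = (b == b').
    by case: b b' => [] [] //; rewrite ?eqxx // /A alt_inj // ?(negPf xy) ?(negPf yx).
  by rewrite -[Some b == Some b']/(b == b'); case: eqP.
- by rewrite listsum_indic ?A0.
- under eq_listsum => L _ do rewrite mulrC.
  by rewrite listsum_indic ?A0.
rewrite -[RHS](block_vec_pairing E E' t xy s2).
by apply: eq_listsum => L _; rewrite mulrC.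
Qed.

End Families.

Section TopVanish.
Variables (k : fieldType) (n : nat) (M : choiceType) (s : M -> M).
Variable (pivot : M -> 'I_n).
Hypotheses (s_inj : injective s) (pivotS : forall m, pivot (s m) != pivot m).
Local Notation K := (letter_hopf k n s).
Hypothesis n_gt1 : (1 < n)%N.
Hypothesis tame : [\/ (2 < n)%N, (forall j, j.+1%:R != 0 :> k) | (forall m, s (s m) != m)].

Variable Y : 'I_n -> 'I_n -> K.
Hypothesis Ycomul : forall a b, comul (Y a b) = \sum_(c < n) Y a c ⊗ Y c b.

(** A pair of types lies in both relations only if s (s m) = m, and otherwise the
length is 1. In characteristic zero every positive length is invertible. *)
Lemma block_len_neq0 t : t != [::] ->
  (2 < n)%N \/ (block_len (ev_pair s) (coev_pair s) t)%:R != 0 :> k.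
Proof.
move=> t0; case: tame => [|p|d2]; [by left| |].
  right; case: t t0 => [|m t] //= _; case: ifP => _; last exact: (p 0%N).
  exact: p.
right; case: t t0 => [|m [|m' t]] //= _; rewrite ?oner_neq0 //.
case: ifP => [/andP[/eqP e1 /eqP e2]|_]; last exact: oner_neq0.
by have := d2 m'; rewrite -e1 -e2 eqxx.
Qed.

Lemma top_vanish N : (1 < N)%N ->
  (forall a b, deg_lt pivot N.+1 (Y a b)) -> (forall a b, deg_lt pivot N (Y a b)).
Proof.
move=> N1 Yd a b; apply: (deg_lt_step s_inj pivotS (Yd a b)) => v iv sv.
rewrite (irr_coord_valmx pivot Y).
suff -> : valmx pivot Y (word_indic k v) = 0 by rewrite mxE.
have sN : size (types v) = N by rewrite size_types.
have t0 : types v != [::] by rewrite -size_eq0 sN; case: (N) N1.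
have [n3|c0] := block_len_neq0 t0.
  have [S [c [u [lt c0 hu pr]]]] := family_ge3 k M n3 N1.
  by apply: (valmx_word_indic0 s_inj pivotS Ycomul Yd sN lt c0 (hu _ _) (hu _ _) pr).
case: (ltnP 2 n) => [n3|n2].
  have [S [c [u [lt c0' hu pr]]]] := family_ge3 k M n3 N1.
  by apply: (valmx_word_indic0 s_inj pivotS Ycomul Yd sN lt c0' (hu _ _) (hu _ _) pr).
pose x : 'I_n := Ordinal (ltnW n_gt1); pose y : 'I_n := Ordinal n_gt1.
have xy : x != y by [].
have s2 (F : 'I_n -> k) : \sum_(l < n) F l = F x + F y.
  rewrite (bigD1 x) //= (bigD1 y) //= big1 ?addr0 // => l /andP[/eqP lx /eqP ly].
  case: l lx ly => [[|[|l]] Hl] lx ly.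
  - by case: lx; apply: val_inj.
  - by case: ly; apply: val_inj.
  by exfalso; lia.
have [|c [u [q [c1 hu hq pr]]]] := family_2 xy _ s2 c0; first by rewrite sN.
apply: (valmx_word_indic0 s_inj pivotS Ycomul Yd sN _ c1 hu hq) => //.
  by rewrite card_option card_bool.
by rewrite -sN.
Qed.

Lemma deg_le1 a b : deg_lt pivot 2 (Y a b).
Proof.
have [N h] : exists N, forall a b, deg_lt pivot N (Y a b).
  have hx a' b' := deg_lt_ex pivot (Y a' b').
  pose f a' b' := projT1 (cid (hx a' b')).
  exists (\max_(i < n) \max_(j < n) f i j) => a' b'.
  apply: deg_lt_mono (projT2 (cid (hx a' b'))).
  apply: leq_trans (leq_bigmax a'); exact: (leq_bigmax b').
move: a b; elim: N h => [|[|[|N]] IH] h a b; try by apply: deg_lt_mono (h a b).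
apply: IH => a' b'; apply: top_vanish => //.
Qed.

End TopVanish.

(** * Comultiplicative matrices of degree at most one *)

Section Classify.
Variables (k : fieldType) (n : nat) (M : choiceType) (s : M -> M).
Variable (pivot : M -> 'I_n).
Hypotheses (s_inj : injective s) (pivotS : forall m, pivot (s m) != pivot m).
Local Notation K := (letter_hopf k n s).
Local Notation kw := (@kw k n M s).
Local Notation word := (seq (letter M n)).

Lemma deg_lt_sub N (x y : K) : deg_lt pivot N x -> deg_lt pivot N y -> deg_lt pivot N (x - y).
Proof.
move=> hx hy; have -> : x - y = \sum_(b <- [:: true; false])
    (if b then 1 else -1 : k) *: (if b then x else y).
  by rewrite big_cons big_seq1 scale1r scaleN1r.
by apply: deg_lt_sum => -[].
Qed.

Lemma deg_lt_scale N c (x : K) : deg_lt pivot N x -> deg_lt pivot N (c *: x).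
Proof.
have := @deg_lt_sum k n M s pivot N _ [:: tt] (fun _ => c) (fun _ => x).
by rewrite big_seq1 => h hx; apply: h.
Qed.

Lemma deg_lt0 (x : K) : deg_lt pivot 0 x -> x = 0.
Proof.
by case=> f [/allP af ->]; rewrite big_seq big1 // => c /af; rewrite andbF.
Qed.

Lemma irr_coord_eq0 (x : K) : deg_lt pivot 2 x ->
  irr_coord pivot [::] x = 0 -> (forall l, irr_coord pivot [:: l] x = 0) -> x = 0.
Proof.
move=> d2 h0 h1; apply: deg_lt0; apply: (deg_lt_step s_inj pivotS); last first.
  by move=> v _ /size0nil ->.
by apply: (deg_lt_step s_inj pivotS d2) => -[|l [|l' v]].
Qed.

Lemma irr_size1 (w : word) : (size w <= 1)%N -> irr k s pivot w.
Proof. by case: w => [|x [|y w]]. Qed.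

Lemma irr_coordB v (x y : K) :
  irr_coord pivot v (x - y) = irr_coord pivot v x - irr_coord pivot v y.
Proof.
have l := irr_coord_linear s_inj pivotS v.
by rewrite -scaleN1r addrC l scaleN1r addrC.
Qed.

Variable Y : 'I_n -> 'I_n -> K.
Hypothesis Ycomul : forall a b, comul (Y a b) = \sum_(c < n) Y a c ⊗ Y c b.
Hypothesis Ycounit : forall a b, counit (Y a b) = (a == b)%:R.
Hypothesis Ydeg : forall a b, deg_lt pivot 2 (Y a b).

Definition letter_val (m : M) (i j : 'I_n) : 'M[k]_n :=
  valmx pivot Y (word_indic k [:: (m, i, j)]).
Definition unit_val : 'M[k]_n := valmx pivot Y (word_indic k [::]).

Lemma stable_functional1 (al : word -> k) : stable_functional s pivot 1 al.
Proof. by move=> w lw; rewrite nf_ext_irr //; apply: irr_size1. Qed.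

(** Only letters have nonzero letter coordinates in degree at most 1, and the coproduct
of a letter is that of a comatrix entry. *)
Lemma letter_valM m i j m' i' j' :
  letter_val m i j *m letter_val m' i' j' = if (m == m') && (j == i') then letter_val m i j' else 0.
Proof.
pose c : k := ((m == m') && (j == i'))%:R.
have -> : (if (m == m') && (j == i') then letter_val m i j' else 0) = c *: letter_val m i j'.
  by rewrite /c; case: (_ && _); rewrite ?scale1r ?scale0r.
rewrite /letter_val -(valmx_scale s_inj pivotS Ydeg).
apply: (valmx_mul s_inj pivotS Ycomul Ydeg); try exact: stable_functional1.
case=> [|[[m0 i0] j0] [|y w]] // _; rewrite /word_indic /=.
  by rewrite mul0r mulr0.
under eq_bigr => l _ do rewrite !eqseq_cons !andbT !xpair_eqE.
rewrite eqseq_cons andbT !xpair_eqE.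
rewrite (bigD1 j) //= eqxx andbT big1 ?addr0 => [|l /negPf ->]; last first.
  by rewrite andbF mul0r.
rewrite /c; case: (m0 =P m) => [->|_] /=; last by rewrite mul0r mulr0.
by case: (i0 == i); case: (m == m'); case: (j == i'); case: (j0 == j');
  rewrite /= ?mul0r ?mulr0 ?mul1r.
Qed.

Lemma unit_letter_val m i j : unit_val *m letter_val m i j = 0.
Proof.
rewrite -(valmx0 s_inj pivotS Ydeg).
apply: (valmx_mul s_inj pivotS Ycomul Ydeg); try exact: stable_functional1.
case=> [|x [|y w]] // _; rewrite /word_indic /= ?mulr0 //.
by rewrite big1 // => l _; rewrite mul0r.
Qed.

(** As soon as one coordinate of type m is nonzero, so are the n orthogonal idempotents
letter_val m i i. They then sum to 1, and what they all annihilate is zero. *)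
Theorem comatrix_classification :
  (forall a b, Y a b = (a == b)%:R *: 1) \/
  exists (m : M) (E : 'I_n -> 'I_n -> 'M[k]_n),
    [/\ forall i j i' j', E i j *m E i' j' = if j == i' then E i j' else 0,
        \sum_i E i i = 1%:M, forall i, E i i != 0
      & forall a b, Y a b = \sum_i \sum_j (E i j) a b *: kw [:: (m, i, j)]].
Proof.
case: (pselect (exists m i j, letter_val m i j != 0)) => [[m [i0 [j0 nz]]]|z]; last first.
  left=> a b.
  have uE0 m i j : letter_val m i j = 0.
    by apply/eqP/negPn/negP => h; apply: z; exists m, i, j.
  have eY : Y a b = unit_val a b *: 1.
    apply/eqP; rewrite -subr_eq0; apply/eqP; apply: irr_coord_eq0.
    - apply: deg_lt_sub => //; apply: deg_lt_scale; rewrite -kw0; exact: deg_lt_kw.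
    - rewrite irr_coordB (lin_scale (irr_coord_linear s_inj pivotS _)) -kw0 irr_coord_monomial //.
      by rewrite (irr_coord_valmx pivot Y) /unit_val /GRing.scale /= mulr1 subrr.
    move=> [[m i] j].
    rewrite irr_coordB (lin_scale (irr_coord_linear s_inj pivotS _)) -kw0 irr_coord_monomial //.
    rewrite (irr_coord_valmx pivot Y) -/(letter_val m i j) uE0 mxE.
    by rewrite scaler0 subrr.
  have := Ycounit a b; rewrite eY (scalable_linear (@counit_linear k K)) /= counit1 mulr1.
  by move=> ->.
right; exists m, (letter_val m).
have nzE i : letter_val m i i != 0.
  apply: contra nz => /eqP h.
  have -> : letter_val m i0 j0 = letter_val m i0 i *m letter_val m i i *m letter_val m i j0.
    by rewrite letter_valM !eqxx /= letter_valM !eqxx.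
  by rewrite h mulmx0 mul0mx.
(* If they did not, 1 minus their sum would be one idempotent too many. *)
have sum1 : \sum_i letter_val m i i = 1%:M.
  pose S := \sum_i letter_val m i i; rewrite -/S.
  have SE i j : S *m letter_val m i j = letter_val m i j.
    rewrite mulmx_suml (bigD1 i) //= letter_valM !eqxx big1 ?addr0 // => l /negPf li.
    by rewrite letter_valM li andbF.
  have ES i j : letter_val m i j *m S = letter_val m i j.
    rewrite mulmx_sumr (bigD1 j) //= letter_valM !eqxx big1 ?addr0 // => l /negPf li.
    by rewrite letter_valM eq_sym li andbF.
  pose F (x : option 'I_n) := if x is Some i then letter_val m i i else 1%:M - S.
  have SS : S *m S = S by rewrite {2}/S mulmx_sumr; apply: eq_bigr => i _.
  have [|||[i|]] := @orthogonal_idempotents_vanish k n (option 'I_n) (fun _ => 1) F.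
  - by move=> _; apply: oner_neq0.
  - move=> [i|] [j|] /=; rewrite ?scale1r.
    + by rewrite letter_valM eqxx /= -[Some i == Some j]/(i == j); case: eqP => [->|].
    + by rewrite mulmxBr mulmx1 ES subrr.
    + by rewrite mulmxBl mul1mx SE subrr.
    by rewrite mulmxBr mulmx1 mulmxBl mul1mx SS subrr subr0.
  - by rewrite card_option card_ord.
  - by move=> /eqP h; have := nzE i; rewrite h.
  by move=> /eqP; rewrite subr_eq0 => /eqP.
(* This applies to the constant term and to the coordinates of the other types. *)
have kill (X : 'M[k]_n) : (forall i, X *m letter_val m i i = 0) -> X = 0.
  by move=> h; rewrite -[X]mulmx1 -sum1 mulmx_sumr big1.
split=> //.
  by move=> i j i' j'; rewrite letter_valM eqxx.
move=> a b; apply/eqP; rewrite -subr_eq0; apply/eqP.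
have cs v : irr_coord pivot v (\sum_i \sum_j letter_val m i j a b *: kw [:: (m, i, j)]) =
    \sum_i \sum_j letter_val m i j a b * ([:: (m, i, j)] == v)%:R.
  rewrite (lin_sum _ _ _ (irr_coord_linear s_inj pivotS _)); apply: eq_bigr => i _.
  rewrite (lin_sum _ _ _ (irr_coord_linear s_inj pivotS _)); apply: eq_bigr => j _.
  by rewrite (lin_scale (irr_coord_linear s_inj pivotS _)) irr_coord_monomial.
apply: irr_coord_eq0.
- apply: deg_lt_sub => //; rewrite pair_big /=.
  apply: (@deg_lt_sum k n M s pivot 2 _ (index_enum _) (fun p => letter_val m p.1 p.2 a b)
    (fun p => kw [:: (m, p.1, p.2)])) => p _.
  exact: deg_lt_kw.
- rewrite irr_coordB cs (irr_coord_valmx pivot Y) -/unit_val.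
  rewrite (kill unit_val) ?mxE ?sub0r; last by move=> i; apply: unit_letter_val.
  by rewrite big1 ?oppr0 // => i _; rewrite big1 // => j _; rewrite mulr0.
move=> [[m' i'] j']; rewrite irr_coordB cs (irr_coord_valmx pivot Y) -/(letter_val m' i' j').
under eq_bigr => i _ do under eq_bigr => j _ do rewrite eqseq_cons andbT !xpair_eqE.
case: (m =P m') => [<-|/eqP ne] /=.
  rewrite (bigD1 i') //= (bigD1 j') //= !eqxx mulr1 [X in _ + X + _]big1.
    rewrite addr0 big1 ?addr0 ?subrr // => i /negPf ni; rewrite big1 // => j _.
    by rewrite ni mulr0.
  by move=> j /negPf nj; rewrite nj mulr0.
rewrite (kill (letter_val m' i' j')) ?mxE ?sub0r.
  by rewrite big1 ?oppr0 // => i _; rewrite big1 // => j _; rewrite mulr0.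
by move=> i; rewrite letter_valM eq_sym (negPf ne).
Qed.

End Classify.

(** * Powers of the antipode and automorphisms of the matrix coalgebra *)

Section Twist.
Variable k : fieldType.

(** The flag b tells whether f reverses the comultiplication, and in [mtwist] the
multiplication; flags add under composition. *)
Definition ctwist (b : bool) (C D : coalgType k) (f : C -> D) : Prop :=
  [/\ linear f,
      forall x, comul (f x) = (if b then @tswap k D D else id) (tmap f f (comul x))
    & forall x, counit (f x) = counit x].

Definition mtwist (b : bool) (A B : algType k) (f : A -> B) : Prop :=
  f 1 = 1 /\ forall x y, f (x * y) = if b then f y * f x else f x * f y.

Lemma ctwist_comp b b' (C D E : coalgType k) (f : C -> D) (g : D -> E) :
  ctwist b f -> ctwist b' g -> ctwist (b (+) b') (g \o f).
Proof.
move=> [lf fD fe] [lg gD ge]; split=> [|x|x]; last by rewrite /= ge fe.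
  exact: linear_comp_fun lf lg.
rewrite /= gD fD; have lgf := linear_comp_fun lf lg.
have e y : tmap g g (tmap f f y) = tmap (g \o f) (g \o f) y by apply: tmap_comp.
by case: b b' {fD gD} => [] [] /=; rewrite -?tswap_tmap // e ?tswapK.
Qed.

Lemma mtwist_comp b b' (A B E : algType k) (f : A -> B) (g : B -> E) :
  mtwist b f -> mtwist b' g -> mtwist (b (+) b') (g \o f).
Proof.
move=> [f1 fM] [g1 gM]; split=> [|x y] /=; first by rewrite f1.
by rewrite fM; case: b b' gM {fM} => [] [] gM /=; rewrite gM.
Qed.

Lemma ctwist_id (C : coalgType k) : ctwist false (@id C).
Proof. by split=> // x; rewrite /= tmap_id. Qed.

Lemma ctwist_iter b (C : coalgType k) (f : C -> C) j :
  ctwist b f -> ctwist (b && odd j) (iter j f).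
Proof.
move=> hf; elim: j => [|j IH]; first by rewrite andbF; apply: ctwist_id.
by have := ctwist_comp IH hf; case: b {hf IH} => /=; rewrite ?addbT.
Qed.

Lemma mtwist_iter b (A : algType k) (f : A -> A) j :
  mtwist b f -> mtwist (b && odd j) (iter j f).
Proof.
move=> hf; elim: j => [|j IH]; first by rewrite andbF; split.
by have := mtwist_comp IH hf; case: b {hf IH} => /=; rewrite ?addbT.
Qed.

Lemma ctwist_inv b (C D : coalgType k) (f : C -> D) (g : D -> C) :
  cancel f g -> cancel g f -> ctwist b f -> ctwist b g.
Proof.
move=> fK gK [lf fD fe].
have lg : linear g by move=> a x y; apply: (can_inj fK); rewrite lf !gK.
split=> // x; last by rewrite -[in RHS](gK x) fe.
rewrite -[in RHS](gK x) fD.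
case: b {fD} => /=; last by rewrite tmap_comp // (tmap_id fK fK).
by rewrite -tswap_tmap // tswapK tmap_comp // (tmap_id fK fK).
Qed.

Lemma mtwist_inv b (A B : algType k) (f : A -> B) (g : B -> A) :
  cancel f g -> cancel g f -> mtwist b f -> mtwist b g.
Proof.
move=> fK gK [f1 fM]; split=> [|x y]; first by rewrite -f1 fK.
by apply: (can_inj fK); rewrite gK; case: b fM => fM; rewrite fM !gK.
Qed.

Lemma hopf_morphismE (H K : hopfType k) (f : H -> K) : hopf_morphism f <->
  [/\ ctwist false f, mtwist false f & forall x, f (antipode x) = antipode (f x)].
Proof.
split=> -[[l d e] [o m] sc]; split=> //; do ?[by split];
by split=> // x y; exact: m.
Qed.

Lemma hopf_antimorphismE (H K : hopfType k) (f : H -> K) : hopf_antimorphism f <->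
  [/\ ctwist true f, mtwist true f & forall x, f (antipode x) = antipode (f x)].
Proof.
by split; [case=> l [o m] d e sc | case=> -[l d e] [o m] sc]; split=> //; split.
Qed.

Lemma hopf_morphism_comp (H K L : hopfType k) (f : H -> K) (g : K -> L) :
  hopf_morphism f -> hopf_morphism g -> hopf_morphism (g \o f).
Proof.
move=> /hopf_morphismE[cf mf sf] /hopf_morphismE[cg mg sg]; apply/hopf_morphismE.
split; [exact: (ctwist_comp cf cg)|exact: (mtwist_comp mf mg)|].
by move=> x /=; rewrite sf sg.
Qed.

Lemma hopf_morphism_id (H : hopfType k) : hopf_morphism (@id H).
Proof. by apply/hopf_morphismE; split=> //; apply: ctwist_id. Qed.

End Twist.

Section Antipode.
Variables (k : fieldType) (H : hopfType k).
Local Notation S := (@antipode k H).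

Lemma antipode_ctwist : ctwist true S.
Proof.
split; [exact: antipode_linear|exact: antipode_comul|exact: counit_antipode].
Qed.

(** Negative powers make sense only for a bijective antipode. *)
Definition pow_defined (m : int) := 0 <= m \/ bijective S.

Lemma pow_ctwist m : pow_defined m -> ctwist (odd `|m|%N) (@antipode_pow k H m).
Proof.
case: m => j; first by move=> _; exact: ctwist_iter antipode_ctwist.
case=> // bS; have [SK KS] := antipode_invK bS.
exact: ctwist_iter (ctwist_inv SK KS antipode_ctwist).
Qed.

Lemma pow_mtwist m : mtwist true S -> pow_defined m ->
  mtwist (odd `|m|%N) (@antipode_pow k H m).
Proof.
move=> mS; case: m => j; first by move=> _; exact: mtwist_iter mS.
case=> // bS; have [SK KS] := antipode_invK bS.
exact: mtwist_iter (mtwist_inv SK KS mS).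
Qed.

Lemma pow_comm m x : pow_defined m -> antipode_pow m (S x) = S (antipode_pow m x).
Proof.
case: m => j; first by move=> _ /=; rewrite -iterSr.
case=> // bS; have [SK KS] := antipode_invK bS.
by rewrite /antipode_pow; elim: j => [|j IH]; rewrite iterS ?IH SK /= ?SK ?KS.
Qed.

Lemma pow_succ m x : pow_defined m -> antipode_pow (m + 1) x = S (antipode_pow m x).
Proof.
case: m => j; first by move=> _; rewrite -PoszD addn1.
case=> // bS; have [SK KS] := antipode_invK bS.
have -> : Negz j + 1 = - j%:Z by rewrite NegzE; lia.
by case: j => [|j] /=; rewrite KS.
Qed.

End Antipode.

Section MatrixMaps.
Variables (k : fieldType) (n : nat) (U : lmodType k).

Definition mx_extend (F : 'I_n -> 'I_n -> U) (A : mxcoalg k n) : U :=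
  \sum_(a < n) \sum_(b < n) (A : 'M_n) a b *: F a b.

Lemma mx_extend_linear F : linear (mx_extend F).
Proof.
move=> x A B; rewrite /mx_extend scaler_sumr -big_split; apply: eq_bigr => a _ /=.
rewrite scaler_sumr -big_split; apply: eq_bigr => b _ /=.
by rewrite !mxE scalerDl scalerA.
Qed.

Lemma mx_extend_gen F a b : mx_extend F (mxgen k a b) = F a b.
Proof. exact: mx_sum_delta. Qed.

End MatrixMaps.

Section MatrixCoalg.
Variables (k : fieldType) (n : nat).
Local Notation x_ := (mxgen k).

Definition comatrix (D : coalgType k) (F : 'I_n -> 'I_n -> D) :=
  (forall a b, comul (F a b) = \sum_(c < n) F a c ⊗ F c b) /\
  (forall a b, counit (F a b) = (a == b)%:R).

Lemma mx_extend_coalg (D : coalgType k) (F : 'I_n -> 'I_n -> D) :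
  comatrix F -> coalg_morphism (mx_extend F).
Proof.
move=> [FD Fe]; have lF := mx_extend_linear F; split=> //.
  apply: mx_ext.
  - exact: linear_comp_fun lF (@comul_linear k D).
  - exact: linear_comp_fun (@comul_linear k (mxcoalg k n)) (tmap_linear lF lF).
  move=> a b; rewrite mx_extend_gen FD [X in tmap _ _ X]mx_comul_gen.
  rewrite (lin_sum _ _ _ (tmap_linear lF lF)).
  by apply: eq_bigr => c _; rewrite tmap_tens // !mx_extend_gen.
apply: (mx_ext (U := k^o)).
- have lc : linear (@counit k D : D -> k^o) by exact: counit_linear.
  exact: linear_comp_fun lF lc.
- by move=> x A B; rewrite counit_linear.
by move=> a b; rewrite mx_extend_gen Fe [RHS]mx_counit_gen.
Qed.

Lemma ctwist_comatrix (D : coalgType k) b (f : mxcoalg k n -> D) : ctwist b f ->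
  comatrix (fun a c => f (if b then x_ c a else x_ a c)).
Proof.
move=> [lf fD fe]; split=> a c; last first.
  by rewrite fe; case: b {fD}; rewrite [LHS]mx_counit_gen // eq_sym.
rewrite fD; case: b {fD}; rewrite [X in tmap _ _ X]mx_comul_gen
    (lin_sum _ _ _ (tmap_linear lf lf)).
  rewrite (lin_sum _ _ _ (@tswap_linear k D D)); apply: eq_bigr => l _.
  by rewrite tmap_tens // tswap_tens.
by apply: eq_bigr => l _; rewrite tmap_tens.
Qed.

Variable E : 'I_n -> 'I_n -> 'M[k]_n.
Hypothesis EE : forall i j i' j', E i j *m E i' j' = if j == i' then E i j' else 0.
Hypothesis E1 : \sum_i E i i = 1%:M.
Hypothesis Enz : forall i, E i i != 0.

Definition unit_map (a b : 'I_n) : mxcoalg k n :=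
  \sum_(i < n) \sum_(j < n) (E i j) a b *: x_ i j.

Lemma unit_map_comatrix : comatrix unit_map.
Proof.
have lD := @comul_linear k (mxcoalg k n); split=> a b; last first.
  have lc : linear (@counit k (mxcoalg k n) : _ -> k^o) by move=> x A B; rewrite counit_linear.
  rewrite /unit_map (lin_sum _ _ _ lc).
  transitivity ((\sum_i E i i) a b); last by rewrite E1 mxE.
  rewrite summxE; apply: eq_bigr => i _; rewrite (lin_sum _ _ _ lc) (bigD1 i) //=.
  rewrite (lin_scale lc) [X in _ *: X]mx_counit_gen eqxx big1 ?addr0.
    by rewrite /GRing.scale /= mulr1.
  move=> j /negPf ji; rewrite (lin_scale lc) [X in _ *: X]mx_counit_gen eq_sym ji.
  exact: scaler0.
have lt (x : mxcoalg k n) := @tens_lin_r k (mxcoalg k n) (mxcoalg k n) x.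
have lt' (x : mxcoalg k n) := @tens_lin_l k (mxcoalg k n) (mxcoalg k n) x.
transitivity (\sum_(i < n) \sum_(j < n) \sum_(l < n) (E i j) a b *: (x_ i l ⊗ x_ l j)).
  rewrite /unit_map (lin_sum _ _ _ lD); apply: eq_bigr => i _.
  rewrite (lin_sum _ _ _ lD); apply: eq_bigr => j _.
  by rewrite (lin_scale lD) [X in _ *: X]mx_comul_gen scaler_sumr.
symmetry.
transitivity (\sum_(i < n) \sum_(l < n) \sum_(l' < n) \sum_(j < n)
    (E i l *m E l' j) a b *: (x_ i l ⊗ x_ l' j)).
  rewrite /unit_map; under eq_bigr => c _ do rewrite tens_suml.
  rewrite exchange_big; apply: eq_bigr => i _ /=.
  under eq_bigr => c _ do rewrite tens_suml.
  rewrite exchange_big; apply: eq_bigr => l _ /=.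
  under eq_bigr => c _ do rewrite tens_sumr.
  rewrite exchange_big; apply: eq_bigr => l' _ /=.
  under eq_bigr => c _ do rewrite tens_sumr.
  rewrite exchange_big; apply: eq_bigr => j _ /=.
  rewrite mxE scaler_suml; apply: eq_bigr => c _.
  by rewrite (lin_scale (lt' _)) (lin_scale (lt _)) scalerA.
apply: eq_bigr => i _; rewrite [RHS]exchange_big; apply: eq_bigr => l _ /=.
rewrite (bigD1 l) //= [X in _ + X]big1 ?addr0.
  by apply: eq_bigr => j _; rewrite EE eqxx.
move=> l' /negPf ne; rewrite big1 // => j _.
by rewrite EE eq_sym ne mxE scale0r.
Qed.

(** If row r of E i0 i0 is nonzero, the r-th rows y j of the matrices E i0 j form a basis on
which the E i j act as the standard matrix units e_ij. With g the matrix of this basis,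
E i j = g^-1 e_ij g, and the map sends A to (g^-1)^T A g^T. *)
Lemma unit_map_auto : coalg_automorphism (mx_extend unit_map).
Proof.
split; first exact: mx_extend_coalg unit_map_comatrix.
case: (posnP n) => [n0|n0].
  have z (A B : mxcoalg k n) : A = B.
    by apply/matrixP => a; exfalso; case: a => a; rewrite n0.
  by exists id.
pose i0 : 'I_n := Ordinal n0.
have [r rnz] : exists r, row r (E i0 i0) != 0.
  case: (pickP (fun r => row r (E i0 i0) != 0)) => [r|h]; first by exists r.
  have /eqP[] := Enz i0; apply/row_matrixP => r; rewrite row0.
  by apply/eqP/negPn; rewrite h.
pose y j := row r (E i0 j).
have yE j i' j' : y j *m E i' j' = if j == i' then y j' else 0.
  by rewrite /y -row_mul EE; case: eqP => _; rewrite ?row0.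
pose g := \matrix_(j < n) y j.
have gu : g \in unitmx.
  rewrite -row_free_unit; apply/inj_row_free => l lg; apply/rowP => j; rewrite [RHS]mxE.
  have : (l *m g) *m E j i0 = 0 by rewrite lg mul0mx.
  rewrite [l *m g]mulmx_sum_row mulmx_suml (bigD1 j) //= big1 ?addr0.
    rewrite rowK -scalemxAl yE eqxx => /eqP; rewrite scaler_eq0 (negPf rnz) orbF.
    by move/eqP.
  by move=> j' /negPf ne; rewrite rowK -scalemxAl yE ne scaler0.
have gE i j : E i j = invmx g *m delta_mx i j *m g.
  rewrite -mulmxA; apply: (can_inj (mulKmx gu)); rewrite mulKVmx //.
  apply/row_matrixP => l; rewrite !row_mul rowK yE.
  have -> : row l (delta_mx i j) = (l == i)%:R *: delta_mx 0 j :> 'rV[k]_n.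
    by apply/rowP => b; rewrite !mxE eqxx /=; case: (l == i); rewrite /= ?mul1r ?mul0r.
  rewrite -scalemxAl -rowE rowK; case: (l == i); by rewrite ?scale1r ?scale0r.
have um a b : unit_map a b = \matrix_(i, j) E i j a b :> 'M_n.
  rewrite [RHS]matrix_sum_delta; apply: eq_bigr => i _; apply: eq_bigr => j _.
  by rewrite mxE.
have eA (A : mxcoalg k n) : mx_extend unit_map A = (invmx g)^T *m (A : 'M_n) *m g^T :> 'M_n.
  apply/matrixP => i j; rewrite /mx_extend summxE.
  transitivity (\sum_(a < n) \sum_(b < n) (A : 'M_n) a b * (E i j) a b).
    apply: eq_bigr => a _; rewrite summxE; apply: eq_bigr => b _.
    by rewrite [LHS]mxE um mxE.
  rewrite exchange_big mxE; apply: eq_bigr => b _; rewrite !mxE mulr_suml.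
  apply: eq_bigr => a _; rewrite gE mxE (bigD1 j) //= big1 ?addr0.
    rewrite mxE (bigD1 i) //= big1 ?addr0.
      by rewrite !mxE !eqxx mulr1 mulrCA mulrA.
    by move=> c /negPf ne; rewrite !mxE ne mulr0.
  move=> c /negPf ne; rewrite mxE big1 ?mul0r // => c' _.
  by rewrite !mxE ne andbF mulr0.
exists (fun A : mxcoalg k n => g^T *m (A : 'M_n) *m (invmx g)^T : mxcoalg k n) => A.
  rewrite eA !mulmxA -trmx_mul mulVmx // trmx1 mul1mx -mulmxA -trmx_mul mulVmx //.
  by rewrite trmx1 mulmx1.
rewrite eA !mulmxA -trmx_mul mulmxV // trmx1 mul1mx -mulmxA -trmx_mul mulmxV //.
by rewrite trmx1 mulmx1.
Qed.

End MatrixCoalg.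

(** * Maps from the Hopf algebra on letters *)

Section Realize.
Variables (k : fieldType) (n : nat) (H : hopfType k).
Variables (M : choiceType) (s : M -> M).
Local Notation K := (letter_hopf k n s).
Local Notation kw := (@kw k n M s).
Local Notation word := (seq (letter M n)).

Variable X : M -> 'I_n -> 'I_n -> H.
Hypothesis Xco : forall m, comatrix (X m).
Hypothesis XS : forall m a b, antipode (X m a b) = X (s m) b a.

Definition word_image (w : word) : H := \prod_(x <- w) X x.1.1 x.1.2 x.2.

Lemma word_image_cat u v : word_image (u ++ v) = word_image u * word_image v.
Proof. exact: big_cat. Qed.

Lemma word_image_cons x w : word_image (x :: w) = X x.1.1 x.1.2 x.2 * word_image w.
Proof. exact: big_cons. Qed.

Lemma word_image_nil : word_image [::] = 1. Proof. exact: big_nil. Qed.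

(** The antipode axiom for X m i j. *)
Lemma X_row m i j : \sum_(l < n) X m i l * X (s m) j l = (i == j)%:R.
Proof.
have lS := @antipode_linear k H.
have b : is_bilinear (fun y z : H => y * antipode z).
  by apply: (bilin_comp (mulr_bilinear H) (g := id) _ lS).
have := antipoder (X m i j); rewrite (Xco m).1 (Xco m).2 (lin_sum _ _ _ (tlift_linear b)).
rewrite scaler_nat => <-; apply: eq_bigr => l _.
by rewrite tlift_tens // XS.
Qed.

Lemma X_col m i j : \sum_(l < n) X (s m) l i * X m l j = (i == j)%:R.
Proof.
have lS := @antipode_linear k H.
have b : is_bilinear (fun y z : H => antipode y * z).
  by apply: (bilin_comp (mulr_bilinear H) lS (h := id)).
have := antipodel (X m i j); rewrite (Xco m).1 (Xco m).2 (lin_sum _ _ _ (tlift_linear b)).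
rewrite scaler_nat => <-; apply: eq_bigr => l _.
by rewrite tlift_tens // XS.
Qed.

Lemma word_image_invariant : rel_invariant s word_image.
Proof.
split=> p q m i j; under eq_bigr do rewrite word_image_cat !word_image_cons /= [X in _ * X]mulrA;
  rewrite -mulr_sumr -mulr_suml word_image_cat scaler_nat.
  by rewrite X_row mulr_natl mulrnAr.
by rewrite X_col mulr_natl mulrnAr.
Qed.

Definition realize : K -> H := klift word_image.

Lemma realize_linear : linear realize. Proof. exact: klift_linear word_image_invariant. Qed.

Lemma realize_w w : realize (kw w) = word_image w.
Proof. exact: klift_w word_image_invariant w. Qed.

Lemma realize_monoid : monoid_morphism realize.
Proof.
have lr := realize_linear; split; first by rewrite -kw0 realize_w word_image_nil.
apply: kbilin_ext => [||u v].
- exact: bilin_post (mulr_bilinear K) lr.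
- exact: (bilin_comp (mulr_bilinear H) lr lr).
by rewrite -kwM !realize_w word_image_cat.
Qed.

Lemma word_image_comul w :
  comul (word_image w) = midsum w (fun a b => word_image a ⊗ word_image b).
Proof.
have bt := @tmul_bilinear k H H.
elim: w => [|[[m i] j] w IH]; first by rewrite word_image_nil comul1 /= word_image_nil.
rewrite word_image_cons comulM IH (Xco m).1 (lin_sum _ _ _ (bilin_l _ bt)) /=.
apply: eq_bigr => l _; rewrite (midsum_lin _ _ (bilin_r _ bt)).
by apply: eq_midsum => a b; rewrite tmul_tens !word_image_cons.
Qed.

Lemma word_image_counit w : counit (word_image w) = kcounit_word k w.
Proof.
elim: w => [|[[m i] j] w IH]; first by rewrite word_image_nil counit1 /kcounit_word big_nil.
by rewrite word_image_cons counitM IH (Xco m).2 kcounit_cons.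
Qed.

Lemma realize_coalg : coalg_morphism realize.
Proof.
have lr := realize_linear; have lm := tmap_linear lr lr.
split=> //.
  apply: klin_ext => [||w].
  - exact: linear_comp_fun lr (@comul_linear k H).
  - exact: linear_comp_fun (@comul_linear k K) lm.
  rewrite realize_w word_image_comul kw_comul (midsum_lin _ _ lm).
  by apply: eq_midsum => a b; rewrite tmap_tens // !realize_w.
have lH : linear (@counit k H : H -> k^o) by move=> x A B; rewrite counit_linear.
apply: (klin_ext (U := k^o)) => [||w].
- exact: linear_comp_fun lr lH.
- by move=> x A B; rewrite counit_linear.
by rewrite realize_w word_image_counit kw_counit.
Qed.

Lemma realize_hopf : hopf_morphism realize.
Proof.
split; [exact: realize_coalg|exact: realize_monoid|].
exact: bialg_antipode realize_coalg realize_monoid.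
Qed.

Lemma letter_comatrix m : comatrix (fun a b => kw [:: (m, a, b)]).
Proof.
split=> a b; first by rewrite kw_comul.
by rewrite kw_counit kcounit_cons /= /kcounit_word big_nil mulr1.
Qed.

End Realize.

Section KAnti.
Variables (k : fieldType) (n : nat) (M : choiceType) (s : M -> M).
Local Notation K := (letter_hopf k n s).

Lemma antipode_mtwistK : mtwist true (@antipode k K).
Proof.
split; first exact: antipode1.
exact: kantiM.
Qed.

Lemma kanti_id_anti : hopf_antimorphism (kanti id : K -> K).
Proof.
have fs m : s (id m) = id (s m) by [].
apply/hopf_antimorphismE; split.
- split; [exact: kanti_linear|exact: kanti_comul|exact: kanti_counit].
- by split; [exact: kanti1|exact: kantiM].
move=> x; move: x; apply: klin_ext => [||w].
- exact: linear_comp_fun (@antipode_linear k K) (kanti_linear fs).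
- exact: linear_comp_fun (kanti_linear fs) (@antipode_linear k K).
rewrite kw_antipode !kantiw // kw_antipode /tword !map_rev revK; congr kw.
by rewrite revK -!map_comp; apply: eq_map.
Qed.

(** The reversals and the transpositions cancel in pairs, and the types are shifted. *)
Lemma kiter_antipode j w :
  iter (2 * j) (@antipode k K) (kw w) =
  kw [seq (iter (2 * j) s x.1.1, x.1.2, x.2) | x <- w].
Proof.
elim: j => [|j IH].
  by rewrite muln0 /= -[in LHS](map_id w); congr kw; apply: eq_map => -[[a b] c].
rewrite mulnS iterD IH /= !kw_antipode /tword map_rev revK -!map_comp; congr kw.
Qed.

Lemma letter_hopf_finord d : (forall m, iter (2 * d) s m = m) ->
  forall x : K, iter (2 * d) antipode x = x.
Proof.
move=> sd; have lin j : linear (iter j (@antipode k K)).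
  by case: (ctwist_iter j (antipode_ctwist K)).
apply: (klin_ext (g := id)) => // w; rewrite kiter_antipode; congr kw.
rewrite -[RHS](map_id w); apply: eq_map => -[[m a] b] /=.
by rewrite sd.
Qed.

Lemma letter_hopf_bij (s' : M -> M) : cancel s s' -> cancel s' s ->
  bijective (@antipode k K).
Proof.
move=> sK s'K; have fs m : s' (s m) = s (s' m) by rewrite s'K sK.
have lS := @antipode_linear k K.
have l' : linear (kanti s' : K -> K) := @kanti_linear k n M s s' fs.
exists (kanti s') => x; move: x.
  apply: (klin_ext (g := id)) => // [|w]; first exact: linear_comp_fun lS l'.
  rewrite kw_antipode kantiw // /tword map_rev revK -map_comp; congr kw.
  by rewrite -[RHS](map_id w); apply: eq_map => -[[m a] b]; rewrite /tletter /= sK.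
apply: (klin_ext (g := id)) => // [|w]; first exact: linear_comp_fun l' lS.
rewrite kantiw // kw_antipode /tword map_rev revK -map_comp; congr kw.
by rewrite -[RHS](map_id w); apply: eq_map => -[[m a] b]; rewrite /tletter /= s'K.
Qed.

End KAnti.

(** * Endomorphisms of the free Hopf algebra *)

Section Final.
Variables (k : fieldType) (n : nat) (c : hopf_class) (H : hopfType k).
Variable i : mxcoalg k n -> H.
Hypotheses (n_gt1 : (1 < n)%N) (H_free : is_free_hopf c i).
Variables (M : choiceType) (s : M -> M) (pivot : M -> 'I_n).
Hypotheses (s_inj : injective s) (pivotS : forall m, pivot (s m) != pivot m).
Hypothesis tame : [\/ (2 < n)%N, (forall j, j.+1%:R != 0 :> k) | (forall m, s (s m) != m)].
Local Notation K := (letter_hopf k n s).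
Hypothesis Kc : in_class c K.
Variables (ex : M -> int) (m0 : M).
Hypothesis ex_defined : forall m, pow_defined H (ex m).
Hypothesis ex_succ : forall m (x : H),
  antipode_pow (ex (s m)) x = antipode (antipode_pow (ex m) x).
Hypothesis ex_parity : forall m, odd `|ex (s m)|%N = ~~ odd `|ex m|%N.
Hypothesis ex_base : ex m0 = 0.
Hypothesis ex_half : forall m, exponent_range c (ex m %/ 2)%Z /\
  pow_defined H (2 * (ex m %/ 2)%Z).

Local Notation x_ := (mxgen k).
Let Hc : in_class c H. Proof. by case: H_free. Qed.
Let ic : coalg_morphism i. Proof. by case: H_free. Qed.

Lemma hopf_uniq (L : hopfType k) (f g : H -> L) : in_class c L ->
  hopf_morphism f -> hopf_morphism g -> (forall A, f (i A) = g (i A)) -> f =1 g.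
Proof.
move=> Lc hf hg e x; have fi : coalg_morphism (fun A => f (i A)).
  case: ic => li iD ie; case: hf => -[lf fD fe] _ _; split=> [|A|A].
  - exact: linear_comp_fun li lf.
  - by rewrite fD iD tmap_comp.
  by rewrite fe ie.
case: H_free => _ _ /(_ L Lc _ fi) [g0 [_ uq]].
have ef : g0 = f by apply: uq; split.
have eg : g0 = g by apply: uq; split=> // A; exact: esym (e A).
by rewrite -ef -eg.
Qed.

Lemma hopf_ext (L : hopfType k) (f : mxcoalg k n -> L) : in_class c L ->
  coalg_morphism f -> exists2 g : H -> L, hopf_morphism g & forall A, g (i A) = f A.
Proof.
by move=> Lc cf; case: H_free => _ _ /(_ L Lc _ cf) [g [[hg e] _]]; exists g.
Qed.

Let par m := odd `|ex m|%N.
(** Transposition compensates for the odd powers of the antipode, which reverse the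
comultiplication, so that every X m is comultiplicative. *)
Let X m a b : H := antipode_pow (ex m) (i (if par m then x_ b a else x_ a b)).

Let Xco m : comatrix (X m).
Proof.
have ci : ctwist false i by case: ic => l d e; split.
exact: ctwist_comatrix (ctwist_comp ci (pow_ctwist (ex_defined m))).
Qed.

Let XS m a b : antipode (X m a b) = X (s m) b a.
Proof. by rewrite /X ex_succ /par ex_parity; case: (odd _). Qed.

Local Notation h := (realize X : K -> H).
Let hh : hopf_morphism h := realize_hopf Xco XS.

Let hX m a b : h (kw [:: (m, a, b)]) = X m a b.
Proof.
by rewrite realize_w ?word_image_cons ?word_image_nil ?mulr1.
Qed.

(** The map g comes from the universal property of H, and h g is the identity because
it fixes the generators. Properties visible on words thus descend from K to H. *)
Lemma comparison : exists g : H -> K, [/\ hopf_morphism g, cancel g h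
  & forall a b, g (i (x_ a b)) = kw [:: (m0, a, b)]].
Proof.
have [g hg gi] := hopf_ext Kc (mx_extend_coalg (letter_comatrix k n s m0)).
exists g; split=> //; last by move=> a b; rewrite gi mx_extend_gen.
apply: (hopf_uniq (g := id) Hc (hopf_morphism_comp hg hh) (hopf_morphism_id H)).
apply: mx_ext => [||a b].
- case: ic => li _ _; case: hg => -[lg _ _] _ _; case: hh => -[lh _ _] _ _.
  exact: linear_comp_fun li (linear_comp_fun lg lh).
- by case: ic.
by rewrite /= gi mx_extend_gen hX /X /par ex_base.
Qed.

Lemma antipode_mtwist : mtwist true (@antipode k H).
Proof.
have [g [hg gK gi]] := comparison; have [_ [g1 gM] gS] := hg; have [_ [h1 hM] hS] := hh.
split=> [|x y]; first exact: antipode1.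
have e z : antipode z = h (antipode (g z)) by rewrite hS gK.
by rewrite !e gM -hM; congr h; apply: (antipode_mtwistK k n s).2.
Qed.

(** Transposing letters and reversing words, transported along the retraction. *)
Lemma transpose_anti : exists TH : H -> H,
  induced_antiendo i (@mx_transpose k n) TH.
Proof.
(* The antimorphism of K is trivial on types, so it preserves the relations. *)
have [g [hg gK gi]] := comparison; exists (h \o kanti id \o g).
have [cT mT sT] := (hopf_antimorphismE _).1 (kanti_id_anti k n s).
have /hopf_morphismE[cg mg sg] := hg; have /hopf_morphismE[ch mh sh] := hh.
split.
  apply/hopf_antimorphismE; split.
  - exact: ctwist_comp cg (ctwist_comp cT ch).
  - exact: mtwist_comp mg (mtwist_comp mT mh).
  by move=> x /=; rewrite sg sT sh.
have [li _ _] := ic; have [[lg _ _] _ _] := hg; have [[lh _ _] _ _] := hh.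
have [lT _ _] := cT.
apply: mx_ext => [||a b].
- exact: linear_comp_fun li (linear_comp_fun (linear_comp_fun lg lT) lh).
- apply: linear_comp_fun li => x A B; exact: linearP.
by rewrite /= gi kantiw // hX /X /par ex_base /= mx_transpose_gen.
Qed.

Lemma pow_even_hopf t : pow_defined H (2 * t) ->
  hopf_morphism (@antipode_pow k H (2 * t)).
Proof.
move=> gt; apply/hopf_morphismE.
have e : odd `|(2 * t)%R|%N = false by rewrite abszM oddM.
split; [by rewrite -e; exact: pow_ctwist|by rewrite -e; exact: pow_mtwist antipode_mtwist gt|].
by move=> x; apply: pow_comm.
Qed.

Lemma trivial_hopf : hopf_morphism (fun x : H => (counit x)%:A : H).
Proof.
have ce := @counit_linear k H.
have lt : linear (fun x : H => (counit x)%:A : H).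
  by move=> a x y; rewrite ce scalerDl scalerA.
have t1 c1 : comul (c1%:A : H) = c1 *: (1 ⊗ 1).
  by rewrite (lin_scale (@comul_linear k H)) comul1.
have lc : linear (@counit k H : H -> k^o) by move=> a x y; rewrite ce.
split; last by move=> x; rewrite counit_antipode (lin_scale (@antipode_linear k H)) antipode1.
  split=> // x.
    rewrite t1 -{1}(counitl x).
    have bl : is_bilinear (fun y z : H => counit y *: z).
      by apply: scale_forml_bilinear; exact: ce.
    have lm := tmap_linear lt lt.
    move: (comul x); apply: (tensor_ext (f := fun z =>
       counit (tlift (fun y z : H => counit y *: z) z) *: (1 ⊗ 1))) => [||v w] //.
      move=> a y z; rewrite (tlift_linear bl) ce scalerDl scalerA.
      by [].
    rewrite tlift_tens // tmap_tens // (lin_scale lc).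
    by rewrite (lin_scale (tens_lin_l _)) (lin_scale (tens_lin_r _)) scalerA.
  by rewrite (lin_scale lc) counit1 /GRing.scale /= mulr1.
split=> [|x y]; first by rewrite counit1 scale1r.
by rewrite counitM -scalerAl mul1r scalerA.
Qed.

(** The matrix of g phi on the generators is classified by [comatrix_classification]. The
map h sends the letters of type m to the entries of X m, and the matrix units that
arise are absorbed in alpha. *)
Theorem endomorphisms (phi : H -> H) (phi_hopf : hopf_morphism phi) :
  [\/ forall x : H, phi x = (counit x)%:A,
      exists (t : int) (alpha : mxcoalg k n -> mxcoalg k n) (alphaH : H -> H),
        [/\ exponent_range c t, coalg_automorphism alpha,
            induced_endo i alpha alphaH
          & phi =1 antipode_pow (2 * t) \o alphaH]
    | exists (t : int) (alpha : mxcoalg k n -> mxcoalg k n) (alphaH TH : H -> H),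
        [/\ exponent_range c t, coalg_automorphism alpha,
            induced_endo i alpha alphaH,
            induced_antiendo i (@mx_transpose k n) TH
          & phi =1 antipode_pow (2 * t + 1) \o TH \o alphaH] ].
Proof.
have [g [hg gK gi]] := comparison.
have [li iD ie] := ic; have [[lp pD pe] _ _] := phi_hopf.
have [[lg gD ge] _ _] := hg; have [[lh _ _] _ _] := hh.
pose Y a b := g (phi (i (x_ a b))).
have cY : comatrix Y.
  have : ctwist false (g \o (phi \o i)).
    have c1 : ctwist false i by split.
    have c2 : ctwist false phi by split.
    have c3 : ctwist false g by split.
    exact: ctwist_comp (ctwist_comp c1 c2) c3.
  exact: ctwist_comatrix.
have Yd := deg_le1 s_inj pivotS n_gt1 tame cY.1.
have [triv|[m [E [EE E1 Enz eY]]]] := comatrix_classification s_inj pivotS cY.1 cY.2 Yd.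
  apply: Or31; apply: (hopf_uniq Hc phi_hopf trivial_hopf).
  apply: mx_ext => [||a b].
  - exact: linear_comp_fun li lp.
  - by case: trivial_hopf => -[lt _ _] _ _; exact: linear_comp_fun li lt.
  rewrite -[LHS]gK -/(Y a b) triv ie (lin_scale lh) [counit _]mx_counit_gen.
  by case: hh => _ [h1 _] _; rewrite h1.
pose alpha := mx_extend (unit_map E).
have aA : coalg_automorphism alpha := unit_map_auto EE E1 Enz.
have [la aD ae] := aA.1.
have [alphaH ha aHi] : exists2 f : H -> H, hopf_morphism f & forall A, f (i A) = i (alpha A).
  apply: hopf_ext => //; split=> [|A|A].
  - exact: linear_comp_fun la li.
  - by rewrite iD aD tmap_comp.
  by rewrite ie ae.
have phiX a b : phi (i (x_ a b)) = \sum_i \sum_j E i j a b *: X m i j.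
  rewrite -[LHS]gK -/(Y a b) eY (lin_sum _ _ _ lh); apply: eq_bigr => a' _.
  rewrite (lin_sum _ _ _ lh); apply: eq_bigr => b' _.
  by rewrite (lin_scale lh) hX.
have [rt gt] := ex_half m; pose t := (ex m %/ 2)%Z.
have et : ex m = 2 * t + (par m)%:Z by rewrite /par /t; lia.
have hp := pow_even_hopf gt; have [[lpow _ _] _ _] := hp.
case epar : (par m); rewrite epar in et.
  apply: Or33; have [TH [hT TiT]] := transpose_anti.
  exists t, alpha, alphaH, TH; split=> //.
  have [cT mT sT] := (hopf_antimorphismE _).1 hT.
  have [lT _ _] := cT.
  have ps (x : H) : antipode_pow (2 * t + 1) x = antipode (antipode_pow (2 * t) x).
    by apply: pow_succ; exact: gt.
  have hST : hopf_morphism (@antipode_pow k H (2 * t + 1) \o TH).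
    apply/hopf_morphismE; have [cp mp sp] := (hopf_morphismE _).1 hp.
    split.
    - have := ctwist_comp (ctwist_comp cT cp) (antipode_ctwist H).
      by congr (ctwist _ _); apply: funext => x /=; rewrite ps.
    - have := mtwist_comp (mtwist_comp mT mp) antipode_mtwist.
      by congr (mtwist _ _); apply: funext => x /=; rewrite ps.
    by move=> x /=; rewrite !ps sT sp.
  apply: (hopf_uniq Hc phi_hopf (hopf_morphism_comp ha hST)).
  have [[lST _ _] _ _] := hST; have [[laH _ _] _ _] := ha.
  apply: mx_ext => [||a b].
  - exact: linear_comp_fun li lp.
  - exact: linear_comp_fun li (linear_comp_fun laH lST).
  have TiA A : TH (i A) = i (mx_transpose A) by exact: TiT.
  rewrite phiX /= aHi TiA /alpha mx_extend_gen /unit_map.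
  have lmt : linear (@mx_transpose k n) by move=> x A B; exact: linearP.
  have [lm _ _] := pow_ctwist (ex_defined m).
  have lf := linear_comp_fun lmt (linear_comp_fun li lm).
  rewrite -[2 * t + 1]et.
  rewrite (lin_sum _ _ _ lf); apply: eq_bigr => a' _.
  rewrite (lin_sum _ _ _ lf); apply: eq_bigr => b' _.
  by rewrite (lin_scale lf) mx_transpose_gen /X epar.
apply: Or32; exists t, alpha, alphaH; split=> //.
apply: (hopf_uniq Hc phi_hopf (hopf_morphism_comp ha hp)).
have [[laH _ _] _ _] := ha.
apply: mx_ext => [||a b].
- exact: linear_comp_fun li lp.
- exact: linear_comp_fun li (linear_comp_fun laH lpow).
rewrite phiX /= aHi /alpha mx_extend_gen /unit_map.
have lf := linear_comp_fun li lpow.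
rewrite (lin_sum _ _ _ lf); apply: eq_bigr => a' _.
rewrite (lin_sum _ _ _ lf); apply: eq_bigr => b' _.
by rewrite (lin_scale lf) /X epar -/t et addr0.
Qed.

End Final.

Theorem proposition2p3 (k : fieldType) (n : nat) (c : hopf_class)
    (H : hopfType k) (i : mxcoalg k n -> H) (phi : H -> H)
    (n_gt1 : (1 < n)%N) (c_valid : valid_class c)
    (H_free : is_free_hopf c i)
    (tame : ~ [/\ c = FinOrdHopf 1, n = 2%N & exists p : nat, p \in [pchar k]])
    (phi_hopf : hopf_morphism phi) :
  [\/ forall x : H, phi x = (counit x)%:A,
      exists (t : int) (alpha : mxcoalg k n -> mxcoalg k n) (alphaH : H -> H),
        [/\ exponent_range c t, coalg_automorphism alpha,
            induced_endo i alpha alphaH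
          & phi =1 antipode_pow (2 * t) \o alphaH]
    | exists (t : int) (alpha : mxcoalg k n -> mxcoalg k n) (alphaH TH : H -> H),
        [/\ exponent_range c t, coalg_automorphism alpha,
            induced_endo i alpha alphaH,
            induced_antiendo i (@mx_transpose k n) TH
          & phi =1 antipode_pow (2 * t + 1) \o TH \o alphaH] ].
Proof.
pose col (p : bool) : 'I_n := if p then Ordinal n_gt1 else Ordinal (ltnW n_gt1).
have colN p : col (~~ p) != col p by case: p.
have Hc : in_class c H by case: H_free.
have half (j : nat) : 0 <= (j%:Z %/ 2)%Z by lia.
case: c c_valid H_free tame Hc => [|| d] /=.
- move=> _ H_free _ _.
  (* Type m stands for the m-th power of the antipode. *)
  apply: (@endomorphisms k n AllHopf H i n_gt1 H_free nat S (fun m => col (odd m))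
    _ _ _ _ Posz 0%N) => //.
  + by move=> m m' [].
  + by move=> m; apply: colN.
  + by apply: Or33 => m; apply/eqP; lia.
  + by left.
  + by move=> m; split; [exact: half|left; have := half m; lia].
- move=> _ H_free _ bS.
  have par (m : int) : odd `|(m + 1)%R|%N = ~~ odd `|m|%N.
    case: m => j; first by rewrite -PoszD addn1.
    have -> : Negz j + 1 = - j%:Z by rewrite NegzE; lia.
    by rewrite abszN /= negbK.
  apply: (@endomorphisms k n BijHopf H i n_gt1 H_free int (fun m => m + 1)
    (fun m => col (odd `|m|%N)) _ _ _ _ id 0) => //.
  + exact: addIr.
  + by move=> m; rewrite par.
  + by apply: Or33 => m; apply/eqP; lia.
  + by apply: (@letter_hopf_bij k n int _ (fun m => m - 1)) => m; rewrite ?addrK ?subrK.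
  + by right.
  + by move=> m x; apply: pow_succ; right.
  + by move=> m; split=> //; right.
move=> d0 H_free tame S2d.
have d20 : (0 < 2 * d)%N by rewrite muln_gt0.
have ordSE (m : 'I_(2 * d)) : (ordS m : nat) = (m.+1 %% (2 * d))%N by [].
have par (m : 'I_(2 * d)) : odd (m.+1 %% (2 * d)) = ~~ odd m.
  by rewrite -oddS [in RHS](divn_eq m.+1 (2 * d)) oddD !oddM /= andbF.
(* The types are the exponents modulo 2d; for d = 1 the successor is an involution. *)
apply: (@endomorphisms k n (FinOrdHopf d) H i n_gt1 H_free 'I_(2 * d) (@ordS _)
    (fun m => col (odd m)) _ _ _ _ (fun m => Posz m) (Ordinal d20)) => //.
- exact: ordS_inj.
- by move=> m; rewrite ordSE par.
- case: (ltnP 2 n) => [n3|n2]; first by apply: Or31.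
  have {}n2 : n = 2%N by apply/eqP; rewrite eqn_leq n2.
  case: (d =P 1%N) => [d1|d1].
    apply: Or32 => j; apply/negP => j0; apply: tame; split=> //; first by rewrite d1.
    exact: (natf0_pchar (ltn0Sn j) j0).
  apply: Or33 => m; apply/eqP => /(congr1 (@nat_of_ord _)); rewrite !ordSE.
  rewrite -addn1 modnDml addn1 => e.
  have := ltn_ord m; have : (1 < d)%N by lia.
  move=> d1' lt; case: (ltnP m.+2 (2 * d)) => lt2; first by move: e; rewrite modn_small //; lia.
  have : m.+2 = (2 * d)%N \/ m.+2 = (2 * d).+1 by lia.
  case=> e2; move: e; rewrite e2; first by rewrite modnn; lia.
  by rewrite -addn1 modnDl modn_small; lia.
- apply: letter_hopf_finord => m.
  have it j : (iter j (@ordS _) m : nat) = ((m + j) %% (2 * d))%N.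
    elim: j => [|j IH]; first by rewrite addn0 modn_small.
    by rewrite iterS ordSE IH -addn1 modnDml addn1 addnS.
  by apply: val_inj; rewrite /= it modnDr modn_small.
- by left.
- move=> m x; rewrite /antipode_pow ordSE -iterS.
  case: (ltnP m.+1 (2 * d)) => lt; first by rewrite modn_small.
  have -> : m.+1 = (2 * d)%N by apply/eqP; rewrite eqn_leq lt ltn_ord.
  by rewrite modnn S2d.
- by move=> m; split; [exact: half|left; have := half m; lia].
Qed.
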